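(* If a commutative ring $A$ is universal for $\mathrm{GE}_2$, then there is an exact sequence $$H_3(\mathrm{PGE}_2(A),\mathbb{Z}) \to \mathcal{P}(A) \to H_2(\mathrm{PB}_2(A),\mathbb{Z}) \to H_2(\mathrm{PGE}_2(A),\mathbb{Z}) \to \mu_2(A) \to 1.$$
   Context: Rings are commutative with $1$. The Steinberg group $\mathrm{St}(2,A)$ has generators $x_{12}(r),x_{21}(s)$ ($r,s\in A$) and relations $x_{ij}(r)x_{ij}(s)=x_{ij}(r+s)$ and $w_{ij}(u)x_{ji}(r)w_{ij}(u)^{-1}=x_{ij}(-u^2r)$ for $u\in A^\times$, where $w_{ij}(u):=x_{ij}(u)x_{ji}(-u^{-1})x_{ij}(u)$. $\mathrm{K}_2(2,A)$ is the kernel of $\mathrm{St}(2,A)\to\mathrm{GL}_2(A)$ sending $x_{12}(r)$ to $\begin{pmatrix}1&r\\ 0&1\end{pmatrix}$ and $x_{21}(r)$ to $\begin{pmatrix}1&0\\ r&1\end{pmatrix}$. With $h_{12}(u):=w_{12}(u)w_{12}(-1)$, the Steinberg symbols are $\{u,v\}=h_{12}(uv)h_{12}(u)^{-1}h_{12}(v)^{-1}$, $u,v\in A^\times$. $A$ is universal for $\mathrm{GE}_2$ if $\mathrm{K}_2(2,A)$ is generated by Steinberg symbols. $\mathrm{GE}_2(A)\le\mathrm{GL}_2(A)$ is the subgroup generated by the elementary matrices and the invertible diagonal matrices; $\mathrm{PGE}_2(A)=\mathrm{GE}_2(A)/A^\times I_2$, $\mathrm{PGL}_2(A)=\mathrm{GL}_2(A)/A^\times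 I_2$. $\mathrm{PB}_2(A)$ and $\mathrm{PT}_2(A)$ are the groups of invertible upper triangular, resp. diagonal, matrices modulo $A^\times I_2$. $\mu_2(A)=\{a\in A:a^2=1\}$. A column vector $\boldsymbol u\in A^2$ is unimodular (resp. $\mathrm{GE}_2$-unimodular) if it is the first column of a matrix in $\mathrm{GL}_2(A)$ (resp. $\mathrm{GE}_2(A)$); $\langle\boldsymbol u\rangle=\boldsymbol uA^\times$. $L_n(A^2)$ is the free abelian group on $(n+1)$-tuples $(\langle\boldsymbol v_0\rangle,\dots,\langle\boldsymbol v_n\rangle)$ of classes of unimodular vectors such that the matrix $(\boldsymbol v_i,\boldsymbol v_j)$ is invertible for all $i\ne j$; $Y_n(A^2)\subseteq L_n(A^2)$ is the subgroup generated by tuples of $\mathrm{GE}_2$-unimodular vectors. With differentials the alternating sums of the maps omitting the $i$-th entry, $L_\bullet(A^2)$ (resp. $Y_\bullet(A^2)$) is a complex of $\mathrm{PGL}_2(A)$- (resp. $\mathrm{PGE}_2(A)$-) modules. Let $Z_n^{\mathrm{GL}_2}(A^2)=\ker\partial_n^L$, $Z_n^{\mathrm{GE}_2}(A^2)=\ker\partial_n^Y$. The scissors congruence group is $\mathcal{P}(A):=H_0(\mathrm{PGL}_2(A),Z_2^{\mathrm{GL}_2}(A^2))\simeq H_0(\mathrm{PGE}_2(A),Z_2^{\mathrm{GE}_2}(A^2))$. Maps in the sequence: let $E_\bullet(A^2)$ be $0\to Z_1^{\mathrm{GE}_2}(A^2)\hookrightarrow Y_1(A^2)\xrightarrow{\partial_1}Y_0(A^2)\to0$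 (degrees $2,1,0$), which resolves $\mathbb{Z}$ via the augmentation, and let $B_\bullet\to\mathbb{Z}$ be the bar resolution of $\mathrm{PGE}_2(A)$. The double complex $B_\bullet\otimes_{\mathrm{PGE}_2(A)}E_\bullet(A^2)$ gives a spectral sequence $E^1_{p,q}=H_q(\mathrm{PGE}_2(A),E_p(A^2))\Rightarrow H_{p+q}(\mathrm{PGE}_2(A),\mathbb{Z})$, with $E^1_{0,q}\simeq H_q(\mathrm{PB}_2(A),\mathbb{Z})$, $E^1_{1,q}\simeq H_q(\mathrm{PT}_2(A),\mathbb{Z})$. For $A$ universal for $\mathrm{GE}_2$ one has $H_1(Y_\bullet(A^2))=0$, $E^2_{2,1}\simeq\mathcal{P}(A)$, $E^2_{0,2}\simeq H_2(\mathrm{PB}_2(A),\mathbb{Z})$, $E^2_{1,1}\simeq\mu_2(A)$; the map $\mathcal{P}(A)\to H_2(\mathrm{PB}_2(A),\mathbb{Z})$ is $d^2_{2,1}$ and the remaining maps are the edge maps. *)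

(* Defs.v *)
From HB Require Import structures.
From mathcomp Require Import all_boot all_algebra finmap.
From mathcomp Require Import boolp ring.
From mathcomp.multinomials Require Import monalg.

Set Implicit Arguments.
Unset Strict Implicit.
Unset Printing Implicit Defensive.

Import GRing.Theory.
Local Open Scope ring_scope.
Local Open Scope quotient_scope.

Section Homology.
Variables (U V W : zmodType) (f : {additive U -> V}) (g : {additive V -> W}).

Definition cycle_pred : {pred V} := fun x => g x == 0.

Fact cycle_pred_closed : zmod_closed cycle_pred.
Proof.
split=> [|x y]; rewrite !unfold_in ?raddf0 // => /eqP gx /eqP gy.
by rewrite raddfB gx gy subrr.
Qed.
HB.instance Definition _ := GRing.isZmodClosed.Build V cycle_pred cycle_pred_closed.

Definition cycles := {x : V | x \in cycle_pred}.
HB.instance Definition _ := SubType.on cycles.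
HB.instance Definition _ := Choice.on cycles.
HB.instance Definition _ := [SubChoice_isSubZmodule of cycles by <:].

Definition bound_pred : {pred cycles} := fun z => `[< exists u, f u = val z >].

Fact bound_pred_closed : zmod_closed bound_pred.
Proof.
split=> [|x y]; rewrite !unfold_in; first by apply/asboolP; exists 0; rewrite !raddf0.
move=> /asboolP[u fu] /asboolP[v fv]; apply/asboolP; exists (u - v).
by rewrite !raddfB fu fv.
Qed.
HB.instance Definition _ :=
  GRing.isZmodClosed.Build cycles bound_pred bound_pred_closed.

(* [ker g / (im f :&: ker g)], without requiring [g \o f = 0] *)
Definition homology := Quotient.quot bound_pred.
HB.instance Definition _ := Choice.on homology.
HB.instance Definition _ := EqQuotient.on homology.
HB.instance Definition _ := GRing.Zmodule.on homology.
HB.instance Definition _ := ZmodQuotient.on homology.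

End Homology.

Section HomologyClass.
Variables (U V W : zmodType) (f : {additive U -> V}) (g : {additive V -> W}).

Definition has_class (x : V) (h : homology f g) : Prop :=
  exists2 z : cycles g, val z = x & \pi_(homology f g) z = h.

End HomologyClass.

Section HomologyMap.
Variables (U V W U' V' W' : zmodType).
Variables (f : {additive U -> V}) (g : {additive V -> W}).
Variables (f' : {additive U' -> V'}) (g' : {additive V' -> W'}).
Variable phi : {additive V -> V'}.
Hypothesis phi_cycle : forall x, g x = 0 -> g' (phi x) = 0.
Hypothesis phi_bound : forall u, exists u', f' u' = phi (f u).

Fact cycle_map_subproof (z : cycles g) : phi (val z) \in cycle_pred g'.
Proof. by rewrite unfold_in phi_cycle //; apply/eqP; have := valP z. Qed.

Definition cycle_map (z : cycles g) : cycles g' :=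
  exist _ (phi (val z)) (cycle_map_subproof z).

Definition homology_map_fun (h : homology f g) : homology f' g' :=
  \pi_(homology f' g') (cycle_map (repr h)).

Lemma homology_map_pi z :
  homology_map_fun (\pi_(homology f g) z) = \pi_(homology f' g') (cycle_map z).
Proof.
apply/eqP; rewrite -Quotient.idealrBE unfold_in; apply/asboolP.
have : (repr (\pi_(homology f g) z) - z) \in @bound_pred _ _ _ f g.
  by rewrite Quotient.idealrBE reprK.
rewrite unfold_in => /asboolP[u]; rewrite raddfB => /= fu.
by have [u' fu'] := phi_bound u; exists u'; rewrite fu' fu !raddfB.
Qed.

Fact homology_map_additive : zmod_morphism homology_map_fun.
Proof.
move=> x y; rewrite -[x]reprK -[y]reprK -raddfB !homology_map_pi -raddfB.
by congr (\pi_(homology f' g') _); apply: val_inj; rewrite /= !raddfB.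
Qed.

Definition homology_map : {additive homology f g -> homology f' g'} :=
  HB.pack homology_map_fun
    (GRing.isZmodMorphism.Build _ _ homology_map_fun homology_map_additive).

End HomologyMap.

HB.lock Definition malg_lift (K : choiceType) (M N : zmodType)
    (F : K -> {additive M -> N}) (x : {malg M[K]}) : N :=
  \sum_(k <- msupp x) F k x@_k.
Canonical malg_lift_unlockable := Unlockable malg_lift.unlock.

Section Lift.
Variables (K : choiceType) (M N : zmodType).

Lemma malg_liftEw (F : K -> {additive M -> N}) (x : {malg M[K]}) (D : {fset K}) :
  (msupp x `<=` D)%fset -> malg_lift F x = \sum_(k <- D) F k x@_k.
Proof.
move=> sxD; rewrite unlock; apply/big_fset_incl => // k _.
by rewrite -mcoeff_eq0 => /eqP->; rewrite raddf0.
Qed.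

Fact malg_lift_additive (F : K -> {additive M -> N}) : zmod_morphism (malg_lift F).
Proof.
move=> x y; pose D := (msupp x `|` msupp y)%fset.
rewrite (@malg_liftEw _ _ D) ?msuppB_le //.
rewrite (@malg_liftEw _ x D) ?fsubsetUl // (@malg_liftEw _ y D) ?fsubsetUr //.
by rewrite -sumrB; apply: eq_bigr => k _; rewrite mcoeffB raddfB.
Qed.
HB.instance Definition _ (F : K -> {additive M -> N}) :=
  GRing.isZmodMorphism.Build {malg M[K]} N (malg_lift F) (malg_lift_additive F).

Lemma malg_liftU (F : K -> {additive M -> N}) k m : malg_lift F << m *g k >> = F k m.
Proof.
rewrite (@malg_liftEw _ _ [fset k]%fset) ?msuppU_le //.
by rewrite big_seq_fset1 mcoeffUU.
Qed.

End Lift.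

Lemma malg_additive_ext (K : choiceType) (M N : zmodType)
    (f g : {additive {malg M[K]} -> N}) :
  (forall k m, f << m *g k >> = g << m *g k >>) -> f =1 g.
Proof.
by move=> fg x; rewrite [x]monalgE !raddf_sum; apply: eq_bigr => k _; apply: fg.
Qed.

Section FreeLift.
Variables (K : choiceType) (N : zmodType).

Definition int_scale (y : N) (a : int) : N := y *~ a.

Fact int_scale_additive y : zmod_morphism (int_scale y).
Proof. by move=> a b; rewrite /int_scale mulrzBr. Qed.
HB.instance Definition _ y :=
  GRing.isZmodMorphism.Build int N (int_scale y) (int_scale_additive y).

(* [{malg int[K]}] is the free abelian group on [K] *)
Definition free_lift (f : K -> N) : {malg int[K]} -> N :=
  malg_lift (fun k => int_scale (f k)).
HB.instance Definition _ f := GRing.Additive.on (free_lift f).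

Lemma free_liftU f k a : free_lift f << a *g k >> = f k *~ a.
Proof. exact: malg_liftU. Qed.

End FreeLift.

Record gmod (G : groupType) := Gmod {
  gmod_sort :> zmodType;
  gact : G -> {additive gmod_sort -> gmod_sort};
  gact1 : forall x, gact 1%g x = x;
  gactM : forall g h x, gact (g * h)%g x = gact g (gact h x) }.
Arguments gact {G M} _ : rename.

Record gmod_hom (G : groupType) (M N : gmod G) := GmodHom {
  gmod_fun :> {additive M -> N};
  gmod_funJ : forall g x, gmod_fun (gact g x) = gact g (gmod_fun x) }.

Section TrivialModules.
Variable G : groupType.

Definition triv_int : gmod G :=
  @Gmod G int (fun _ => idfun) (fun _ => erefl) (fun _ _ _ => erefl).

Definition zero_gmod : gmod G :=
  @Gmod G 'rV[int]_0 (fun _ => idfun) (fun _ => erefl) (fun _ _ _ => erefl).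

Fact zero_homJ (M N : gmod G) g x : (\0 : M -> N) (gact g x) = gact g ((\0 : M -> N) x).
Proof. by rewrite /= raddf0. Qed.
Definition zero_hom (M N : gmod G) : gmod_hom M N := GmodHom (@zero_homJ M N).

End TrivialModules.

Section KernelModule.
Variables (G : groupType) (M N : gmod G) (f : gmod_hom M N).

Definition ker_pred : {pred M} := fun x => f x == 0.
Fact ker_pred_closed : zmod_closed ker_pred.
Proof. exact: (@cycle_pred_closed _ _ f). Qed.
HB.instance Definition _ := GRing.isZmodClosed.Build M ker_pred ker_pred_closed.

Definition ker_type := {x : M | x \in ker_pred}.
HB.instance Definition _ := SubType.on ker_type.
HB.instance Definition _ := Choice.on ker_type.
HB.instance Definition _ := [SubChoice_isSubZmodule of ker_type by <:].

Fact ker_act_subproof g (x : ker_type) : gact g (val x) \in ker_pred.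
Proof.
rewrite unfold_in gmod_funJ; have /eqP -> := valP x.
by rewrite raddf0.
Qed.
Definition ker_act g (x : ker_type) : ker_type :=
  exist _ (gact g (val x)) (ker_act_subproof g x).
Fact ker_act_additive g : zmod_morphism (ker_act g).
Proof. by move=> x y; apply: val_inj; rewrite /= !raddfB. Qed.
HB.instance Definition _ g :=
  GRing.isZmodMorphism.Build ker_type ker_type (ker_act g) (ker_act_additive g).
Fact ker_act1 x : ker_act 1%g x = x.
Proof. by apply: val_inj; rewrite /= gact1. Qed.
Fact ker_actM g h x : ker_act (g * h)%g x = ker_act g (ker_act h x).
Proof. by apply: val_inj; rewrite /= gactM. Qed.

Definition ker_gmod : gmod G := Gmod ker_act1 ker_actM.

Definition ker_incl : gmod_hom ker_gmod M :=
  @GmodHom G ker_gmod M (val : ker_type -> M) (fun _ _ => erefl).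

End KernelModule.

Section BarComplex.
Variables (G : groupType).

(* The degree-[n] part of [B_* (x)_G M]: [<< m *g t >>] stands for
   [t_0 | ... | t_(n-1)] (x) m. *)
Definition bar (M : gmod G) n := {malg M[n.-tuple G]}.

(* [bar_face i] multiplies the entries [i-1] and [i] of [t]; for the extreme
   values of [i] it drops the first, resp. the last entry. *)
Definition bar_face n (i : 'I_n.+2) (t : n.+1.-tuple G) : n.-tuple G :=
  [tuple if (j.+1 < i)%N then tnth t (widen_ord (leqnSn n) j)
         else if j.+1 == i
              then (tnth t (widen_ord (leqnSn n) j) * tnth t (lift ord0 j))%g
              else tnth t (lift ord0 j) | j < n].

(* [g b (x) m = b (x) g^-1 m] in the tensor product over [G], where the left
   [G]-modules [B_n] are turned into right ones through inversion *)
Definition bar_coef (M : gmod G) n (i : 'I_n.+2) (t : n.+1.-tuple G) :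
    {additive M -> M} :=
  if i == ord0 then gact (thead t)^-1%g else idfun.

Definition bar_d1 (M : gmod G) n (t : n.+1.-tuple G) (m : M) : bar M n :=
  \sum_(i < n.+2) << bar_coef M i t m *g bar_face i t >> *~ (-1) ^+ i.

Fact bar_d1_additive M n t : zmod_morphism (@bar_d1 M n t).
Proof.
move=> x y; rewrite /bar_d1 -sumrB; apply: eq_bigr => i _.
by rewrite -mulrzBl [bar_coef _ _ _ _]raddfB monalgUB.
Qed.
HB.instance Definition _ (M : gmod G) n t :=
  GRing.isZmodMorphism.Build M (bar M n) (@bar_d1 M n t) (@bar_d1_additive M n t).

Definition bar_d (M : gmod G) n : bar M n.+1 -> bar M n :=
  malg_lift (@bar_d1 M n).
HB.instance Definition _ (M : gmod G) n := GRing.Additive.on (@bar_d M n).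

Lemma bar_dU (M : gmod G) n t (m : M) :
  bar_d << m *g t >> =
    \sum_(i < n.+2) << bar_coef M i t m *g bar_face i t >> *~ (-1) ^+ i.
Proof. exact: malg_liftU. Qed.

Definition bar_out (M : gmod G) n : {additive bar M n -> bar M n.-1} :=
  match n with 0 => \0 | n'.+1 => @bar_d M n' end.

Definition group_homology (M : gmod G) n := homology (@bar_d M n) (bar_out M n).
HB.instance Definition _ (M : gmod G) n := Choice.on (group_homology M n).
HB.instance Definition _ (M : gmod G) n := GRing.Zmodule.on (group_homology M n).

End BarComplex.

Section BarMap.
Variables (G H : groupType) (M : gmod G) (N : gmod H).
Variables (phi : G -> H) (f : {additive M -> N}).

Definition bar_map1 n (t : n.-tuple G) (m : M) : bar N n :=
  << f m *g map_tuple phi t >>.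
Fact bar_map1_additive n t : zmod_morphism (@bar_map1 n t).
Proof. by move=> x y; rewrite /bar_map1 raddfB monalgUB. Qed.
HB.instance Definition _ n t :=
  GRing.isZmodMorphism.Build M (bar N n) (@bar_map1 n t) (@bar_map1_additive n t).

Definition bar_map n : bar M n -> bar N n := malg_lift (@bar_map1 n).
HB.instance Definition _ n := GRing.Additive.on (@bar_map n).

Lemma bar_mapU n (t : n.-tuple G) m : bar_map << m *g t >> = << f m *g map_tuple phi t >>.
Proof. exact: malg_liftU. Qed.

End BarMap.

Section BarMapHomology.
Variables (G : groupType) (M N : gmod G) (f : gmod_hom M N).

Lemma bar_map_d n x :
  bar_map idfun f (@bar_d _ M n x) = bar_d (bar_map idfun f x).
Proof.
apply: (@malg_additive_ext _ _ _ (@bar_map _ _ _ _ idfun f n \o @bar_d _ M n)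
          (@bar_d _ N n \o @bar_map _ _ _ _ idfun f n.+1)) => t m /=.
rewrite bar_mapU !bar_dU raddf_sum; apply: eq_bigr => i _.
rewrite raddfMz /= bar_mapU.
have mt k (u : k.-tuple G) : map_tuple idfun u = u.
  by apply: val_inj; rewrite /= map_id.
have cf : f (bar_coef M i t m) = bar_coef N i t (f m).
  by rewrite /bar_coef; case: (i == ord0); rewrite ?gmod_funJ.
by rewrite cf (mt _ t) (mt _ (bar_face i t)).
Qed.

Lemma bar_map_cycle n (x : bar M n) :
  bar_out M n x = 0 -> bar_out N n (bar_map idfun f x) = 0.
Proof.
case: n x => [//|n] x dx; change (bar_d (bar_map idfun f x) = 0).
by rewrite -bar_map_d (dx : bar_d x = 0) raddf0.
Qed.

Lemma bar_map_bound n (u : bar M n.+1) :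
  exists v, bar_d v = bar_map idfun f (bar_d u).
Proof. by exists (bar_map idfun f u); rewrite bar_map_d. Qed.

Definition group_homology_map n :
    {additive group_homology M n -> group_homology N n} :=
  @homology_map _ _ _ _ _ _ _ _ _ _ (@bar_map _ _ _ _ idfun f n) (@bar_map_cycle n) (@bar_map_bound n).

End BarMapHomology.

Record gconf (G : groupType) := Gconf {
  gconf_sort :> choiceType;
  gconf_rel : rel gconf_sort;
  gconf_act : G -> gconf_sort -> gconf_sort;
  gconf_act1 : forall x, gconf_act 1%g x = x;
  gconf_actM : forall g h x, gconf_act (g * h)%g x = gconf_act g (gconf_act h x);
  gconf_act_rel : forall g x y,
    gconf_rel x y -> gconf_rel (gconf_act g x) (gconf_act g y) }.
Arguments gconf_rel {G X} _ _ : rename.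
Arguments gconf_act {G X} _ _ : rename.

Section Configurations.
Variables (G : groupType) (X : gconf G).

Definition in_config n (t : n.+1.-tuple X) :=
  [forall i, forall j, (i != j) ==> gconf_rel (tnth t i) (tnth t j)].

Definition config n := {t : n.+1.-tuple X | in_config t}.
HB.instance Definition _ n := SubType.on (config n).
HB.instance Definition _ n := Choice.on (config n).

Definition face_tuple n (i : 'I_n.+2) (t : n.+2.-tuple X) : n.+1.-tuple X :=
  [tuple tnth t (lift i j) | j < n.+1].

Fact face_subproof n i (c : config n.+1) : in_config (face_tuple i (val c)).
Proof.
apply/'forall_forallP => j k; apply/implyP => jk; rewrite !tnth_mktuple.
have /'forall_forallP/(_ (lift i j) (lift i k))/implyP := valP c.
by apply; rewrite (inj_eq (@lift_inj _ i)).
Qed.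
Definition face n (i : 'I_n.+2) (c : config n.+1) : config n :=
  exist _ (face_tuple i (val c)) (face_subproof i c).

Fact config_act_subproof g n (c : config n) :
  in_config (map_tuple (gconf_act g) (val c)).
Proof.
apply/'forall_forallP => j k; apply/implyP => jk; rewrite !tnth_map.
have /'forall_forallP/(_ j k)/implyP/(_ jk) := valP c.
exact: gconf_act_rel.
Qed.
Definition config_act g n (c : config n) : config n :=
  exist _ (map_tuple (gconf_act g) (val c)) (config_act_subproof g c).

Lemma config_act1 n (c : config n) : config_act 1%g c = c.
Proof.
by apply: val_inj; apply: eq_from_tnth => i; rewrite tnth_map gconf_act1.
Qed.

Lemma config_actM g h n (c : config n) :
  config_act (g * h)%g c = config_act g (config_act h c).
Proof.
by apply: val_inj; apply: eq_from_tnth => i; rewrite !tnth_map gconf_actM.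
Qed.

Lemma face_act g n (i : 'I_n.+2) (c : config n.+1) :
  face i (config_act g c) = config_act g (face i c).
Proof.
apply: val_inj; apply: eq_from_tnth => j.
by rewrite tnth_mktuple !tnth_map tnth_ord_tuple.
Qed.

Definition conf_chain n := {malg int[config n]}.

Definition chain_act g n : conf_chain n -> conf_chain n :=
  free_lift (fun c => << config_act g c >>).
HB.instance Definition _ g n := GRing.Additive.on (@chain_act g n).

Lemma chain_actU g n (c : config n) a :
  chain_act g << a *g c >> = << a *g config_act g c >>.
Proof. by rewrite /chain_act free_liftU -raddfMz intz. Qed.

Fact chain_act1 n (x : conf_chain n) : chain_act 1%g x = x.
Proof.
apply: (@malg_additive_ext _ _ _ (@chain_act 1%g n) idfun) => c a.
by rewrite /= chain_actU config_act1.
Qed.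
Fact chain_actM n g h (x : conf_chain n) :
  chain_act (g * h)%g x = chain_act g (chain_act h x).
Proof.
apply: (@malg_additive_ext _ _ _ (@chain_act (g * h)%g n)
          (@chain_act g n \o @chain_act h n)) => c a /=.
by rewrite !chain_actU config_actM.
Qed.

Definition chain_gmod n : gmod G :=
  @Gmod G (conf_chain n) (fun g => @chain_act g n) (@chain_act1 n) (@chain_actM n).

Definition chain_diff n : conf_chain n.+1 -> conf_chain n :=
  free_lift (fun c => \sum_(i < n.+2) << face i c >> *~ (-1) ^+ i).
HB.instance Definition _ n := GRing.Additive.on (@chain_diff n).

Lemma chain_diffU n (c : config n.+1) a :
  chain_diff << a *g c >> = (\sum_(i < n.+2) << face i c >> *~ (-1) ^+ i) *~ a.
Proof. exact: free_liftU. Qed.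

Fact chain_diffJ n g (x : conf_chain n.+1) :
  chain_diff (chain_act g x) = chain_act g (chain_diff x).
Proof.
apply: (@malg_additive_ext _ _ _ (@chain_diff n \o @chain_act g n.+1)
          (@chain_act g n \o @chain_diff n)) => c a /=.
rewrite chain_actU [LHS]chain_diffU [in RHS]chain_diffU raddfMz raddf_sum.
congr (_ *~ _).
by apply: eq_bigr => i _; rewrite raddfMz /= chain_actU face_act.
Qed.

Definition chain_hom n : gmod_hom (chain_gmod n.+1) (chain_gmod n) :=
  @GmodHom _ (chain_gmod n.+1) (chain_gmod n) (@chain_diff n) (@chain_diffJ n).

Definition augmentation : conf_chain 0 -> int := free_lift (fun=> 1).
HB.instance Definition _ := GRing.Additive.on augmentation.

End Configurations.

Inductive generated (G : groupType) (S : G -> Prop) : G -> Prop :=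
| gen_in g : S g -> generated S g
| gen_one : generated S 1%g
| gen_mul g h : generated S g -> generated S h -> generated S (g * h)%g
| gen_inv g : generated S g -> generated S g^-1%g.

Section Presentation.
Variables (X : choiceType).

(* the letter [(b, x)] stands for [x^-1] if [b] is true and for [x] otherwise *)
Definition word := seq (bool * X).
Definition word_inv (w : word) : word := rev [seq (~~ l.1, l.2) | l <- w].

Variable (rels : word -> word -> Prop).

Inductive word_equiv : word -> word -> Prop :=
| weq_rel u v : rels u v -> word_equiv u v
| weq_cancel l : word_equiv [:: l; (~~ l.1, l.2)] [::]
| weq_refl u : word_equiv u u
| weq_sym u v : word_equiv u v -> word_equiv v u
| weq_trans u v w : word_equiv u v -> word_equiv v w -> word_equiv u w
| weq_cat u u' v v' :
    word_equiv u u' -> word_equiv v v' -> word_equiv (u ++ v) (u' ++ v').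

Definition word_equivb : rel word := fun u v => `[< word_equiv u v >].

Fact word_equivb_equiv : equiv_class_of word_equivb.
Proof.
split=> [u|u v|v u w].
- exact/asboolP/weq_refl.
- by apply/asboolP/asboolP => /weq_sym.
- by move=> /asboolP uv /asboolP vw; apply/asboolP/(weq_trans uv vw).
Qed.
Canonical word_equiv_rel := EquivRelPack word_equivb_equiv.
Canonical word_encModRel := defaultEncModRel word_equivb.

Definition presented := {eq_quot word_equivb}.
HB.instance Definition _ := Choice.on presented.
HB.instance Definition _ := EqQuotient.on presented.

Lemma presentedP u v :
  reflect (word_equiv u v) (\pi_presented u == \pi_presented v).
Proof. by rewrite piE; apply: asboolP. Qed.

Lemma word_invK : involutive word_inv.
Proof.
move=> w; rewrite /word_inv map_rev revK -map_comp -[RHS]map_id.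
by apply: eq_map => -[b x] /=; rewrite negbK.
Qed.

Lemma word_invr w : word_equiv (w ++ word_inv w) [::].
Proof.
elim: w => [|l w IHw]; first exact: weq_refl.
rewrite /word_inv map_cons rev_cons -cats1 -/(word_inv w).
rewrite -[l :: w]/([:: l] ++ w) -catA (catA w).
apply: weq_trans (weq_cancel l).
exact: (weq_cat (weq_refl [:: l]) (weq_cat IHw (weq_refl [:: _]))).
Qed.

Lemma word_invl w : word_equiv (word_inv w ++ w) [::].
Proof. by rewrite -{2}[w]word_invK; apply: word_invr. Qed.

Lemma word_inv_equiv u v : word_equiv u v -> word_equiv (word_inv u) (word_inv v).
Proof.
move=> uv; apply: weq_trans (_ : word_equiv (word_inv u ++ v ++ word_inv v) _).
  rewrite -[X in word_equiv X]cats0; apply: weq_cat (weq_refl _) _.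
  exact/weq_sym/word_invr.
rewrite catA -[word_inv v in X in word_equiv _ X]cat0s.
apply: weq_cat (weq_refl _); apply: weq_trans (word_invl u).
exact: weq_cat (weq_refl _) (weq_sym uv).
Qed.

Definition pres_one : presented := \pi_presented [::].
Definition pres_mul (x y : presented) := \pi_presented (repr x ++ repr y).
Definition pres_inv (x : presented) := \pi_presented (word_inv (repr x)).

Lemma repr_equiv u : word_equiv (repr (\pi_presented u)) u.
Proof. by apply/presentedP; rewrite reprK. Qed.

Lemma pres_mulE u v :
  pres_mul (\pi_presented u) (\pi_presented v) = \pi_presented (u ++ v).
Proof. exact/eqP/presentedP/(weq_cat (repr_equiv u) (repr_equiv v)). Qed.

Lemma pres_invE u : pres_inv (\pi_presented u) = \pi_presented (word_inv u).
Proof. exact/eqP/presentedP/word_inv_equiv/repr_equiv. Qed.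

Fact pres_mulA : associative pres_mul.
Proof.
move=> x y z; rewrite -[x]reprK -[y]reprK -[z]reprK.
by rewrite (pres_mulE (repr y)) (pres_mulE (repr x)) (pres_mulE (repr x)) pres_mulE catA.
Qed.
Fact pres_mul1 : left_id pres_one pres_mul.
Proof. by move=> x; rewrite -[x]reprK pres_mulE. Qed.
Fact pres_mulr1 : right_id pres_one pres_mul.
Proof. by move=> x; rewrite -[x]reprK pres_mulE cats0. Qed.
Fact pres_mulV : left_inverse pres_one pres_inv pres_mul.
Proof.
move=> x; rewrite -[x]reprK pres_invE pres_mulE.
exact/eqP/presentedP/word_invl.
Qed.
Fact pres_mulrV : right_inverse pres_one pres_inv pres_mul.
Proof.
move=> x; rewrite -[x]reprK pres_invE pres_mulE.
exact/eqP/presentedP/word_invr.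
Qed.
HB.instance Definition _ :=
  isGroup.Build presented pres_mulA pres_mul1 pres_mulr1 pres_mulV pres_mulrV.

Section Eval.
Variables (G : groupType) (f : X -> G).

Definition word_eval (w : word) : G :=
  (\prod_(l <- w) (if l.1 then (f l.2)^-1 else f l.2))%g.

Lemma word_eval_cat u v : word_eval (u ++ v) = (word_eval u * word_eval v)%g.
Proof. exact: big_cat. Qed.

Hypothesis f_rels : forall u v, rels u v -> word_eval u = word_eval v.

Lemma word_eval_equiv u v : word_equiv u v -> word_eval u = word_eval v.
Proof.
elim=> {u v} [u v|[[] x]|u|u v _ ->|u v w _ -> _ ->|u u' v v' _ eu _ ev] //=.
- exact: f_rels.
- by rewrite /word_eval !big_cons big_nil mulg1 mulVg.
- by rewrite /word_eval !big_cons big_nil mulg1 mulgV.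
- by rewrite !word_eval_cat eu ev.
Qed.

Definition pres_eval (x : presented) : G := word_eval (repr x).

Lemma pres_evalE w : pres_eval (\pi_presented w) = word_eval w.
Proof. exact/word_eval_equiv/repr_equiv. Qed.

End Eval.
End Presentation.

Section GL2.
Variable A : comPzRingType.

Definition is_unit (a : A) := exists b, a * b = 1.

(* invertible matrices, paired with their inverse *)
Definition GL2 := {p : 'M[A]_2 * 'M[A]_2 |
  (p.1 *m p.2 == 1%:M) && (p.2 *m p.1 == 1%:M)}.
HB.instance Definition _ := SubType.on GL2.
HB.instance Definition _ := Choice.on GL2.

Definition mx (g : GL2) : 'M[A]_2 := (val g).1.
Definition mxV (g : GL2) : 'M[A]_2 := (val g).2.

Lemma mxrV g : mx g *m mxV g = 1%:M.
Proof. by have /andP[/eqP-> _] := valP g. Qed.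
Lemma mxVr g : mxV g *m mx g = 1%:M.
Proof. by have /andP[_ /eqP->] := valP g. Qed.

Lemma mx_inj : injective mx.
Proof.
move=> g h e; have eV : mxV g = mxV h.
  by rewrite -[LHS]mulmx1 -(mxrV h) -e mulmxA mxVr mul1mx.
apply: val_inj; move: e eV; rewrite /mx /mxV.
by case: (val g) (val h) => [? ?] [? ?] /= -> ->.
Qed.

Fact mkGL2_subproof (M N : 'M[A]_2) : M *m N = 1%:M -> N *m M = 1%:M ->
  ((M, N).1 *m (M, N).2 == 1%:M) && ((M, N).2 *m (M, N).1 == 1%:M).
Proof. by move=> /= -> ->; rewrite eqxx. Qed.
Definition mkGL2 M N (MN : M *m N = 1%:M) (NM : N *m M = 1%:M) : GL2 :=
  exist _ (M, N) (mkGL2_subproof MN NM).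

Fact GL2_mul_subproof1 g h : (mx g *m mx h) *m (mxV h *m mxV g) = 1%:M.
Proof. by rewrite mulmxA -(mulmxA (mx g)) mxrV mulmx1 mxrV. Qed.
Fact GL2_mul_subproof2 g h : (mxV h *m mxV g) *m (mx g *m mx h) = 1%:M.
Proof. by rewrite mulmxA -(mulmxA (mxV h)) mxVr mulmx1 mxVr. Qed.

Definition GL2_one : GL2 := mkGL2 (mulmx1 1%:M) (mulmx1 1%:M).
Definition GL2_mul (g h : GL2) : GL2 :=
  mkGL2 (GL2_mul_subproof1 g h) (GL2_mul_subproof2 g h).
Definition GL2_inv (g : GL2) : GL2 := mkGL2 (mxVr g) (mxrV g).

Fact GL2_mulA : associative GL2_mul.
Proof. by move=> g h k; apply: mx_inj; apply: mulmxA. Qed.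
Fact GL2_mul1 : left_id GL2_one GL2_mul.
Proof. by move=> g; apply: mx_inj; apply: mul1mx. Qed.
Fact GL2_mulr1 : right_id GL2_one GL2_mul.
Proof. by move=> g; apply: mx_inj; apply: mulmx1. Qed.
Fact GL2_mulV : left_inverse GL2_one GL2_inv GL2_mul.
Proof. by move=> g; apply: mx_inj; apply: mxVr. Qed.
Fact GL2_mulrV : right_inverse GL2_one GL2_inv GL2_mul.
Proof. by move=> g; apply: mx_inj; apply: mxrV. Qed.
HB.instance Definition _ :=
  isGroup.Build GL2 GL2_mulA GL2_mul1 GL2_mulr1 GL2_mulV GL2_mulrV.

Lemma mxM (g h : GL2) : mx (g * h)%g = mx g *m mx h. Proof. by []. Qed.
Lemma mx1 : mx 1%g = 1%:M. Proof. by []. Qed.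

Definition mat2 (a b c d : A) : 'M[A]_2 :=
  \matrix_(i, j) if i == 0 then if j == 0 then a else b
                 else if j == 0 then c else d.

Lemma mat2_eta (M : 'M[A]_2) : M = mat2 (M 0 0) (M 0 1) (M 1 0) (M 1 1).
Proof.
apply/matrixP => i j; rewrite mxE.
by case: i => -[|[]] // Hi; case: j => -[|[]] // Hj; congr (M _ _); apply: val_inj.
Qed.

Lemma mat2M a b c d a' b' c' d' :
  mat2 a b c d *m mat2 a' b' c' d' =
  mat2 (a * a' + b * c') (a * b' + b * d') (c * a' + d * c') (c * b' + d * d').
Proof.
apply/matrixP => i j; rewrite !mxE !big_ord_recl big_ord0 !mxE /= addr0.
by case: i => -[|[]] // Hi; case: j => -[|[]] // Hj.
Qed.

Lemma mat2_1 : 1%:M = mat2 1 0 0 1.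
Proof.
apply/matrixP => i j; rewrite !mxE.
by case: i => -[|[]] // Hi; case: j => -[|[]] // Hj.
Qed.

Lemma mat2Z k a b c d : k *: mat2 a b c d = mat2 (k * a) (k * b) (k * c) (k * d).
Proof.
apply/matrixP => i j; rewrite !mxE.
by case: i => -[|[]] // Hi; case: j => -[|[]] // Hj.
Qed.

Fact elem_subproof ij r :
  (if ij then mat2 1 r 0 1 else mat2 1 0 r 1) *m
  (if ij then mat2 1 (- r) 0 1 else mat2 1 0 (- r) 1) = 1%:M.
Proof.
by case: ij; rewrite mat2M mat2_1 !(mul0r, mulr0, mul1r, mulr1, addr0, add0r)
  ?addNr ?addrN.
Qed.
Fact elem_subproof' ij r :
  (if ij then mat2 1 (- r) 0 1 else mat2 1 0 (- r) 1) *m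
  (if ij then mat2 1 r 0 1 else mat2 1 0 r 1) = 1%:M.
Proof.
by case: ij; rewrite mat2M mat2_1 !(mul0r, mulr0, mul1r, mulr1, addr0, add0r)
  ?addNr ?addrN.
Qed.

(* the elementary matrix [E_12(r)] if [ij] is true, [E_21(r)] otherwise *)
Definition elem (ij : bool) (r : A) : GL2 :=
  mkGL2 (elem_subproof ij r) (elem_subproof' ij r).

Definition GE2 : GL2 -> Prop :=
  generated (fun g => (exists ij r, g = elem ij r) \/ is_diag_mx (mx g)).

Definition scalar_equiv : rel GL2 :=
  fun g h => `[< exists2 a, is_unit a & mx h = a *: mx g >].

Lemma is_unitM a b : is_unit a -> is_unit b -> is_unit (a * b).
Proof. by move=> [a' ea] [b' eb]; exists (a' * b'); rewrite mulrACA ea eb mulr1. Qed.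
Lemma is_unit1 : is_unit 1. Proof. by exists 1; rewrite mulr1. Qed.

Fact scalar_equiv_equiv : equiv_class_of scalar_equiv.
Proof.
have sym g h : scalar_equiv g h -> scalar_equiv h g.
  move=> /asboolP[a [b ab] e]; apply/asboolP; exists b.
    by exists a; rewrite mulrC.
  by rewrite e scalerA mulrC ab scale1r.
split=> [g|g h|h g k].
- by apply/asboolP; exists 1; [exact: is_unit1|rewrite scale1r].
- by apply/idP/idP; apply: sym.
- move=> /asboolP[a ua e] /asboolP[b ub e']; apply/asboolP.
  by exists (b * a); [exact: is_unitM|rewrite e' e scalerA].
Qed.
Canonical scalar_equiv_rel := EquivRelPack scalar_equiv_equiv.
Canonical scalar_encModRel := defaultEncModRel scalar_equiv.

Definition PGL2 := {eq_quot scalar_equiv}.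
HB.instance Definition _ := Choice.on PGL2.
HB.instance Definition _ := EqQuotient.on PGL2.

Lemma PGL2P (g h : GL2) :
  reflect (exists2 a, is_unit a & mx h = a *: mx g) (\pi_PGL2 g == \pi_PGL2 h).
Proof. by rewrite piE; apply: asboolP. Qed.

Definition PGL2_one : PGL2 := \pi_PGL2 1%g.
Definition PGL2_mul (x y : PGL2) : PGL2 := \pi_PGL2 (repr x * repr y)%g.
Definition PGL2_inv (x : PGL2) : PGL2 := \pi_PGL2 (repr x)^-1%g.

Lemma repr_PGL2 g : exists2 a, is_unit a & mx g = a *: mx (repr (\pi_PGL2 g)).
Proof. by apply/PGL2P; rewrite reprK. Qed.

Lemma PGL2_mulE g h : PGL2_mul (\pi_PGL2 g) (\pi_PGL2 h) = \pi_PGL2 (g * h)%g.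
Proof.
have [a ua ea] := repr_PGL2 g; have [b ub eb] := repr_PGL2 h.
apply/eqP/PGL2P; exists (a * b); first exact: is_unitM.
by rewrite !mxM ea eb -scalemxAl -scalemxAr scalerA.
Qed.

Lemma PGL2_invE g : PGL2_inv (\pi_PGL2 g) = \pi_PGL2 g^-1%g.
Proof.
have [a [b ab] ea] := repr_PGL2 g; set k := repr _ in ea *.
apply/eqP/PGL2P; exists b; first by exists a; rewrite mulrC.
rewrite -[LHS]mulmx1 -(mxrV k); have -> : mx k = b *: mx g.
  by rewrite ea scalerA mulrC ab scale1r.
by rewrite -scalemxAl -scalemxAr mulmxA [mx g^-1%g *m _]mxVr mul1mx.
Qed.

Fact PGL2_mulA : associative PGL2_mul.
Proof.
move=> x y z; rewrite -[x]reprK -[y]reprK -[z]reprK.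
by rewrite (PGL2_mulE (repr y)) (PGL2_mulE (repr x)) (PGL2_mulE (repr x)) PGL2_mulE mulgA.
Qed.
Fact PGL2_mul1 : left_id PGL2_one PGL2_mul.
Proof. by move=> x; rewrite -[x]reprK PGL2_mulE mul1g. Qed.
Fact PGL2_mulr1 : right_id PGL2_one PGL2_mul.
Proof. by move=> x; rewrite -[x]reprK PGL2_mulE mulg1. Qed.
Fact PGL2_mulV : left_inverse PGL2_one PGL2_inv PGL2_mul.
Proof. by move=> x; rewrite -[x]reprK PGL2_invE PGL2_mulE mulVg. Qed.
Fact PGL2_mulrV : right_inverse PGL2_one PGL2_inv PGL2_mul.
Proof. by move=> x; rewrite -[x]reprK PGL2_invE PGL2_mulE mulgV. Qed.
HB.instance Definition _ := isGroup.Build PGL2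
  PGL2_mulA PGL2_mul1 PGL2_mulr1 PGL2_mulV PGL2_mulrV.

Lemma pi_PGL2M g h : \pi_PGL2 (g * h)%g = (\pi_PGL2 g * \pi_PGL2 h)%g.
Proof. by rewrite -PGL2_mulE. Qed.
Lemma pi_PGL2V g : \pi_PGL2 g^-1%g = (\pi_PGL2 g)^-1%g.
Proof. by rewrite -PGL2_invE. Qed.

(* For a subgroup [H] of [GL2] containing the scalars, [H / A^* I_2] is the
   subgroup of [PGL2] formed by the cosets of the elements of [H]. *)
Definition in_PGE2 : {pred PGL2} :=
  fun x => `[< exists2 g, GE2 g & \pi_PGL2 g = x >].

Fact in_PGE2_closed : group_closed in_PGE2.
Proof.
split=> [|x y]; rewrite !unfold_in.
  by apply/asboolP; exists 1%g; [exact: gen_one|].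
move=> /asboolP[g gx <-] /asboolP[h hy <-]; apply/asboolP; exists (g * h^-1)%g.
  by apply: gen_mul gx _; apply: gen_inv.
by rewrite pi_PGL2M pi_PGL2V.
Qed.

Definition PGE2 := {x : PGL2 | x \in in_PGE2}.
HB.instance Definition _ := SubType.on PGE2.
HB.instance Definition _ := Choice.on PGE2.
HB.instance Definition _ :=
  SubChoice_isSubGroup.Build PGL2 (mem in_PGE2) PGE2 in_PGE2_closed.

Definition upper_triangular (g : GL2) := mx g 1 0 = 0.

Definition in_PB2 : {pred PGL2} :=
  fun x => `[< exists2 g, upper_triangular g & \pi_PGL2 g = x >].

Lemma upper_triangularV g : upper_triangular g -> upper_triangular g^-1%g.
Proof.
rewrite /upper_triangular => gT; pose M := mx g; pose N := mxV g.
have NM := mxVr g; rewrite [mx g]mat2_eta [mxV g]mat2_eta mat2M mat2_1 in NM.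
have /matrixP e := NM; have := e 1 0; have := e 0 0; rewrite !mxE /= gT.
rewrite !mulr0 !addr0 => e00 e10; change (mxV g 1 0 = 0).
by rewrite -[LHS]mulr1 -e00 mulrCA e10 mulr0.
Qed.

Lemma upper_triangularM g h :
  upper_triangular g -> upper_triangular h -> upper_triangular (g * h)%g.
Proof.
rewrite /upper_triangular mxM !mxE !big_ord_recl big_ord0 => gT hT.
by rewrite -[X in mx g 1 X * mx h _ 0]/(0 : 'I_2) gT mul0r add0r addr0
   (_ : lift ord0 ord0 = 1 :> 'I_2) ?hT ?mulr0 //; apply: val_inj.
Qed.

Fact in_PB2_closed : group_closed in_PB2.
Proof.
split=> [|x y]; rewrite !unfold_in.
  by apply/asboolP; exists 1%g; rewrite /upper_triangular ?mx1 ?mxE.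
move=> /asboolP[g gx <-] /asboolP[h hy <-]; apply/asboolP; exists (g * h^-1)%g.
  exact/upper_triangularM/upper_triangularV.
by rewrite pi_PGL2M pi_PGL2V.
Qed.

Definition PB2 := {x : PGL2 | x \in in_PB2}.
HB.instance Definition _ := SubType.on PB2.
HB.instance Definition _ := Choice.on PB2.
HB.instance Definition _ :=
  SubChoice_isSubGroup.Build PGL2 (mem in_PB2) PB2 in_PB2_closed.

End GL2.

Section Steinberg.
Variable A : comPzRingType.

(* letters [(ij, r)] stand for [x_12(r)] if [ij] is true, for [x_21(r)] otherwise *)
Definition xl (ij : bool) (r : A) : word (bool * A)%type :=
  [:: (false, (ij, r))].

(* [u'] stands for the inverse of the unit [u] *)
Definition wl (ij : bool) (u u' : A) : word (bool * A)%type :=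
  xl ij u ++ xl (~~ ij) (- u') ++ xl ij u.

Inductive St_rels : word (bool * A)%type -> word (bool * A)%type -> Prop :=
| St_add ij r s : St_rels (xl ij r ++ xl ij s) (xl ij (r + s))
| St_conj ij u u' r : u * u' = 1 ->
    St_rels (wl ij u u' ++ xl (~~ ij) r ++ word_inv (wl ij u u'))
            (xl ij (- (u ^+ 2 * r))).

Definition St := presented St_rels.
HB.instance Definition _ := Choice.on St.
HB.instance Definition _ := EqQuotient.on St.
HB.instance Definition _ := Group.on St.

Definition St_x (ij : bool) (r : A) : St := \pi_St (xl ij r).

Definition St_to_GL2 : St -> GL2 A := pres_eval (fun l => elem l.1 l.2).

Fact St_rels_GL2 u v : St_rels u v ->
  word_eval (fun l => elem l.1 l.2) u = word_eval (fun l => elem l.1 l.2) v.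
Proof.
have elemN (ij : bool) (r : A) : (elem ij r)^-1%g = elem ij (- r).
  by apply: mx_inj; case: ij.
case=> [ij r s|ij a a' r aa'].
  rewrite /word_eval !big_cons big_nil !mulg1; apply: mx_inj.
  by case: ij; rewrite mxM /mx /= mat2M !(mul0r, mulr0, mul1r, mulr1, addr0, add0r) // addrC.
rewrite /word_eval !big_cons big_nil /= !mulg1 !elemN; apply: mx_inj.
rewrite !mxM /mx /=.
by case: ij => /=; rewrite !mat2M; congr mat2; ring: aa'.
Qed.

Lemma St_to_GL2_x ij r : St_to_GL2 (St_x ij r) = elem ij r.
Proof.
rewrite /St_to_GL2 (pres_evalE St_rels_GL2) /word_eval big_cons big_nil.
by rewrite mulg1.
Qed.

Definition K2 (k : St) : Prop := St_to_GL2 k = 1%g.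

Definition St_w12 (u u' : A) : St :=
  (St_x true u * St_x false (- u') * St_x true u)%g.

Definition St_h12 (u u' : A) : St := (St_w12 u u' * St_w12 (- 1) (- 1))%g.

Definition Steinberg_symbol (k : St) : Prop :=
  exists u u' v v' : A, [/\ u * u' = 1, v * v' = 1 &
    k = (St_h12 (u * v) (u' * v') * (St_h12 u u')^-1 * (St_h12 v v')^-1)%g].

Definition universal_for_GE2 : Prop :=
  forall k : St, K2 k <-> generated Steinberg_symbol k.

End Steinberg.

Section Points.
Variable A : comPzRingType.

Definition unimodular (v : 'cV[A]_2) : Prop := exists g : GL2 A, v = col 0 (mx g).
Definition GE2_unimodular (v : 'cV[A]_2) : Prop :=
  exists2 g : GL2 A, GE2 g & v = col 0 (mx g).

Definition umod := {v : 'cV[A]_2 | `[< unimodular v >]}.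
HB.instance Definition _ := SubType.on umod.
HB.instance Definition _ := Choice.on umod.

Definition point_equiv : rel umod :=
  fun u v => `[< exists2 a, is_unit a & val v = a *: val u >].

Fact point_equiv_equiv : equiv_class_of point_equiv.
Proof.
have sym u v : point_equiv u v -> point_equiv v u.
  move=> /asboolP[a [b ab] e]; apply/asboolP; exists b.
    by exists a; rewrite mulrC.
  by rewrite e scalerA mulrC ab scale1r.
split=> [u|u v|v u w].
- by apply/asboolP; exists 1; [exact: is_unit1|rewrite scale1r].
- by apply/idP/idP; apply: sym.
- move=> /asboolP[a ua e] /asboolP[b ub e']; apply/asboolP.
  by exists (b * a); [exact: is_unitM|rewrite e' e scalerA].
Qed.
Canonical point_equiv_rel := EquivRelPack point_equiv_equiv.
Canonical point_encModRel := defaultEncModRel point_equiv.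

Definition point := {eq_quot point_equiv}.
HB.instance Definition _ := Choice.on point.
HB.instance Definition _ := EqQuotient.on point.

Lemma pointP (u v : umod) :
  reflect (exists2 a, is_unit a & val v = a *: val u)
          (\pi_point u == \pi_point v).
Proof. by rewrite piE; apply: asboolP. Qed.

Definition in_class (x : point) (v : 'cV[A]_2) : Prop :=
  exists2 u : umod, val u = v & \pi_point u = x.

Definition pair_invertible : rel point := fun x y =>
  `[< exists v w, [/\ in_class x v, in_class y w &
        exists g : GL2 A, mx g = row_mx v w] >].

Fact umod_act_subproof (g : GL2 A) (u : umod) : `[< unimodular (mx g *m val u) >].
Proof.
have /asboolP[h ->] := valP u; apply/asboolP; exists (g * h)%g.
by rewrite mxM !colE mulmxA.
Qed.
Definition umod_act (g : GL2 A) (u : umod) : umod :=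
  exist _ (mx g *m val u) (umod_act_subproof g u).

Definition point_act (g : PGL2 A) (x : point) : point :=
  \pi_point (umod_act (repr g) (repr x)).

Lemma point_actE g u :
  point_act (\pi_(PGL2 A) g) (\pi_point u) = \pi_point (umod_act g u).
Proof.
have [a ua ea] := repr_PGL2 g.
have [b ub eb] : exists2 b, is_unit b & val u = b *: val (repr (\pi_point u)).
  by apply/pointP; rewrite reprK.
apply/eqP/pointP; exists (a * b); first exact: is_unitM.
by rewrite /= ea eb -scalemxAl -scalemxAr scalerA.
Qed.

Fact point_act1 x : point_act 1%g x = x.
Proof.
rewrite -[x]reprK (point_actE 1%g); congr (\pi_point _).
by apply: val_inj; rewrite /= mul1mx.
Qed.
Fact point_actM g h x : point_act (g * h)%g x = point_act g (point_act h x).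
Proof.
rewrite -[g]reprK -[h]reprK -[x]reprK -pi_PGL2M.
rewrite (point_actE (repr h)) !point_actE; congr (\pi_point _).
by apply: val_inj; rewrite /= mulmxA.
Qed.

Lemma in_class_act g x v :
  in_class x v -> in_class (point_act (\pi_(PGL2 A) g) x) (mx g *m v).
Proof. by move=> [u <- <-]; exists (umod_act g u) => //; rewrite point_actE. Qed.

Fact point_act_rel g x y :
  pair_invertible x y -> pair_invertible (point_act g x) (point_act g y).
Proof.
move=> /asboolP[v [w [xv yw [h hvw]]]]; apply/asboolP; rewrite -[g]reprK.
exists (mx (repr g) *m v), (mx (repr g) *m w).
split; [exact: in_class_act|exact: in_class_act|exists (repr g * h)%g].
rewrite mxM hvw; exact: (@mul_mx_row A 2 2 1 1 _ v w).
Qed.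

Definition Lconf : gconf (PGL2 A) :=
  @Gconf (PGL2 A) point pair_invertible point_act
    point_act1 point_actM point_act_rel.

Definition in_GE2point : {pred point} :=
  fun x => `[< exists2 v, GE2_unimodular v & in_class x v >].

Definition GE2point := {x : point | x \in in_GE2point}.
HB.instance Definition _ := SubType.on GE2point.
HB.instance Definition _ := Choice.on GE2point.

Definition GE2pair_invertible : rel GE2point :=
  fun x y => pair_invertible (val x) (val y).

Fact GE2point_act_subproof (g : PGE2 A) (x : GE2point) :
  point_act (val g) (val x) \in in_GE2point.
Proof.
have := valP g; rewrite unfold_in => /asboolP[h hE <-].
have := valP x; rewrite unfold_in => /asboolP[v [k kE ->] xv].
rewrite unfold_in; apply/asboolP; exists (mx h *m col 0 (mx k)).
  by exists (h * k)%g; [exact: gen_mul|rewrite mxM !colE mulmxA].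
exact: in_class_act.
Qed.
Definition GE2point_act (g : PGE2 A) (x : GE2point) : GE2point :=
  exist _ (point_act (val g) (val x)) (GE2point_act_subproof g x).

Fact GE2point_act1 x : GE2point_act 1%g x = x.
Proof. by apply: val_inj; apply: point_act1. Qed.
Fact GE2point_actM g h x :
  GE2point_act (g * h)%g x = GE2point_act g (GE2point_act h x).
Proof. by apply: val_inj; apply: point_actM. Qed.
Fact GE2point_act_rel g x y :
  GE2pair_invertible x y ->
  GE2pair_invertible (GE2point_act g x) (GE2point_act g y).
Proof. exact: point_act_rel. Qed.

Definition Yconf : gconf (PGE2 A) :=
  @Gconf (PGE2 A) GE2point GE2pair_invertible GE2point_act
    GE2point_act1 GE2point_actM GE2point_act_rel.

Definition L n := chain_gmod Lconf n.
(* [Y n] is given as the free abelian group on its basis, [Y_incl] is the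
   inclusion into [L n] *)
Definition Y n := chain_gmod Yconf n.

Fact config_incl_subproof n (c : config Yconf n) :
  @in_config _ Lconf n (map_tuple val (val c)).
Proof.
apply/'forall_forallP => i j; apply/implyP => ij; rewrite !tnth_map.
by have /'forall_forallP/(_ i j)/implyP/(_ ij) := valP c.
Qed.
Definition config_incl n (c : config Yconf n) : config Lconf n :=
  exist _ (map_tuple val (val c)) (config_incl_subproof c).

Definition Y_incl n : Y n -> L n :=
  free_lift (fun c => << config_incl c >> : {malg int[config Lconf n]}).

Definition Z1_GE2 : gmod (PGE2 A) := ker_gmod (chain_hom Yconf 0).
Definition Z2_GE2 : gmod (PGE2 A) := ker_gmod (chain_hom Yconf 1).
Definition Z2_GL2 : gmod (PGL2 A) := ker_gmod (chain_hom Lconf 1).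

Definition scissors := group_homology Z2_GL2 0.
HB.instance Definition _ := Choice.on scissors.
HB.instance Definition _ := GRing.Zmodule.on scissors.

End Points.

Section SpectralSequence.
Variable A : comPzRingType.

Definition E (p : nat) : gmod (PGE2 A) :=
  match p with
  | 0 => Y A 0
  | 1 => Y A 1
  | 2 => Z1_GE2 A
  | _ => zero_gmod (PGE2 A)
  end.

Definition E_diff (p : nat) : gmod_hom (E p.+1) (E p) :=
  match p return gmod_hom (E p.+1) (E p) with
  | 0 => chain_hom (Yconf A) 0
  | 1 => ker_incl (chain_hom (Yconf A) 0)
  | p'.+2 => zero_hom (E p'.+3) (E p'.+2)
  end.

Definition D p q := bar (E p) q.
Definition d_v p q : D p q.+1 -> D p q := @bar_d _ (E p) q.
Definition d_h p q : D p.+1 q -> D p q := @bar_map _ _ _ _ idfun (E_diff p) q.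

Definition E1 p q := group_homology (E p) q.

Definition d1 p q : {additive E1 p.+1 q -> E1 p q} :=
  group_homology_map (E_diff p) q.
Definition d1_out p q : {additive E1 p q -> E1 p.-1 q} :=
  match p with 0 => \0 | p'.+1 => d1 p' q end.

Definition E2 p q := homology (d1 p q) (d1_out p q).

(* [x] survives to the second page, where its class is [h] *)
Definition E2_class p q (x : D p q) (h : E2 p q) : Prop :=
  exists2 k : E1 p q, has_class x k & has_class k h.

Definition H_PGE2 n := group_homology (triv_int (PGE2 A)) n.
Definition H_PB2 n := group_homology (triv_int (PB2 A)) n.

(* A total chain of degree [n] is given by its components [t p q] with
   [p + q = n]; the total differential is [d_v + (-1)^q d_h]. *)
Definition total_cycle n (t : forall p q, D p q) : Prop :=
  forall p q, (p + q).+1 = n -> d_v (t p q.+1) + d_h (t p.+1 q) *~ (-1) ^+ q = 0.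

Definition D_aug q : D 0 q -> bar (triv_int (PGE2 A)) q :=
  @bar_map _ _ (Y A 0) (triv_int (PGE2 A)) idfun (@augmentation _ (Yconf A)) q.

(* [x] is identified with the class of the total cycle [t] under the isomorphism
   between the homology of the total complex and that of [PGE_2(A)] *)
Definition total_class n (t : forall p q, D p q) (x : H_PGE2 n) : Prop :=
  total_cycle n t /\ has_class (D_aug (t 0 n)) x.

(* the graph of the edge map [H_(p+q) -> E^2_(p,q)], which is defined if
   the [p]-th step of the filtration is the whole of [H_(p+q)]: project a
   representing total cycle of filtration [p] to its component in [D p q] *)
Definition edge_to p q (x : H_PGE2 (p + q)) (h : E2 p q) : Prop :=
  exists t : forall p q, D p q,
    [/\ total_class t x,
        forall p' q', (p' + q' = p + q)%N -> (p < p')%N -> t p' q' = 0 &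
        E2_class (t p q) h].

(* the graph of the edge map [E^2_(0,q) -> H_q] *)
Definition edge_from q (h : E2 0 q) (x : H_PGE2 q) : Prop :=
  exists2 c : D 0 q, E2_class c h & has_class (D_aug c) x.

(* the graph of the differential [d^2_(p+2,q)] *)
Definition d2_graph p q (h : E2 p.+2 q) (h' : E2 p q.+1) : Prop :=
  exists x : D p.+2 q, exists y : D p.+1 q.+1,
    [/\ E2_class x h, d_h x = d_v y & E2_class (d_h y) h'].

(* [P(A) -> E^2_(2,1)]: inverse of the connecting map
   [H_1(PGE_2, Z_1) -> H_0(PGE_2, Z_2)] attached to the sequence
   [0 -> Z_2 -> Y_2 -> Z_1 -> 0], combined with [H_0(PGE_2, Z_2^GE2) = P(A)] *)
Definition scissors_graph (a : scissors A) (h : E2 2 1) : Prop :=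
  exists (z : Z2_GL2 A) (z' : Z2_GE2 A) (c : bar (Y A 2) 1) (w : D 2 1),
    [/\ has_class (<< z *g [tuple] >> : bar (Z2_GL2 A) 0) a,
        val z = Y_incl (val z'),
        bar_d c = << val z' *g [tuple] >>,
        d_h w = bar_map idfun (chain_hom (Yconf A) 1) c &
        E2_class w h].

Fact PB2_PGE2_subproof (b : PB2 A) : val b \in @in_PGE2 A.
Proof.
have := valP b; rewrite !unfold_in => /asboolP[g gT <-].
have gTV := upper_triangularV gT.
have := mxrV g; have := mxVr g; rewrite [mx g]mat2_eta [mxV g]mat2_eta !mat2M mat2_1.
have gTV' : mxV g 1 0 = 0 by [].
rewrite (gT : mx g 1 0 = 0) gTV' !(mulr0, mul0r, addr0, add0r).
set a := mx g 0 0; set b' := mx g 0 1; set d := mx g 1 1.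
set a' := mxV g 0 0; set d' := mxV g 1 1 => e1 e2.
have aa' : a * a' = 1 by have /matrixP/(_ 0 0) := e2; rewrite !mxE.
have dd' : d * d' = 1 by have /matrixP/(_ 1 1) := e2; rewrite !mxE.
have a'a : a' * a = 1 by rewrite mulrC.
have d'd : d' * d = 1 by rewrite mulrC.
have h1 : mat2 a 0 0 d *m mat2 a' 0 0 d' = 1%:M.
  by rewrite mat2M mat2_1 aa' dd' !(mulr0, mul0r, addr0, add0r).
have h2 : mat2 a' 0 0 d' *m mat2 a 0 0 d = 1%:M.
  by rewrite mat2M mat2_1 a'a d'd !(mulr0, mul0r, addr0, add0r).
apply/asboolP; exists (mkGL2 h1 h2 * elem true (a' * b'))%g.
  apply: gen_mul; apply: gen_in; last by left; exists true, (a' * b').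
  right; apply/is_diag_mxP => i j; rewrite !mxE.
  by case: i => -[|[]] // Hi; case: j => -[|[]] // Hj.
congr (\pi_(PGL2 A) _); apply: mx_inj.
rewrite mxM /mx /= mat2M [RHS]mat2_eta -/(mx g) (gT : mx g 1 0 = 0).
by rewrite !(mulr0, mul0r, addr0, add0r, mulr1) mulrA aa' mul1r.
Qed.
Definition PB2_PGE2 (b : PB2 A) : PGE2 A := exist _ (val b) (PB2_PGE2_subproof b).

Definition swap_mx : 'M[A]_2 := mat2 0 1 1 0.
Fact swap_mxK : swap_mx *m swap_mx = 1%:M.
Proof. by rewrite mat2M mat2_1 !(mulr0, mul0r, mulr1, addr0, add0r). Qed.
Definition swap : GL2 A := mkGL2 swap_mxK swap_mxK.

Lemma GE2_swap : GE2 swap.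
Proof.
have dK : mat2 1 0 0 (-1) *m mat2 1 0 0 (-1) = 1%:M :> 'M[A]_2.
  by rewrite mat2M mat2_1 !(mulr0, mul0r, mulr1, addr0, add0r) mulrNN mulr1.
have -> : swap = (mkGL2 dK dK * (elem true 1 * elem false (-1) * elem true 1))%g.
  apply: mx_inj; rewrite !mxM /mx /= !mat2M.
  by congr mat2; ring.
have elemP ij r : GE2 (@elem A ij r) by apply: gen_in; left; exists ij, r.
apply: gen_mul; last by apply: gen_mul; [apply: gen_mul|]; apply: elemP.
apply: gen_in; right; apply/is_diag_mxP => i j; rewrite !mxE.
by case: i => -[|[]] // Hi; case: j => -[|[]] // Hj.
Qed.

Lemma delta_col0 : delta_mx 0 0 = col 0 (mx (1%g : GL2 A)).
Proof. by rewrite mx1 col1. Qed.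
Lemma delta_col1 : delta_mx 1 0 = col 0 (mx swap).
Proof.
apply/matrixP => i j; rewrite !mxE ord1.
by case: i => -[|[]] // Hi.
Qed.

Lemma std_GE2_unimodular (i : 'I_2) : GE2_unimodular (delta_mx i 0 : 'cV[A]_2).
Proof.
have [->|->] : i = 0 \/ i = 1.
  by case: i => -[|[]] // Hi; [left|right]; apply: val_inj.
- by exists 1%g; [apply: gen_one|rewrite delta_col0].
- by exists swap; [apply: GE2_swap|rewrite delta_col1].
Qed.

Fact std_umod_subproof (i : 'I_2) : `[< unimodular (delta_mx i 0 : 'cV[A]_2) >].
Proof. by apply/asboolP; have [g _ e] := std_GE2_unimodular i; exists g. Qed.
Definition std_umod (i : 'I_2) : umod A :=
  exist _ (delta_mx i 0) (std_umod_subproof i).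

Fact std_point_subproof (i : 'I_2) : \pi_(point A) (std_umod i) \in @in_GE2point A.
Proof.
rewrite unfold_in; apply/asboolP; exists (delta_mx i 0).
  exact: std_GE2_unimodular.
by exists (std_umod i).
Qed.
Definition std_point (i : 'I_2) : GE2point A :=
  exist _ (\pi_(point A) (std_umod i)) (std_point_subproof i).

Lemma std_pair i j : i != j -> GE2pair_invertible (std_point i) (std_point j).
Proof.
have in_std k : in_class (\pi_(point A) (std_umod k)) (delta_mx k 0).
  by exists (std_umod k).
move=> ij; apply/asboolP; exists (delta_mx i 0), (delta_mx j 0).
split; [exact: in_std|exact: in_std|]; case: (eqVneq i 0) ij => [-> j0|i0 ij].
  have -> : j = 1 by case: j j0 => -[|[]] // Hj _; apply: val_inj.
  exists 1%g; rewrite mx1 mat2_1; apply/matrixP => k l; rewrite !mxE.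
  case: splitP => l' e; rewrite ord1 in e; rewrite mxE (ord1 l');
    case: k => -[|[]] // Hk; case: l e => -[|[]] // Hl.
have -> : i = 1 by case: i i0 ij => -[|[]] // Hi _ _; apply: val_inj.
have -> : j = 0.
  by case: i i0 ij => -[|[]] // Hi _; case: j => -[|[]] // Hj _; apply: val_inj.
exists swap; rewrite /mx /= /swap_mx; apply/matrixP => k l; rewrite !mxE.
case: splitP => l' e; rewrite ord1 in e; rewrite mxE (ord1 l');
  case: k => -[|[]] // Hk; case: l e => -[|[]] // Hl.
Qed.

Definition base0_tuple : 1.-tuple (Yconf A) := [tuple std_point 0].
Definition base1_tuple : 2.-tuple (Yconf A) := [tuple std_point i | i < 2].

Fact base0_subproof : in_config base0_tuple.
Proof. by apply/'forall_forallP => i j; rewrite !ord1. Qed.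
Fact base1_subproof : in_config base1_tuple.
Proof.
apply/'forall_forallP => i j; apply/implyP => ij; rewrite !tnth_mktuple.
exact: std_pair.
Qed.
Definition base0 : config (Yconf A) 0 := exist _ base0_tuple base0_subproof.
Definition base1 : config (Yconf A) 1 := exist _ base1_tuple base1_subproof.

(* [H_q(PB_2, Z) -> E^2_(0,q)], induced by [PB_2 -> PGE_2] and by
   [Z -> Y_0, 1 |-> (<e_1>)] *)
Definition PB2_graph q (a : H_PB2 q) (h : E2 0 q) : Prop :=
  exists2 x : bar (triv_int (PB2 A)) q, has_class x a &
    E2_class (@bar_map _ _ (triv_int (PB2 A)) (Y A 0) PB2_PGE2
                (mkmalgU base0 : {additive int -> Y A 0}) q x : D 0 q) h.

Definition mu2 := {a : A | a ^+ 2 == 1}.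
HB.instance Definition _ := SubType.on mu2.
HB.instance Definition _ := Choice.on mu2.

Fact mu2_one_subproof : (1 : A) ^+ 2 == 1. Proof. by rewrite expr1n. Qed.
Fact mu2_mul_subproof (a b : mu2) : (val a * val b) ^+ 2 == 1.
Proof. by rewrite exprMn (eqP (valP a)) (eqP (valP b)) mulr1. Qed.
Definition mu2_one : mu2 := exist _ 1 mu2_one_subproof.
Definition mu2_mul (a b : mu2) : mu2 := exist _ (val a * val b) (mu2_mul_subproof a b).
Fact mu2_mulA : associative mu2_mul.
Proof. by move=> a b c; apply: val_inj; apply: mulrA. Qed.
Fact mu2_mul1 : left_id mu2_one mu2_mul.
Proof. by move=> a; apply: val_inj; apply: mul1r. Qed.
Fact mu2_mulr1 : right_id mu2_one mu2_mul.
Proof. by move=> a; apply: val_inj; apply: mulr1. Qed.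
Fact mu2_mulV : left_inverse mu2_one id mu2_mul.
Proof. by move=> a; apply: val_inj; rewrite /= -expr2; apply/eqP/(valP a). Qed.
HB.instance Definition _ :=
  isGroup.Build mu2 mu2_mulA mu2_mul1 mu2_mulr1 mu2_mulV mu2_mulV.

Fact mu2_diag_subproof (a : mu2) :
  mat2 (val a) 0 0 1 *m mat2 (val a) 0 0 1 = 1%:M.
Proof.
rewrite mat2M mat2_1 !(mulr0, mul0r, addr0, add0r, mulr1) -expr2.
by rewrite (eqP (valP a)).
Qed.
Fact mu2_PGE2_subproof (a : mu2) :
  \pi_(PGL2 A) (mkGL2 (mu2_diag_subproof a) (mu2_diag_subproof a)) \in @in_PGE2 A.
Proof.
rewrite unfold_in; apply/asboolP; eexists; last by [].
apply: gen_in; right; apply/is_diag_mxP => i j; rewrite !mxE.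
by case: i => -[|[]] // Hi; case: j => -[|[]] // Hj.
Qed.
Definition mu2_PGE2 (a : mu2) : PGE2 A :=
  exist _ (\pi_(PGL2 A) (mkGL2 (mu2_diag_subproof a) (mu2_diag_subproof a)))
    (mu2_PGE2_subproof a).

(* [mu_2(A) -> E^2_(1,1)], through [mu_2(A) <= A^* = PT_2(A)] and
   [PT_2(A) = H_1(PT_2(A), Z) = H_1(PGE_2(A), Y_1)] *)
Definition mu2_graph (a : mu2) (h : E2 1 1) : Prop :=
  E2_class (<< (<< base1 >> : Y A 1) *g [tuple mu2_PGE2 a] >> : D 1 1) h.

End SpectralSequence.

Definition exact_at (U V W : zmodType) (f : U -> V) (g : V -> W) : Prop :=
  forall y, (exists x, f x = y) <-> g y = 0.

(* Main.v *)
Require Import Defs.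
From HB Require Import structures.
From mathcomp Require Import all_boot all_algebra finmap.
From mathcomp Require Import boolp ring zify.
From mathcomp.multinomials Require Import monalg.

(** The complex [E] resolves the integers: the graph of points is connected because
    [GE2] is generated by matrices that move the first coordinate point along
    edges ([aug_exact]). The rows of the double complex are therefore exact, and
    as there are only three columns, its spectral sequence is governed by chases
    along staircases. Once [E^2_(2,0)] is known to vanish ([col20]), these give
    the exact sequence
      [H_3 -> E^2_(2,1) -> E^2_(0,2) -> H_2 -> E^2_(1,1) -> 0],
    and the theorem amounts to the identification of the three second-page terms.
    All maps are described by relations between classes, which are shown to be
    graphs of additive maps ([additive_of_graph]).

    Shapiro's lemma, proved with explicit homotopies in low degrees, replaces the
    modules of points and of pairs by the Borel subgroup and by the torus [T] of the
    matrices [diag(u, 1)].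

    The term [E^2_(0,2)] is [H_2(PB2)] because the differential from [H_2(T)] is zero:
    it is the difference of the maps induced by two inclusions of [T], which are
    exchanged, up to inversion on [T], by conjugation with the swap. As inversion
    preserves the bilinear commutator pairing of a two-cocycle, the difference of the
    two cocycles is symmetric, and a symmetric cocycle vanishes on two-cycles of an
    abelian group ([sym_cocycle_cycles], [d_h_cycle_bound]).

    For the term [E^2_(1,1)], the scalars by which matrices move representatives of
    points define two cocycles. The cocycle [phi] identifies [H_1(PGE2, Y_1)] with the
    unit group and is zero on the image of the last column; the cocycle [chi] is a
    character of the Borel subgroup that takes the differential of the class of [u]
    to [u^-2]. What is left is the group of units with square 1.

    The term [E^2_(2,1)] is where universality enters, through the exactness of
    [Y_2 -> Y_1 -> Y_0] ([Y_exact1]). Modulo triangles, following the point at infinity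
    along paths of edges defines a crossed homomorphism on the Steinberg group. It
    vanishes on Steinberg symbols, hence on [K2], hence on every element that fixes
    the point at infinity; so it is a potential on points, of which each edge is
    the difference at its endpoints, and a cycle of edges is zero modulo triangles.
    Consequently [0 -> Z_2 -> Y_2 -> Z_1 -> 0] is exact. The action on triples is simply
    transitive, so the connecting map from [H_1(Z_1)] to the coinvariants of [Z_2] is
    injective, with image the elements that die in the coinvariants of [Y_2]; and all
    do, for a cycle of triples has coefficient sum zero. That all of [H_1(Z_1)]
    survives to the second page is again seen with [phi]. Finally [Z_2] has the same
    coinvariants for [PGE2] and for [PGL2]: the cosets of [PGE2] index the components
    of the graph of all points, which translations bring back to the component of
    the [GE2]-points ([scissors_surj], [scissors_inj]). *)

Set Implicit Arguments.
Unset Strict Implicit.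
Unset Printing Implicit Defensive.

Import GRing.Theory.
Local Open Scope ring_scope.
Local Open Scope quotient_scope.

(** * Linear identities in abelian groups *)

Inductive zterm := ZVar of nat | ZZero | ZAdd of zterm & zterm | ZOpp of zterm.

Fixpoint zcoef (t : zterm) (i : nat) : int :=
  match t with
  | ZVar j => (i == j)%:Z
  | ZZero => 0%:Z
  | ZAdd t1 t2 => intZmod.addz (zcoef t1 i) (zcoef t2 i)
  | ZOpp t1 => intZmod.oppz (zcoef t1 i)
  end.

Section ZEval.
Variable V : zmodType.

Fixpoint zeval (env : seq V) (t : zterm) : V :=
  match t with
  | ZVar j => nth 0 env j
  | ZZero => 0
  | ZAdd t1 t2 => zeval env t1 + zeval env t2
  | ZOpp t1 => - zeval env t1
  end.

Lemma zeval_coef env t :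
  zeval env t = \sum_(i < size env) nth 0 env i *~ zcoef t i.
Proof.
elim: t => [j||t1 IH1 t2 IH2|t IH] /=.
- case: (ltnP j (size env)) => jn; last first.
    rewrite nth_default // big1 // => i _.
    by rewrite eqn_leq [(j <= i)%N]leqNgt (leq_trans (ltn_ord i) jn) andbF.
  rewrite (bigD1 (Ordinal jn)) //= eqxx big1 ?addr0 // => i ij.
  by rewrite -[j]/(val (Ordinal jn)) (inj_eq val_inj) (negPf ij).
- by rewrite big1.
- rewrite IH1 IH2 -big_split; apply: eq_bigr => i _; apply: esym (mulrzDr_tmp _ _ _).
- rewrite IH -sumrN; apply: eq_bigr => i _; apply: esym (mulrNz _ _).
Qed.

Lemma zeval_eq n env t1 t2 : size env = n ->
  all (fun i => zcoef t1 i == zcoef t2 i) (iota 0 n) -> zeval env t1 = zeval env t2.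
Proof.
move=> <- /allP e; rewrite !zeval_coef; apply: eq_bigr => i _.
by rewrite (eqP (e _ _)) // mem_iota ltn_ord.
Qed.
End ZEval.

Ltac zm_in x env :=
  lazymatch env with
  | nil => constr:(false)
  | cons x _ => constr:(true)
  | cons _ ?e => zm_in x e
  end.
Ltac zm_add x env :=
  let b := zm_in x env in
  lazymatch b with true => env | false => constr:(cons x env) end.
Ltac zm_env t env :=
  lazymatch t with
  | (?a + ?b)%R => let e := zm_env a env in zm_env b e
  | (- ?a)%R => zm_env a env
  | 0%R => env
  | ?x => zm_add x env
  end.
Ltac zm_index x env :=
  lazymatch env with
  | cons x _ => constr:(0%N)
  | cons _ ?e => let n := zm_index x e in constr:(S n)
  end.
Ltac zm_term t env :=
  lazymatch t with
  | (?a + ?b)%R =>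
      let a' := zm_term a env in let b' := zm_term b env in constr:(ZAdd a' b')
  | (- ?a)%R => let a' := zm_term a env in constr:(ZOpp a')
  | 0%R => constr:(ZZero)
  | ?x => let n := zm_index x env in constr:(ZVar n)
  end.

Ltac zm_generalize env :=
  lazymatch env with
  | nil => idtac
  | cons ?x ?e => generalize x; zm_generalize e
  end.

Ltac zm_solve :=
  lazymatch goal with
  | |- @eq ?V ?a ?b =>
    let env0 := constr:(@nil V) in
    let env1 := zm_env a env0 in
    let env := zm_env b env1 in
    let t1 := zm_term a env in
    let t2 := zm_term b env in
    let n := eval compute in (size env) in
    exact (@zeval_eq _ n env t1 t2 (erefl n) (erefl true))
  end.

(** Decides equalities between integral linear combinations of atoms of an
    abelian group by comparing coefficients. *)
Ltac zmodule :=
  lazymatch goal with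
  | |- @eq ?V ?a ?b =>
    let env0 := constr:(@nil V) in
    let env1 := zm_env a env0 in
    let env := zm_env b env1 in
    zm_generalize env; intros; zm_solve
  end.

(** * Additive relations and chain-level classes *)

(** The maps of the spectral sequence are given as relations between classes. A
    relation that is total, compatible with subtraction and trivial over [0] is
    single-valued, and its function is additive. *)
Lemma additive_of_graph (U V : zmodType) (R : U -> V -> Prop) :
    (forall x, exists y, R x y) ->
    (forall x x' y y', R x y -> R x' y' -> R (x - x') (y - y')) ->
    (forall y, R 0 y -> y = 0) ->
  exists f : {additive U -> V}, forall x, R x (f x).
Proof.
move=> Rtot Rsub R0.
have Runi x y y' : R x y -> R x y' -> y = y'.
  move=> xy xy'; apply/eqP; rewrite -subr_eq0; apply/eqP/R0.
  by rewrite -(subrr x); apply: Rsub.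
have [f fR] : exists f : U -> V, forall x, R x (f x).
  by exists (fun x => sval (cid (Rtot x))) => x; apply: (svalP (cid (Rtot x))).
have fB : zmod_morphism f.
  by move=> x y; apply: Runi (fR _) _; apply: Rsub; apply: fR.
pose F : {additive U -> V} := HB.pack f (GRing.isZmodMorphism.Build U V f fB).
by exists F.
Qed.

Lemma additive_bijective (U V : zmodType) (f : {additive U -> V}) :
  (forall x, f x = 0 -> x = 0) -> (forall y, exists x, f x = y) -> bijective f.
Proof.
move=> f_inj f_surj; exists (fun y => sval (cid (f_surj y))) => [x|y]; last first.
  exact: (svalP (cid (f_surj y))).
apply/eqP; rewrite -subr_eq0; apply/eqP/f_inj; rewrite raddfB.
by rewrite (svalP (cid (f_surj (f x)))) subrr.
Qed.

Section Classes.
Variables (U V W : zmodType) (f : {additive U -> V}) (g : {additive V -> W}).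
Implicit Types (x : V) (h : homology f g).

Lemma has_class_ex x : g x = 0 -> exists h, has_class x h.
Proof.
move=> gx; have xP : x \in @cycle_pred _ _ g by rewrite unfold_in gx.
by exists (\pi_(homology f g) (exist _ x xP : cycles g)); exists (exist _ x xP).
Qed.

Lemma has_class_cycle x h : has_class x h -> g x = 0.
Proof. by move=> [z <- _]; apply/eqP; have := valP z. Qed.

Lemma has_class_surj h : exists x, has_class x h.
Proof. by exists (val (repr h)); exists (repr h) => //; rewrite reprK. Qed.

Lemma has_classB x x' h h' :
  has_class x h -> has_class x' h' -> has_class (x - x') (h - h').
Proof.
by move=> [z <- <-] [z' <- <-]; exists (z - z'); rewrite !raddfB.
Qed.

Lemma has_class0P x : has_class x (0 : homology f g) <-> g x = 0 /\ exists u, f u = x.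
Proof.
have pi0 z : \pi_(homology f g) z = 0 <-> exists u, f u = val z.
  rewrite -(raddf0 (\pi_(homology f g))).
  split=> [/eqP|].
    by rewrite -Quotient.idealrBE subr0 unfold_in => /asboolP.
  by move=> e; apply/eqP; rewrite -Quotient.idealrBE subr0 unfold_in; apply/asboolP.
split=> [xh|[gx xu]].
  split; first exact: has_class_cycle xh.
  by have [z <- /pi0] := xh.
have xP : x \in @cycle_pred _ _ g by rewrite unfold_in gx.
by exists (exist _ x xP) => //; apply/pi0.
Qed.

Lemma has_class_uniq x h h' : has_class x h -> has_class x h' -> h = h'.
Proof. by move=> [z <- <-] [z' /val_inj -> ->]. Qed.

End Classes.

(** * The bar complex *)

Section AlternatingSum.
Variables (V : zmodType) (n : nat) (F : 'I_n.+2 -> 'I_n.+1 -> V).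

(** The simplicial identity pairs each term [F i j] with [j < i] with the term
    [F j (i - 1)], which carries the opposite sign. *)
Lemma alternating_sum0 :
    (forall i j : 'I_n.+1, (j <= i)%N ->
       F (lift ord0 i) j = F (widen_ord (leqnSn n.+1) j) i) ->
  \sum_(i < n.+2) \sum_(j < n.+1) F i j *~ (-1) ^+ j *~ (-1) ^+ i = 0.
Proof.
move=> FF; under eq_bigr => i _.
  rewrite (bigID (fun j : 'I_n.+1 => (j < i)%N)) /=; over.
rewrite big_split /= big_ord_recl big_pred0_eq add0r.
rewrite [X in _ + X]big_ord_recr /= [X in _ + (_ + X)]big_pred0 ?addr0; last first.
  by move=> j; rewrite ltn_ord.
rewrite (exchange_big_dep predT) //=; rewrite -big_split big1 //= => j _.
rewrite (eq_bigl (fun i : 'I_n.+1 => (j <= i)%N)) => [|i]; last by rewrite ltnS.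
rewrite [X in _ + X](eq_bigl (fun i : 'I_n.+1 => (j <= i)%N)) => [|i].
  rewrite -big_split big1 //= => i ji; rewrite FF // exprS mulN1r mulrNz.
  by rewrite -!mulrzA mulrC addNr.
by rewrite -leqNgt.
Qed.
End AlternatingSum.

Section BarSquare.
Variables (G : groupType) (M : gmod G).

Lemma nth_bar_face n (i : 'I_n.+2) (t : n.+1.-tuple G) k : (k < n)%N ->
  nth 1%g (bar_face i t) k =
    if (k.+1 < i)%N then nth 1%g t k
    else if k.+1 == i then (nth 1%g t k * nth 1%g t k.+1)%g else nth 1%g t k.+1.
Proof.
move=> kn; rewrite -[k]/(val (Ordinal kn)) -tnth_nth tnth_mktuple !(tnth_nth 1%g) /=.
by rewrite /bump /= add1n.
Qed.

Definition face_fun (i : nat) (p : nat -> G) (k : nat) : G :=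
  if (k.+1 < i)%N then p k else if k.+1 == i then (p k * p k.+1)%g else p k.+1.

Lemma face_funK i j p k : (j <= i)%N ->
  face_fun j (face_fun i.+1 p) k = face_fun i (face_fun j p) k.
Proof.
rewrite /face_fun => ji.
by do ![case: ifPn => ?; try (exfalso; lia)]; rewrite ?mulgA.
Qed.

Lemma bar_faceK n (i j : 'I_n.+2) (t : n.+2.-tuple G) : (j <= i)%N ->
  bar_face j (bar_face (lift ord0 i) t) =
  bar_face i (bar_face (widen_ord (leqnSn n.+2) j) t).
Proof.
move=> ji; apply: val_inj; apply: (@eq_from_nth _ 1%g); rewrite !size_tuple // => k kn.
rewrite !(nth_bar_face _ _ kn) !nth_bar_face ?ltnS ?(ltnW kn) //=.
exact: (face_funK (nth 1%g t) k ji).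
Qed.

Lemma bar_coefK n (i j : 'I_n.+2) (t : n.+2.-tuple G) (m : M) : (j <= i)%N ->
  bar_coef M j (bar_face (lift ord0 i) t) (bar_coef M (lift ord0 i) t m) =
  bar_coef M i (bar_face (widen_ord (leqnSn n.+2) j) t)
    (bar_coef M (widen_ord (leqnSn n.+2) j) t m).
Proof.
move=> ji; rewrite /bar_coef /= -[widen_ord _ j == ord0]/(j == ord0).
have theadE k (u : k.+1.-tuple G) : thead u = nth 1%g u 0 by rewrite /thead (tnth_nth 1%g).
case: (eqVneq j ord0) ji => [->|j0] ji; last first.
  by rewrite ifN // -lt0n (leq_trans _ ji) // lt0n.
rewrite !theadE !nth_bar_face //=; case: (eqVneq i ord0) => [->|i0] /=.
  by rewrite -gactM invgM.
by rewrite /bump /= ltnS lt0n i0.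
Qed.

Lemma bar_dd n (x : bar M n.+2) : bar_d (bar_d x) = 0.
Proof.
apply: (@malg_additive_ext _ _ _ (@bar_d _ M n \o @bar_d _ M n.+1) \0) => t m /=.
rewrite bar_dU raddf_sum /= -[RHS](alternating_sum0 (V := bar M n)
  (F := fun i j => << bar_coef M j (bar_face i t) (bar_coef M i t m) *g
                      bar_face j (bar_face i t) >>)) => [|i j ji]; last first.
  by rewrite /= (bar_faceK t ji) (bar_coefK t m ji).
by apply: eq_bigr => i _; rewrite raddfMz /= bar_dU mulrz_suml.
Qed.

Lemma bar_out_d n (x : bar M n.+1) : bar_out M n (bar_d x) = 0.
Proof. by case: n x => [//|n] x; apply: bar_dd. Qed.

End BarSquare.

(** * Functoriality and exactness of the bar complex *)

Section BarMaps.
Variables (G H : groupType) (M : gmod G) (N : gmod H).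
Variables (phi : G -> H) (f : {additive M -> N}).
Hypothesis phiM : forall g h, phi (g * h)%g = (phi g * phi h)%g.
Hypothesis f_equiv : forall g m, f (gact g m) = gact (phi g) (f m).

Lemma bar_map_dG n (x : bar M n.+1) : bar_map phi f (bar_d x) = bar_d (bar_map phi f x).
Proof.
have phi1 : phi 1%g = 1%g by apply: (mulgI (phi 1%g)); rewrite -phiM !mulg1.
have phiV g : phi g^-1%g = (phi g)^-1%g.
  by apply: (mulgI (phi g)); rewrite -phiM !mulgV.
apply: (@malg_additive_ext _ _ _ (@bar_map _ _ _ _ phi f n \o @bar_d _ M n)
          (@bar_d _ N n \o @bar_map _ _ _ _ phi f n.+1)) => t m /=.
rewrite bar_mapU !bar_dU raddf_sum; apply: eq_bigr => i _.
rewrite raddfMz /= bar_mapU.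
have -> : f (bar_coef M i t m) = bar_coef N i (map_tuple phi t) (f m).
  rewrite /bar_coef; case: (i == ord0) => //=.
  by rewrite f_equiv phiV /thead tnth_map.
have -> // : map_tuple phi (bar_face i t) = bar_face i (map_tuple phi t).
apply: eq_from_tnth => k; rewrite tnth_map !tnth_mktuple !tnth_map.
by case: ifP => // _; case: ifP => // _.
Qed.

End BarMaps.

Section BarExact.
Variable G : groupType.

Lemma mcoeff_bar_map (M N : gmod G) (f : {additive M -> N}) n (x : bar M n) t :
  (bar_map idfun f x)@_t = f x@_t.
Proof.
apply: (@malg_additive_ext _ _ _ (mcoeff t \o @bar_map _ _ M N idfun f n)
          (f \o mcoeff t)) => u m /=.
rewrite bar_mapU !mcoeffU (_ : map_tuple idfun u = u) ?raddfMn //.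
by apply: val_inj; rewrite /= map_id.
Qed.

Lemma bar_map_comp0 (M N P : gmod G) (f : {additive M -> N}) (g : {additive N -> P})
    n (x : bar M n) :
  (forall m, g (f m) = 0) -> bar_map idfun g (bar_map idfun f x) = 0.
Proof. by move=> gf; apply/malgP => t; rewrite !mcoeff_bar_map gf mcoeff0. Qed.

Lemma bar_map_inj (M N : gmod G) (f : {additive M -> N}) n (x : bar M n) :
  (forall m, f m = 0 -> m = 0) -> bar_map idfun f x = 0 -> x = 0.
Proof.
move=> f_inj fx; apply/malgP => t; rewrite mcoeff0; apply: f_inj.
by rewrite -mcoeff_bar_map fx mcoeff0.
Qed.

Lemma bar_map_lift (M N : gmod G) (f : {additive M -> N}) n (y : bar N n) :
  (forall t, exists m, f m = y@_t) -> exists x, bar_map idfun f x = y.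
Proof.
move=> fy; pose u t := sval (cid (fy t)).
exists (\sum_(t <- msupp y) << u t *g t >> : bar M n).
rewrite raddf_sum [RHS]monalgE; apply: eq_bigr => t _ /=.
have mt : map_tuple idfun t = t by apply: val_inj; rewrite /= map_id.
by rewrite bar_mapU (svalP (cid (fy t))) mt.
Qed.

(** In each bar degree the chains are a direct sum of copies of the coefficient
    module, so exactness can be checked one coefficient at a time. *)
Lemma bar_map_exact (M N P : gmod G) (f : {additive M -> N}) (g : {additive N -> P})
    n (y : bar N n) :
    (forall m, g m = 0 -> exists m', f m' = m) ->
  bar_map idfun g y = 0 -> exists x, bar_map idfun f x = y.
Proof.
move=> fg gy; apply: bar_map_lift => t; apply: fg.
by rewrite -mcoeff_bar_map gy mcoeff0.
Qed.
End BarExact.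

(** * Low-dimensional bar chains *)

Section TupleInd.
Variable T : groupType.

Definition tup0 : 0.-tuple T := [tuple].
Definition tup1 (a : T) : 1.-tuple T := [tuple a].
Definition tup2 (a b : T) : 2.-tuple T := [tuple a; b].
Definition tup3 (a b c : T) : 3.-tuple T := [tuple a; b; c].

Lemma tup0E (t : 0.-tuple T) : t = tup0. Proof. exact: tuple0. Qed.

Lemma tuple1_ind (P : 1.-tuple T -> Prop) : (forall a, P (tup1 a)) -> forall t, P t.
Proof.
move=> PT t; case/tupleP: t => a t; rewrite (tup0E t); move: (PT a).
by rewrite (_ : (tup1 a) = [tuple of a :: tup0]) //; apply: val_inj.
Qed.

Lemma tuple2_ind (P : 2.-tuple T -> Prop) :
  (forall a b, P (tup2 a b)) -> forall t, P t.
Proof.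
move=> PT t; case/tupleP: t => a t; elim/tuple1_ind: t => b; move: (PT a b).
by rewrite (_ : (tup2 a b) = [tuple of a :: (tup1 b)]) //; apply: val_inj.
Qed.

Lemma tuple3_ind (P : 3.-tuple T -> Prop) :
  (forall a b c, P (tup3 a b c)) -> forall t, P t.
Proof.
move=> PT t; case/tupleP: t => a t; elim/tuple2_ind: t => b c; move: (PT a b c).
by rewrite (_ : (tup3 a b c) = [tuple of a :: (tup2 b c)]) //; apply: val_inj.
Qed.
End TupleInd.
Arguments tup0 {T}.

Section AltSums.
Variable V : zmodType.

Lemma alt_sum2 (F : 'I_2 -> V) : \sum_(i < 2) F i *~ (-1) ^+ i = F 0 - F 1.
Proof.
rewrite !big_ord_recl big_ord0 /= addr0 expr0 mulr1z expr1 mulrN1z.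
by congr (_ - F _); apply: val_inj.
Qed.

Lemma alt_sum3 (F : 'I_3 -> V) :
  \sum_(i < 3) F i *~ (-1) ^+ i = F 0 - F 1 + F 2%:R.
Proof.
rewrite !big_ord_recl big_ord0 /= addr0 expr0 mulr1z expr1 mulrN1z sqrrN expr1n mulr1z.
by rewrite addrA; congr (_ - F _ + F _); apply: val_inj.
Qed.

Lemma alt_sum4 (F : 'I_4 -> V) :
  \sum_(i < 4) F i *~ (-1) ^+ i = F 0 - F 1 + F 2%:R - F 3%:R.
Proof.
rewrite !big_ord_recl big_ord0 /= addr0 expr0 mulr1z expr1 mulrN1z sqrrN expr1n mulr1z.
rewrite (_ : (-1) ^+ 3 = -1 :> int) // mulrN1z !addrA.
by congr (_ - F _ + F _ - F _); apply: val_inj.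
Qed.
End AltSums.

Section LowDegree.
Variables (G : groupType) (M : gmod G).
Implicit Types (m : M) (g h k : G).

Lemma bar_dD n (x y : bar M n.+1) : bar_d (x + y) = bar_d x + bar_d y.
Proof. exact: raddfD. Qed.

Lemma bar_dB n (x y : bar M n.+1) : bar_d (x - y) = bar_d x - bar_d y.
Proof. exact: raddfB. Qed.

Lemma bar_dN n (x : bar M n.+1) : bar_d (- x) = - bar_d x.
Proof. exact: raddfN. Qed.

Lemma bar_d0 n : bar_d (0 : bar M n.+1) = 0.
Proof. exact: raddf0. Qed.

Lemma bar_d1E m g :
  bar_d << m *g (tup1 g) >> =
    << gact g^-1%g m *g tup0 >> - << m *g tup0 >> :> bar M 0.
Proof.
apply: etrans (bar_dU _ _) _.
apply: etrans (alt_sum2 _) _.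
have e i : bar_face i (tup1 g) = tup0 by rewrite (tup0E (bar_face i _)).
by rewrite !e.
Qed.

Lemma bar_d2E m g h :
  bar_d << m *g (tup2 g h) >> =
    << gact g^-1%g m *g (tup1 h) >> - << m *g (tup1 (g * h)%g) >>
    + << m *g (tup1 g) >> :> bar M 1.
Proof.
have face2 (i : 'I_3) (a : G) : nth 1%g (bar_face i (tup2 g h)) 0 = a ->
    bar_face i (tup2 g h) = (tup1 a).
  by elim/tuple1_ind: (bar_face _ _) => b /= ->.
have e0 : bar_face 0 (tup2 g h) = (tup1 h) by apply: face2; rewrite nth_bar_face.
have e1 : bar_face 1 (tup2 g h) = (tup1 (g * h)%g).
  by apply: face2; rewrite nth_bar_face.
have e2 : bar_face 2%:R (tup2 g h) = (tup1 g) by apply: face2; rewrite nth_bar_face.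
apply: etrans (bar_dU _ _) _; apply: etrans (alt_sum3 _) _.
by rewrite e0 e1 e2.
Qed.

Lemma bar_d3E m g h k :
  bar_d << m *g (tup3 g h k) >> =
    << gact g^-1%g m *g (tup2 h k) >> - << m *g (tup2 (g * h)%g k) >>
    + << m *g (tup2 g (h * k)%g) >> - << m *g (tup2 g h) >> :> bar M 2.
Proof.
have face3 (i : 'I_4) (a b : G) : nth 1%g (bar_face i (tup3 g h k)) 0 = a ->
    nth 1%g (bar_face i (tup3 g h k)) 1 = b ->
    bar_face i (tup3 g h k) = (tup2 a b).
  by elim/tuple2_ind: (bar_face _ _) => c d /= -> ->.
have e0 : bar_face 0 (tup3 g h k) = (tup2 h k).
  by apply: face3; rewrite nth_bar_face.
have e1 : bar_face 1 (tup3 g h k) = (tup2 (g * h)%g k).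
  by apply: face3; rewrite nth_bar_face.
have e2 : bar_face 2%:R (tup3 g h k) = (tup2 g (h * k)%g).
  by apply: face3; rewrite nth_bar_face.
have e3 : bar_face 3%:R (tup3 g h k) = (tup2 g h).
  by apply: face3; rewrite nth_bar_face.
apply: etrans (bar_dU _ _) _; apply: etrans (alt_sum4 _) _.
by rewrite e0 e1 e2 e3.
Qed.
End LowDegree.

Lemma monalgU_int (J : choiceType) (j : J) (a : int) :
  << a *g j >> = (<< j >> : {malg int[J]}) *~ a.
Proof.
by rewrite -[in LHS](intz a) -(raddfMz (mkmalgU j : {additive int -> {malg int[J]}})).
Qed.

Lemma free_additive_ext (J : choiceType) (N : zmodType)
    (f g : {additive {malg int[J]} -> N}) :
  (forall j, f << j >> = g << j >>) -> f =1 g.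
Proof.
move=> fg x; rewrite [x]monalgE !raddf_sum; apply: eq_bigr => c _.
by rewrite monalgU_int !raddfMz fg.
Qed.

Lemma free_ind (J : choiceType) (P : {malg int[J]} -> Prop) : P 0 ->
    (forall x y, P x -> P y -> P (x - y)) -> (forall j, P << j >>) ->
  forall x, P x.
Proof.
move=> P0 PB PU.
have PN x : P x -> P (- x) by move=> Px; rewrite -sub0r; apply: PB.
have PD x y : P x -> P y -> P (x + y) by move=> Px Py; rewrite -[y]opprK; apply/PB/PN.
have PMn x j : P x -> P (x *+ j).
  by move=> Px; elim: j => [|j IH]; [rewrite mulr0n|rewrite mulrS; apply: PD].
have PMz x (a : int) : P x -> P (x *~ a).
  by move=> Px; case: a => j; [apply: PMn|apply/PN/PMn].
move=> x; rewrite [x]monalgE; apply: (big_ind P) => // j _.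
by rewrite monalgU_int; apply/PMz/PU.
Qed.

HB.lock Definition pcell (G : groupType) (X : gconf G) n k (c : config X n)
  (t : k.-tuple G) : bar (chain_gmod X n) k := << (<< c >> : chain_gmod X n) *g t >>.

HB.lock Definition bar_lift (G : groupType) (X : gconf G) n (N : zmodType) k
    (F : k.-tuple G -> config X n -> N) : bar (chain_gmod X n) k -> N :=
  malg_lift (fun t => free_lift (F t) : {additive chain_gmod X n -> N}).

Section PermutationModule.
Variables (G : groupType) (X : gconf G) (n : nat).
Local Notation K := (config X n).
Local Notation M := (chain_gmod X n).

Lemma gact_cell g (c : K) : gact g (<< c >> : M) = << config_act g c >>.
Proof. exact: chain_actU. Qed.

Lemma pcellE k (c : K) (t : k.-tuple G) : pcell c t = << (<< c >> : M) *g t >>.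
Proof. by rewrite [pcell]unlock. Qed.

Section Lift.
Variables (N : zmodType) (k : nat) (F : k.-tuple G -> K -> N).

Fact bar_lift_additive : zmod_morphism (bar_lift F).
Proof. by rewrite [bar_lift]unlock => x y; rewrite raddfB. Qed.
HB.instance Definition _ :=
  GRing.isZmodMorphism.Build (bar M k) N (bar_lift F) bar_lift_additive.

Lemma bar_liftU c t : bar_lift F (pcell c t) = F t c.
Proof.
rewrite pcellE [bar_lift]unlock; have e := @malg_liftU _ M N (fun t => free_lift (F t)) t << c >>.
apply: etrans e _; apply: etrans (free_liftU _ _ _) _.
exact: mulr1z.
Qed.
End Lift.

Lemma bar_ind k (P : bar M k -> Prop) : P 0 ->
    (forall x y, P x -> P y -> P (x - y)) -> (forall c t, P (pcell c t)) ->
  forall x, P x.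
Proof.
move=> P0 PB PU x; have PD y z : P y -> P z -> P (y + z).
  by move=> Py Pz; rewrite -[z]opprK -[- z]sub0r; apply/(PB)/(PB).
pose U t : {additive {malg int[K]} -> bar M k} := mkmalgU t.
have PUt t m : P (U t m).
  move: m; apply: free_ind => [|m m' Pm Pm'|c].
  - by rewrite (raddf0 (U t)).
  - by rewrite (raddfB (U t)); apply: PB.
  - by move: (PU c t); rewrite pcellE.
by rewrite [x]monalgE; apply: (big_ind P) => // t _; apply: PUt.
Qed.
End PermutationModule.

(** * Homology of transitive permutation modules *)

Section PermCells.
Variables (G : groupType) (X : gconf G) (n : nat).
Implicit Type c : config X n.

Lemma config_actMV c g h :
  config_act (g * h)^-1%g c = config_act h^-1%g (config_act g^-1%g c).
Proof. by rewrite invgM config_actM. Qed.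

Lemma pcell_d1 c g :
  bar_d (pcell c (tup1 g)) = pcell (config_act g^-1%g c) tup0 - pcell c tup0.
Proof. by rewrite !pcellE bar_d1E gact_cell. Qed.

Lemma pcell_d2 c g h :
  bar_d (pcell c (tup2 g h)) = pcell (config_act g^-1%g c) (tup1 h)
    - pcell c (tup1 (g * h)%g) + pcell c (tup1 g).
Proof. by rewrite !pcellE bar_d2E gact_cell. Qed.

Lemma pcell_d3 c g h k :
  bar_d (pcell c (tup3 g h k)) = pcell (config_act g^-1%g c) (tup2 h k)
    - pcell c (tup2 (g * h)%g k) + pcell c (tup2 g (h * k)%g)
    - pcell c (tup2 g h).
Proof. by rewrite !pcellE bar_d3E gact_cell. Qed.

(** Conjugation by [w] is trivial in homology: the chain [[g|w] - [w|g]] bounds the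
    difference of the two transported one-cells. *)
Lemma pcell_conj c c' g w : config_act g^-1%g c = c -> config_act w^-1%g c = c' ->
    (g * w)%g = (w * g)%g ->
  pcell c (tup1 g) - pcell c' (tup1 g) =
    bar_d (pcell c (tup2 g w) - pcell c (tup2 w g)).
Proof.
move=> gc <- gw; rewrite bar_dB !pcell_d2 gc; set x := pcell c (tup1 (g * w)%g).
have -> : pcell c (tup1 (w * g)%g) = x by rewrite /x gw.
zmodule.
Qed.

Lemma pcell_d2_1 c : bar_d (pcell c (tup2 1%g 1%g)) = pcell c (tup1 1%g).
Proof. by rewrite pcell_d2 mulg1 invg1 config_act1 subrr add0r. Qed.
End PermCells.

Section Shapiro.
Variables (G : groupType) (X : gconf G) (n : nat).
Local Notation K := (config X n).
Local Notation M := (chain_gmod X n).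
Variables (c0 : K) (s : K -> G).
Hypothesis s_act : forall c, config_act (s c) c0 = c.

(** The Schreier element: a choice [s] of transporters from the base point turns
    [g], read at the point [c], into an element of the stabiliser. *)
Definition stab_elem (g : G) (c : K) : G :=
  ((s c)^-1 * g * s (config_act g^-1 c))%g.

Lemma stab_elemE g c : (s c * stab_elem g c = g * s (config_act g^-1 c))%g.
Proof. by rewrite /stab_elem !mulgA mulgV mul1g. Qed.

Lemma s_actV c : config_act (s c)^-1%g c = c0.
Proof. by rewrite -{2}(s_act c) -config_actM mulVg config_act1. Qed.

Lemma stab_elem_act g c : config_act (stab_elem g c) c0 = c0.
Proof.
by rewrite /stab_elem !config_actM s_act -(config_actM g) mulgV config_act1 s_actV.
Qed.

Lemma stab_elemM g h c :
  stab_elem (g * h)%g c = (stab_elem g c * stab_elem h (config_act g^-1 c))%g.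
Proof.
by rewrite /stab_elem config_actMV !mulgA mulgK.
Qed.

Definition rho1 : bar M 1 -> bar M 1 :=
  bar_lift (fun t c => pcell c0 (tup1 (stab_elem (tnth t 0) c))).
HB.instance Definition _ := GRing.Additive.on rho1.

Definition rho2 : bar M 2 -> bar M 2 :=
  bar_lift (fun t c => pcell c0 (tup2 (stab_elem (tnth t 0) c) (stab_elem (tnth t 1) (config_act (tnth t 0)^-1%g c)))).
HB.instance Definition _ := GRing.Additive.on rho2.

Definition htpy0 : bar M 0 -> bar M 1 :=
  bar_lift (fun t c => pcell c (tup1 (s c))).
HB.instance Definition _ := GRing.Additive.on htpy0.

Definition htpy1 : bar M 1 -> bar M 2 :=
  bar_lift (fun t c => let g := tnth t 0 in
    pcell c (tup2 g (s (config_act g^-1%g c)))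
    - pcell c (tup2 (s c) (stab_elem g c))).
HB.instance Definition _ := GRing.Additive.on htpy1.

Definition htpy2 : bar M 2 -> bar M 3 :=
  bar_lift (fun t c => let g := tnth t 0 in let h := tnth t 1 in
    let c1 := config_act g^-1%g c in let c2 := config_act h^-1%g c1 in
    pcell c (tup3 g h (s c2)) - pcell c (tup3 g (s c1) (stab_elem h c1))
    + pcell c (tup3 (s c) (stab_elem g c) (stab_elem h c1))).
HB.instance Definition _ := GRing.Additive.on htpy2.

Lemma rho1U c g : rho1 (pcell c (tup1 g)) = pcell c0 (tup1 (stab_elem g c)).
Proof. exact: bar_liftU. Qed.

Lemma rho2U c g h : rho2 (pcell c (tup2 g h)) =
  pcell c0 (tup2 (stab_elem g c) (stab_elem h (config_act g^-1%g c))).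
Proof. exact: bar_liftU. Qed.

Lemma htpy0U c : htpy0 (pcell c tup0) = pcell c (tup1 (s c)).
Proof. exact: bar_liftU. Qed.

Lemma htpy1U c g : htpy1 (pcell c (tup1 g)) =
  pcell c (tup2 g (s (config_act g^-1%g c))) - pcell c (tup2 (s c) (stab_elem g c)).
Proof. exact: bar_liftU. Qed.

Lemma htpy2U c g h (c1 := config_act g^-1%g c) :
  htpy2 (pcell c (tup2 g h)) =
    pcell c (tup3 g h (s (config_act h^-1%g c1)))
    - pcell c (tup3 g (s c1) (stab_elem h c1))
    + pcell c (tup3 (s c) (stab_elem g c) (stab_elem h c1)).
Proof. exact: bar_liftU. Qed.

Lemma htpy0B x y : htpy0 (x - y) = htpy0 x - htpy0 y.
Proof. exact: raddfB. Qed.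

Lemma htpy1B x y : htpy1 (x - y) = htpy1 x - htpy1 y.
Proof. exact: raddfB. Qed.

Lemma htpy1D x y : htpy1 (x + y) = htpy1 x + htpy1 y.
Proof. exact: raddfD. Qed.

Lemma rho1B x y : rho1 (x - y) = rho1 x - rho1 y.
Proof. exact: raddfB. Qed.

Lemma rho2B x y : rho2 (x - y) = rho2 x - rho2 y.
Proof. exact: raddfB. Qed.

Lemma htpy2B x y : htpy2 (x - y) = htpy2 x - htpy2 y.
Proof. exact: raddfB. Qed.

(** The identity and the retraction of the transport groupoid onto the stabiliser
    are naturally isomorphic through [s]; the prism operators of this
    isomorphism are the homotopies used here, up to sign, in the degrees that
    [H_1] and [H_2] require. *)
Lemma htpy1_d x : bar_d (htpy1 x) = x - rho1 x + htpy0 (bar_d x).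
Proof.
elim/bar_ind: x => [|x y IHx IHy|c t].
- by rewrite (raddf0 htpy1) !bar_d0 (raddf0 rho1) (raddf0 htpy0) subrr addr0.
- by rewrite htpy1B !bar_dB rho1B htpy0B IHx IHy; zmodule.
elim/tuple1_ind: t => g; rewrite htpy1U rho1U pcell_d1 bar_dB htpy0B.
rewrite !htpy0U.
by rewrite !pcell_d2 s_actV stab_elemE; zmodule.
Qed.

Lemma htpy2_d x : bar_d (htpy2 x) = rho2 x - x + htpy1 (bar_d x).
Proof.
elim/bar_ind: x => [|x y IHx IHy|c t].
- by rewrite (raddf0 htpy2) !bar_d0 (raddf0 rho2) (raddf0 htpy1) subrr addr0.
- by rewrite htpy2B !bar_dB rho2B htpy1B IHx IHy; zmodule.
elim/tuple2_ind: t => g h.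
rewrite htpy2U rho2U pcell_d2 bar_dD bar_dB htpy1D htpy1B !htpy1U.
rewrite !pcell_d3 s_actV !stab_elemE -stab_elemM config_actMV.
zmodule.
Qed.
End Shapiro.

(** * Shapiro's lemma in low degrees *)

HB.lock Definition tcell (S : groupType) k (t : k.-tuple S) : bar (triv_int S) k :=
  << 1 *g t >>.

Section TrivialBar.
Variable S : groupType.
Local Notation C := (bar (triv_int S)).
Implicit Types a b c : S.

Lemma tcellE k (t : k.-tuple S) : tcell t = << (1 : triv_int S) *g t >>.
Proof. by rewrite [tcell]unlock. Qed.

Lemma tcell_d2 a b :
  bar_d (tcell (tup2 a b)) = tcell (tup1 b) - tcell (tup1 (a * b)%g) + tcell (tup1 a).
Proof. by rewrite !tcellE bar_d2E. Qed.

Lemma tcell_d3 a b c :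
  bar_d (tcell (tup3 a b c)) = tcell (tup2 b c) - tcell (tup2 (a * b)%g c)
    + tcell (tup2 a (b * c)%g) - tcell (tup2 a b).
Proof. by rewrite !tcellE bar_d3E. Qed.

Lemma bar_triv_ind k (P : C k -> Prop) : P 0 ->
    (forall x y, P x -> P y -> P (x - y)) -> (forall t, P (tcell t)) ->
  forall x, P x.
Proof. by move=> P0 PB PU; apply: free_ind => // t; move: (PU t); rewrite tcellE. Qed.

End TrivialBar.

HB.lock Definition csum (G : groupType) (X : gconf G) n : chain_gmod X n -> int :=
  free_lift (fun=> 1).

Section CoinvariantsAndFreeActions.
Variables (G : groupType) (X : gconf G) (n : nat).
Local Notation K := (config X n).
Local Notation M := (chain_gmod X n).
Variable c0 : K.
Hypothesis trans : forall c, exists g, config_act g c0 = c.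

Fact csum_additive : zmod_morphism (@csum _ _ _ : M -> int).
Proof. by rewrite [csum]unlock => x y; rewrite raddfB. Qed.
HB.instance Definition _ := GRing.isZmodMorphism.Build M int (@csum _ _ _) csum_additive.

Lemma csumU c : csum (<< c >> : M) = 1.
Proof. by rewrite [csum]unlock; exact: etrans (free_liftU _ _ _) (mulr1z _). Qed.

Lemma csum_pcell c : csum (pcell c tup0 : bar M 0)@_tup0 = 1.
Proof. rewrite pcellE; exact: etrans (congr1 _ (mcoeffUU _ _)) (csumU c). Qed.

Lemma csum_bar_d (x : bar M 1) : csum (bar_d x)@_tup0 = 0.
Proof.
elim/bar_ind: x => [|x y IHx IHy|c t].
- by rewrite bar_d0 mcoeff0 (raddf0 (@csum G X n)).
- by rewrite bar_dB mcoeffB (raddfB (@csum G X n)) /= IHx IHy subrr.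
elim/tuple1_ind: t => g; rewrite pcell_d1 mcoeffB (raddfB (@csum G X n)) /=.
by rewrite !csum_pcell subrr.
Qed.

Let s c := sval (cid (trans c)).
Let s_act c : config_act (s c) c0 = c. Proof. exact: (svalP (cid (trans c))). Qed.

(** The coinvariants of a transitive permutation module are infinite cyclic, so
    the sum of the coefficients detects them. *)
Lemma coinvariants_csum0 m : csum m = 0 ->
  exists x : bar M 1, bar_d x = << m *g tup0 >>.
Proof.
pose cst (x : bar M 0) : bar M 0 := << (<< c0 >> : M) *~ csum x@_tup0 *g tup0 >>.
have cstB x y : cst (x - y) = cst x - cst y.
  rewrite /cst mcoeffB (raddfB (@csum G X n)) /= mulrzBr.
  exact: (raddfB (mkmalgU tup0 : {additive M -> bar M 0})).
have cst0 : cst 0 = 0.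
  rewrite /cst mcoeff0 (raddf0 (@csum G X n)) mulr0z.
  exact: (raddf0 (mkmalgU tup0 : {additive M -> bar M 0})).
have dx x : bar_d (htpy0 s x) = cst x - x.
  elim/bar_ind: x => [|x y IHx IHy|c t].
  - by rewrite (raddf0 (htpy0 s)) bar_d0 cst0 subrr.
  - by rewrite htpy0B bar_dB IHx IHy cstB; zmodule.
  rewrite (tup0E t) htpy0U pcell_d1 (s_actV s_act); congr (_ - _).
  by rewrite /cst csum_pcell mulr1z pcellE.
move=> m0; exists (- htpy0 s << m *g tup0 >>); rewrite bar_dN dx.
by rewrite /cst mcoeffUU m0 mulr0z monalgU0 sub0r opprK.
Qed.

(** All the Schreier elements are trivial, so the retraction only produces cells
    on the identity, which are boundaries of [1|1]. *)
Lemma free_H1 (x : bar M 1) : (forall g, config_act g c0 = c0 -> g = 1%g) ->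
  bar_d x = 0 -> exists y, bar_d y = x.
Proof.
move=> c0_free dx.
pose e : bar M 1 -> bar M 2 := bar_lift (fun _ _ => pcell c0 (tup2 1%g 1%g)).
have eB u v : e (u - v) = e u - e v by apply: raddfB.
have de u : bar_d (e u) = rho1 c0 s u.
  elim/bar_ind: u => [|u v IHu IHv|c t].
  - by rewrite (raddf0 (rho1 c0 s)) [e 0]raddf0 bar_d0.
  - by rewrite eB bar_dB rho1B IHu IHv.
  elim/tuple1_ind: t => g; rewrite rho1U [e _]bar_liftU pcell_d2.
  rewrite (c0_free _ (stab_elem_act s_act g c)) mulg1 invg1 config_act1; zmodule.
exists (htpy1 s x + e x); rewrite bar_dD (htpy1_d s_act) de dx (raddf0 (htpy0 s)).
zmodule.
Qed.

End CoinvariantsAndFreeActions.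

Section ShapiroLemma.
Variables (G S : groupType) (X : gconf G) (n : nat).
Local Notation K := (config X n).
Local Notation M := (chain_gmod X n).
Variables (c0 : K) (iota : S -> G).
Hypothesis trans : forall c, exists g, config_act g c0 = c.
Hypothesis iotaM : forall a b, iota (a * b)%g = (iota a * iota b)%g.
Hypothesis iota_inj : injective iota.
Hypothesis iota_stab : forall a, config_act (iota a) c0 = c0.
Hypothesis stab_iota : forall g, config_act g c0 = c0 -> exists a, iota a = g.

Definition shapiro k : bar (triv_int S) k -> bar M k :=
  @bar_map _ _ (triv_int S) M iota (mkmalgU c0 : {additive int -> M}) k.
HB.instance Definition _ k := GRing.Additive.on (@shapiro k).

Lemma shapiro_d k (x : bar (triv_int S) k.+1) : shapiro (bar_d x) = bar_d (shapiro x).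
Proof.
apply: bar_map_dG => // a m.
by rewrite /= chain_actU iota_stab.
Qed.

Lemma shapiroB k (x y : bar (triv_int S) k) : shapiro (x - y) = shapiro x - shapiro y.
Proof. exact: raddfB. Qed.

Lemma shapiroU k t : shapiro (tcell t) = pcell c0 (map_tuple iota t) :> bar M k.
Proof. by rewrite tcellE pcellE; apply: bar_mapU. Qed.

Lemma shapiroU1 a : shapiro (tcell (tup1 a)) = pcell c0 (tup1 (iota a)).
Proof. by rewrite shapiroU; congr pcell; apply: val_inj. Qed.

Lemma shapiroU2 a b : shapiro (tcell (tup2 a b)) = pcell c0 (tup2 (iota a) (iota b)).
Proof. by rewrite shapiroU; congr pcell; apply: val_inj. Qed.

(* With [s c0 = 1], restricting the retraction to the stabiliser gives the
   identity on the nose, whence injectivity without a further homotopy. *)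
Let s c := if c == c0 then 1%g else sval (cid (trans c)).
Let s_act c : config_act (s c) c0 = c.
Proof.
by rewrite /s; case: eqP => [->|_]; [apply: config_act1|apply: (svalP (cid (trans c)))].
Qed.
Let s1 : s c0 = 1%g. Proof. by rewrite /s eqxx. Qed.

Let p g c : S := sval (cid (stab_iota (stab_elem_act s_act g c))).
Let iota_p g c : iota (p g c) = stab_elem s g c.
Proof. exact: (svalP (cid (stab_iota (stab_elem_act s_act g c)))). Qed.

Let pM g h c : p (g * h)%g c = (p g c * p h (config_act g^-1%g c))%g.
Proof. by apply: iota_inj; rewrite iotaM !iota_p stab_elemM. Qed.

Let p_iota a : p (iota a) c0 = a.
Proof.
have iotaV : config_act (iota a)^-1%g c0 = c0.
  by rewrite -{1}(iota_stab a) -config_actM mulVg config_act1.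
by apply: iota_inj; rewrite iota_p /stab_elem iotaV s1 invg1 mul1g mulg1.
Qed.

Let r1 : bar M 1 -> bar (triv_int S) 1 :=
  bar_lift (fun t c => tcell (tup1 (p (tnth t 0) c))).
Let r2 : bar M 2 -> bar (triv_int S) 2 :=
  bar_lift (fun t c => tcell (tup2 (p (tnth t 0) c)
     (p (tnth t 1) (config_act (tnth t 0)^-1%g c)))).
Let r3 : bar M 3 -> bar (triv_int S) 3 :=
  bar_lift (fun t c => tcell (tup3 (p (tnth t 0) c)
     (p (tnth t 1) (config_act (tnth t 0)^-1%g c))
     (p (nth 1%g t 2) (config_act (nth 1 t 1)^-1%g (config_act (tnth t 0)^-1%g c))))).

Let r1U c g : r1 (pcell c (tup1 g)) = tcell (tup1 (p g c)).
Proof. exact: bar_liftU. Qed.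
Let r2U c g h : r2 (pcell c (tup2 g h)) =
  tcell (tup2 (p g c) (p h (config_act g^-1%g c))).
Proof. exact: bar_liftU. Qed.
Let r3U c g h k : r3 (pcell c (tup3 g h k)) =
  tcell (tup3 (p g c) (p h (config_act g^-1%g c))
           (p k (config_act h^-1%g (config_act g^-1%g c)))).
Proof. exact: bar_liftU. Qed.
Let r1B x y : r1 (x - y) = r1 x - r1 y. Proof. exact: raddfB. Qed.
Let r1D x y : r1 (x + y) = r1 x + r1 y. Proof. exact: raddfD. Qed.
Let r2B x y : r2 (x - y) = r2 x - r2 y. Proof. exact: raddfB. Qed.
Let r2D x y : r2 (x + y) = r2 x + r2 y. Proof. exact: raddfD. Qed.
Let r3B x y : r3 (x - y) = r3 x - r3 y. Proof. exact: raddfB. Qed.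

Let r2_d x : bar_d (r2 x) = r1 (bar_d x).
Proof.
elim/bar_ind: x => [|x y IHx IHy|c t].
- by rewrite bar_d0 [r2 0]raddf0 [r1 0]raddf0 bar_d0.
- by rewrite r2B !bar_dB r1B IHx IHy.
by elim/tuple2_ind: t => g h; rewrite r2U pcell_d2 tcell_d2 r1D r1B !r1U pM.
Qed.

Let r3_d x : bar_d (r3 x) = r2 (bar_d x).
Proof.
elim/bar_ind: x => [|x y IHx IHy|c t].
- by rewrite bar_d0 [r2 0]raddf0 [r3 0]raddf0 bar_d0.
- by rewrite r3B !bar_dB r2B IHx IHy.
elim/tuple3_ind: t => g h k.
by rewrite r3U pcell_d3 tcell_d3 r2B r2D r2B !r2U !pM config_actMV.
Qed.

Let shapiro_r1 x : shapiro (r1 x) = rho1 c0 s x.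
Proof.
elim/bar_ind: x => [|x y IHx IHy|c t].
- by rewrite [r1 0]raddf0 (raddf0 (rho1 c0 s)) [shapiro 0]raddf0.
- by rewrite r1B shapiroB rho1B IHx IHy.
by elim/tuple1_ind: t => g; rewrite r1U rho1U shapiroU1 iota_p.
Qed.

Let shapiro_r2 x : shapiro (r2 x) = rho2 c0 s x.
Proof.
elim/bar_ind: x => [|x y IHx IHy|c t].
- by rewrite [r2 0]raddf0 (raddf0 (rho2 c0 s)) [shapiro 0]raddf0.
- by rewrite r2B shapiroB rho2B IHx IHy.
by elim/tuple2_ind: t => g h; rewrite r2U rho2U shapiroU2 !iota_p.
Qed.

Let r2_shapiro y : r2 (shapiro y) = y.
Proof.
elim/bar_triv_ind: y => [|x y IHx IHy|t].
- by rewrite [shapiro 0]raddf0 [r2 0]raddf0.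
- by rewrite shapiroB r2B IHx IHy.
elim/tuple2_ind: t => a b; rewrite shapiroU2 r2U p_iota.
have iotaV : config_act (iota a)^-1%g c0 = c0.
  by rewrite -{1}(iota_stab a) -config_actM mulVg config_act1.
by rewrite iotaV p_iota.
Qed.

Lemma shapiro_surj1 (x : bar M 1) : bar_d x = 0 ->
  exists (y : bar (triv_int S) 1) (z : bar M 2), x = shapiro y + bar_d z.
Proof.
move=> dx; exists (r1 x), (htpy1 s x).
by rewrite (htpy1_d s_act) dx (raddf0 (htpy0 s)) shapiro_r1; zmodule.
Qed.

Lemma shapiro_surj2 (x : bar M 2) : bar_d x = 0 ->
  exists (y : bar (triv_int S) 2) (z : bar M 3), bar_d y = 0 /\ x = shapiro y + bar_d z.
Proof.
move=> dx; exists (r2 x), (- htpy2 s x).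
rewrite r2_d dx [r1 0]raddf0 bar_dN (htpy2_d s_act) dx (raddf0 (htpy1 s)) shapiro_r2.
by split=> //; zmodule.
Qed.

Lemma shapiro_inj2 (y : bar (triv_int S) 2) (z : bar M 3) : shapiro y = bar_d z -> exists w, y = bar_d w.
Proof. by move=> e; exists (r3 z); rewrite r3_d -e r2_shapiro. Qed.

End ShapiroLemma.

(** * Second-page classes at chain level *)

Lemma has_class_map (U V W U' V' W' : zmodType)
    (f : {additive U -> V}) (g : {additive V -> W})
    (f' : {additive U' -> V'}) (g' : {additive V' -> W'}) (phi : {additive V -> V'})
    (phi_cycle : forall x, g x = 0 -> g' (phi x) = 0)
    (phi_bound : forall u, exists u', f' u' = phi (f u)) x (h : homology f g) :
  has_class x h -> has_class (phi x) (homology_map phi_cycle phi_bound h).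
Proof.
move=> [z <- <-]; rewrite /homology_map /= (homology_map_pi phi_cycle phi_bound).
by exists (Defs.cycle_map phi_cycle z).
Qed.

Section SecondPage.
Variable A : comPzRingType.

Lemma d_hB p q (x y : D A p.+1 q) : d_h (x - y) = d_h x - d_h y.
Proof. exact: raddfB. Qed.
Lemma d_hD p q (x y : D A p.+1 q) : d_h (x + y) = d_h x + d_h y.
Proof. exact: raddfD. Qed.
Lemma d_hN p q (x : D A p.+1 q) : d_h (- x) = - d_h x.
Proof. exact: raddfN. Qed.
Lemma d_h0 p q : d_h (0 : D A p.+1 q) = 0.
Proof. exact: raddf0. Qed.
Lemma d_vB p q (x y : D A p q.+1) : d_v (x - y) = d_v x - d_v y.
Proof. exact: raddfB. Qed.
Lemma d_vD p q (x y : D A p q.+1) : d_v (x + y) = d_v x + d_v y.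
Proof. exact: raddfD. Qed.
Lemma d_vN p q (x : D A p q.+1) : d_v (- x) = - d_v x.
Proof. exact: raddfN. Qed.
Lemma d_v0 p q : d_v (0 : D A p q.+1) = 0.
Proof. exact: raddf0. Qed.
Lemma d_vv p q (x : D A p q.+2) : d_v (d_v x) = 0.
Proof. exact: bar_dd. Qed.
Lemma d_hv p q (x : D A p.+1 q.+1) : d_h (d_v x) = d_v (d_h x).
Proof. exact: bar_map_d. Qed.
Lemma d_h_out p q (x : D A p.+1 q) :
  bar_out (E A p.+1) q x = 0 -> bar_out (E A p) q (d_h x) = 0.
Proof. exact: bar_map_cycle. Qed.
Lemma out_d_v p q (x : D A p q.+1) : bar_out (E A p) q (d_v x) = 0.
Proof. exact: bar_out_d. Qed.

Lemma d_hh0 q (x : D A 2 q) : d_h (d_h x) = 0 :> D A 0 q.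
Proof. by apply: bar_map_comp0 => m; apply/eqP; have := valP m. Qed.

Lemma D3_0 q (x : D A 3 q) : x = 0.
Proof. by apply/malgP => t; apply/matrixP => i []. Qed.

Lemma d1_class p q (x : D A p.+1 q) (k : E1 A p.+1 q) :
  has_class x k -> has_class (d_h x : D A p q) (d1 A p q k).
Proof. exact: has_class_map. Qed.

Lemma E1_class0 p q (x : D A p q) :
  has_class x (0 : E1 A p q) <-> bar_out (E A p) q x = 0 /\ exists y, d_v y = x.
Proof. exact: has_class0P. Qed.

Lemma E2_class_out p q (x : D A p q) (h : E2 A p q) :
  E2_class x h -> bar_out (E A p) q x = 0.
Proof. by move=> [k /has_class_cycle]. Qed.

Lemma E2_class_dh p q (x : D A p.+1 q) (h : E2 A p.+1 q) :
  E2_class x h -> exists y, d_h x = d_v y.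
Proof.
move=> [k xk /has_class_cycle k0]; have := d1_class xk.
by rewrite (k0 : d1 A p q k = 0) => /E1_class0[_ [y <-]]; exists y.
Qed.

Lemma E2_class_ex0 q (x : D A 0 q) :
  bar_out (E A 0) q x = 0 -> exists h : E2 A 0 q, E2_class x h.
Proof.
move=> x0; have [k xk] := has_class_ex (@bar_d _ (E A 0) q) x0.
have [h kh] := has_class_ex (d1 A 0 q) (erefl : d1_out A 0 q k = 0).
by exists h, k.
Qed.

Lemma E2_class_exS p q (x : D A p.+1 q) (y : D A p q.+1) :
    bar_out (E A p.+1) q x = 0 -> d_h x = d_v y ->
  exists h : E2 A p.+1 q, E2_class x h.
Proof.
move=> x0 xy; have [k xk] := has_class_ex (@bar_d _ (E A p.+1) q) x0.
have k0 : d1_out A p.+1 q k = 0.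
  have dx := d1_class xk; apply: has_class_uniq dx _; apply/E1_class0.
  by split; [apply: d_h_out|exists y].
by have [h kh] := has_class_ex (d1 A p.+1 q) k0; exists h, k.
Qed.

Lemma E2_classB p q (x x' : D A p q) (h h' : E2 A p q) :
  E2_class x h -> E2_class x' h' -> E2_class (x - x') (h - h').
Proof.
move=> [k xk kh] [k' xk' kh']; exists (k - k'); last exact: has_classB.
exact: (has_classB xk xk').
Qed.

Lemma E2_class_surj p q (h : E2 A p q) : exists x : D A p q, E2_class x h.
Proof.
have [k kh] := has_class_surj h; have [x xk] := has_class_surj k.
by exists x; exists k.
Qed.

(** On the second page a class vanishes when it comes from [d^1]; at chain level
    this is the horizontal image of a vertical cycle, up to a vertical boundary. *)
Lemma E2_class0 p q (x : D A p q) : E2_class x (0 : E2 A p q) ->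
  exists (y : D A p q.+1) (y' : D A p.+1 q),
    bar_out (E A p.+1) q y' = 0 /\ x = d_v y + d_h y'.
Proof.
move=> [k xk /has_class0P[_ [k' kk']]]; have [y' yk'] := has_class_surj k'.
have := has_classB xk (d1_class yk'); rewrite kk' subrr => /E1_class0[_ [y e]].
by exists y, y'; split; [apply: has_class_cycle yk'|rewrite e subrK].
Qed.

Lemma E2_class_bound p q (x : D A p q) (h : E2 A p q)
    (y : D A p q.+1) (y' : D A p.+1 q) :
  E2_class x h -> bar_out (E A p.+1) q y' = 0 -> x = d_v y + d_h y' -> h = 0.
Proof.
move=> [k xk kh] y'0 xE; have [k' yk'] := has_class_ex (@bar_d _ (E A p.+1) q) y'0.
have ek : k - d1 A p q k' = 0.
  apply: has_class_uniq (has_classB xk (d1_class yk')) _; apply/E1_class0.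
  have -> : x - d_h y' = d_v y by rewrite xE addrK.
  by split; [apply: out_d_v|exists y].
have k_cycle := has_class_cycle kh.
apply: has_class_uniq kh _; apply/has_class0P; split; first exact: k_cycle.
by exists k'; apply/esym/eqP; rewrite -subr_eq0 ek.
Qed.

Lemma E2_class_d_v p q (x : D A p q) (h : E2 A p q) (y : D A p q.+1) :
  E2_class x h -> x = d_v y -> h = 0.
Proof.
move=> xh xE; apply: (E2_class_bound (y := y) (y' := 0) xh).
  by case: q x h y xh xE => [|q] *; apply: raddf0.
by rewrite d_h0 addr0.
Qed.
End SecondPage.

(** * Points of the projective line and the action of PGE2 *)

Section Points2.
Variable A : comPzRingType.
Implicit Types (a b c d : A) (g h : GL2 A) (v w : 'cV[A]_2).

Lemma is_unitMl a b : is_unit (a * b) -> is_unit a.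
Proof. by move=> [c e]; exists (b * c); rewrite mulrA. Qed.
Lemma is_unitMr a b : is_unit (a * b) -> is_unit b.
Proof. by rewrite mulrC; apply: is_unitMl. Qed.

Definition col2 a b : 'cV[A]_2 := \col_i if i == 0 then a else b.

Lemma col2_eta v : v = col2 (v 0 0) (v 1 0).
Proof.
apply/matrixP => i j; rewrite mxE (ord1 j).
by case: i => -[|[]] // Hi; congr (v _ _); apply: val_inj.
Qed.

Lemma col2_inj a b a' b' : col2 a b = col2 a' b' -> a = a' /\ b = b'.
Proof. by move=> e; split; [move/matrixP/(_ 0 0): e|move/matrixP/(_ 1 0): e]; rewrite !mxE. Qed.

Lemma col2Z k a b : k *: col2 a b = col2 (k * a) (k * b).
Proof. by apply/matrixP => i j; rewrite !mxE; case: ifP. Qed.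

Lemma mat2_col2 a b c d x y : mat2 a b c d *m col2 x y = col2 (a * x + b * y) (c * x + d * y).
Proof.
apply/matrixP => i j; rewrite !mxE !big_ord_recl big_ord0 !mxE /= addr0.
by case: i => -[|[]] // Hi.
Qed.

Lemma mat2_inj a b c d a' b' c' d' : mat2 a b c d = mat2 a' b' c' d' ->
  [/\ a = a', b = b', c = c' & d = d'].
Proof.
move=> /matrixP e; have := e 0 0; have := e 0 1; have := e 1 0; have := e 1 1.
by rewrite !mxE.
Qed.

Lemma col_mat2 a b c d : col 0 (mat2 a b c d) = col2 a c.
Proof. by apply/matrixP => i j; rewrite !mxE. Qed.

Lemma row_mx_col2 v w : row_mx v w = mat2 (v 0 0) (w 0 0) (v 1 0) (w 1 0).
Proof.
apply/matrixP => i j; rewrite !mxE; case: splitP => k e; rewrite (ord1 k) in e *;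
  case: i => -[|[]] // Hi; case: j e => -[|[]] // Hj e; by congr (_ _ _); apply: val_inj.
Qed.

Lemma delta0_col2 : delta_mx 0 0 = col2 1 0.
Proof. by apply/matrixP => i j; rewrite !mxE (ord1 j) eqxx andbT; case: ifP. Qed.
Lemma delta1_col2 : delta_mx 1 0 = col2 0 1.
Proof.
apply/matrixP => i j; rewrite !mxE (ord1 j) eqxx andbT.
by case: i => -[|[]] // Hi.
Qed.

Definition det2 (M : 'M[A]_2) := M 0 0 * M 1 1 - M 0 1 * M 1 0.

Lemma det2E a b c d : det2 (mat2 a b c d) = a * d - b * c.
Proof. by rewrite /det2 !mxE. Qed.

Lemma det2M (M N : 'M[A]_2) : det2 (M *m N) = det2 M * det2 N.
Proof. by rewrite [M]mat2_eta [N]mat2_eta mat2M !det2E; ring. Qed.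

Lemma det2Z k (M : 'M[A]_2) : det2 (k *: M) = k ^+ 2 * det2 M.
Proof. by rewrite [M]mat2_eta mat2Z !det2E; ring. Qed.

Lemma det2_1 : det2 (1%:M : 'M[A]_2) = 1.
Proof. by rewrite mat2_1 det2E mulr1 mulr0 subr0. Qed.

Lemma det2_unit g : is_unit (det2 (mx g)).
Proof. by exists (det2 (mxV g)); rewrite -det2M mxrV det2_1. Qed.

Lemma GL2_of_det a b c d : is_unit (a * d - b * c) ->
  exists g : GL2 A, mx g = mat2 a b c d.
Proof.
move=> [k e].
have h1 : mat2 a b c d *m mat2 (k * d) (- (k * b)) (- (k * c)) (k * a) = 1%:M.
  by rewrite mat2M mat2_1; congr mat2; [rewrite -e|..|rewrite -e]; ring.
have h2 : mat2 (k * d) (- (k * b)) (- (k * c)) (k * a) *m mat2 a b c d = 1%:M.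
  by rewrite mat2M mat2_1; congr mat2; [rewrite -e|..|rewrite -e]; ring.
by exists (mkGL2 h1 h2).
Qed.

Lemma GL2_eta g : exists a b c d, [/\ mx g = mat2 a b c d & is_unit (a * d - b * c)].
Proof.
exists (mx g 0 0), (mx g 0 1), (mx g 1 0), (mx g 1 1); split; first exact: mat2_eta.
exact: det2_unit.
Qed.

Lemma is_diag_mat2 a d : is_diag_mx (mat2 a 0 0 d).
Proof.
apply/is_diag_mxP => i j; rewrite !mxE.
by case: i => -[|[]] // Hi; case: j => -[|[]] // Hj.
Qed.

Lemma GE2_elem ij r : GE2 (@elem A ij r).
Proof. by apply: gen_in; left; exists ij, r. Qed.

Lemma GE2_diag g a d : mx g = mat2 a 0 0 d -> GE2 g.
Proof. by move=> e; apply: gen_in; right; rewrite e is_diag_mat2. Qed.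

Lemma GE2_upper g : mx g 1 0 = 0 -> GE2 g.
Proof.
have [a [b [c [d [gE [k e]]]]]] := GL2_eta g; rewrite gE mxE /= => c0.
move: gE e; rewrite c0 mulr0 subr0 => gE e.
have [h hE] : exists h : GL2 A, mx h = mat2 a 0 0 d.
  by apply: GL2_of_det; exists k; rewrite mulr0 subr0.
have -> : g = (h * elem true (d * k * b))%g.
  apply: mx_inj; rewrite mxM hE gE /mx /= mat2M; congr mat2; ring: e.
by apply: gen_mul; [apply: GE2_diag hE|apply: GE2_elem].
Qed.

Definition vec (x : point A) : 'cV[A]_2 := val (repr x).

Lemma vec_umod (u : umod A) : exists2 a, is_unit a & val u = a *: vec (\pi_(point A) u).
Proof. by apply/pointP; rewrite reprK. Qed.

Lemma vec_inj x y a : is_unit a -> vec y = a *: vec x -> x = y.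
Proof. by move=> ua e; rewrite -[x]reprK -[y]reprK; apply/eqP/pointP; exists a. Qed.

Lemma vec_class x v : in_class x v -> exists2 a, is_unit a & v = a *: vec x.
Proof. by move=> [u <- <-]; apply: vec_umod. Qed.

Lemma in_class_vec x : in_class x (vec x).
Proof. by exists (repr x); rewrite ?reprK. Qed.

Lemma vec_GL2 x : exists g, vec x = col 0 (mx g).
Proof. exact/asboolP/(valP (repr x)). Qed.

Lemma vec_free x a b : a *: vec x = b *: vec x -> a = b.
Proof.
have [g ->] := vec_GL2 x => /(congr1 (fun v => mxV g *m v)).
rewrite -!scalemxAr colE mulmxA mxVr mul1mx delta0_col2 !col2Z !mulr1 => /col2_inj[].
by [].
Qed.

Lemma act_vec g x : exists2 a, is_unit a & mx g *m vec x = a *: vec (point_act (\pi_(PGL2 A) g) x).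
Proof. by rewrite -{2}[x]reprK point_actE; apply: (vec_umod (umod_act g (repr x))). Qed.

Lemma act_vecP g x y a : is_unit a -> mx g *m vec x = a *: vec y ->
  point_act (\pi_(PGL2 A) g) x = y.
Proof.
move=> [a' aa'] e; have [b ub e'] := act_vec g x.
apply: (@vec_inj _ _ (a' * b)); first by apply: is_unitM => //; exists a; rewrite mulrC.
by rewrite -scalerA -e' e scalerA mulrC aa' scale1r.
Qed.

Lemma pair_invP x y :
  pair_invertible x y <-> is_unit (vec x 0 0 * vec y 1 0 - vec y 0 0 * vec x 1 0).
Proof.
split=> [/asboolP[v [w [/vec_class[a ua ->] /vec_class[b ub ->] [g gE]]]]|u].
  have := det2_unit g; rewrite gE row_mx_col2 det2E !mxE => ug.
  apply: (@is_unitMr (a * b)); move: ug; congr is_unit; ring.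
have [g gE] := GL2_of_det u.
apply/asboolP; exists (vec x), (vec y); split; try exact: in_class_vec.
by exists g; rewrite gE row_mx_col2.
Qed.

Lemma pair_invI x y v w : in_class x v -> in_class y w ->
  is_unit (v 0 0 * w 1 0 - w 0 0 * v 1 0) -> pair_invertible x y.
Proof.
move=> xv yw u; apply/asboolP; exists v, w; split=> //.
have [g gE] := GL2_of_det u; by exists g; rewrite gE row_mx_col2.
Qed.

End Points2.

(** * Transitivity and stabilisers of the action on small configurations *)

Section Configs.
Variable A : comPzRingType.
Implicit Types (x y z : point A) (g : PGE2 A) (h k : GL2 A).
Local Notation Y := (Yconf A).

Fact pge_subproof h (hE : GE2 h) : \pi_(PGL2 A) h \in @in_PGE2 A.
Proof. by rewrite unfold_in; apply/asboolP; exists h. Qed.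
Definition pge h (hE : GE2 h) : PGE2 A := exist _ (\pi_(PGL2 A) h) (pge_subproof hE).

Lemma pgeP g : exists h (hE : GE2 h), g = pge hE.
Proof.
have := valP g; rewrite unfold_in => /asboolP[h hE e].
by exists h, hE; apply: val_inj.
Qed.

Definition cpt n (c : config Y n) (i : 'I_n.+1) : point A := val (tnth (val c) i).

Lemma cpt_inj n (c c' : config Y n) : (forall i, cpt c i = cpt c' i) -> c = c'.
Proof.
by move=> e; apply: val_inj; apply: eq_from_tnth => i; apply: val_inj; apply: e.
Qed.

Lemma cpt_act n (c : config Y n) g i : cpt (config_act g c) i = point_act (val g) (cpt c i).
Proof. by rewrite /cpt tnth_map. Qed.

Lemma cpt_rel n (c : config Y n) i j : i != j -> pair_invertible (cpt c i) (cpt c j).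
Proof. by move=> ij; have /'forall_forallP/(_ i j)/implyP/(_ ij) := valP c. Qed.

Definition pinf : point A := \pi_(point A) (std_umod A 0).
Definition pzero : point A := \pi_(point A) (std_umod A 1).

Lemma cpt_base0 i : cpt (base0 A) i = pinf.
Proof. by rewrite (ord1 i). Qed.
Lemma cpt_base1_0 : cpt (base1 A) 0 = pinf.
Proof. by rewrite /cpt tnth_mktuple. Qed.
Lemma cpt_base1_1 : cpt (base1 A) 1 = pzero.
Proof. by rewrite /cpt tnth_mktuple. Qed.

Lemma class_pinf : in_class pinf (col2 1 0).
Proof. by exists (std_umod A 0) => //=; rewrite delta0_col2. Qed.
Lemma class_pzero : in_class pzero (col2 0 1).
Proof. by exists (std_umod A 1) => //=; rewrite delta1_col2. Qed.

(** Points are compared through arbitrary representatives, so that the coordinate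
    points can be given by their standard columns. *)
Lemma act_class h x y v w : in_class x v -> in_class y w ->
  (exists2 a, is_unit a & mx h *m v = a *: w) <-> point_act (\pi_(PGL2 A) h) x = y.
Proof.
move=> xv yw; have [b ub vE] := vec_class xv; have [d [d' dd'] wE] := vec_class yw.
split=> [[a ua e]|e].
  have [b' bb'] := ub; apply: (@act_vecP A h x y (b' * (a * d))).
    apply: is_unitM; first by exists b; rewrite mulrC.
    by apply: is_unitM => //; exists d'.
  have -> : vec x = b' *: v by rewrite vE scalerA mulrC bb' scale1r.
  by rewrite -scalemxAr e wE !scalerA mulrA.
have [a ua aE] := act_vec h x; rewrite e in aE.
exists (b * a * d'); first by apply: is_unitM; [apply: is_unitM|exists d; rewrite mulrC].
rewrite vE -scalemxAr aE wE !scalerA; congr (_ *: _).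
by rewrite -!mulrA (mulrC d') dd' mulr1.
Qed.

Lemma GE2point_pinf (x : GE2point A) : exists h (hE : GE2 h),
  val x = point_act (\pi_(PGL2 A) h) pinf.
Proof.
have := valP x; rewrite unfold_in => /asboolP[v [h hE ->] xv].
exists h, hE; apply/esym/(act_class h class_pinf xv).
by exists 1; [apply: is_unit1|rewrite scale1r colE delta0_col2].
Qed.

(** If [k] in [GE2] has first column [x], the matrix with columns [x] and [y] is [k]
    times an upper triangular matrix, hence lies in [GE2] as well. So a point
    that is joined to a [GE2]-point is one, and all edges are equivalent. *)
Lemma edge_GE2 (x : GE2point A) y : pair_invertible (val x) y ->
  exists h (hE : GE2 h), [/\ mx h = row_mx (vec (val x)) (vec y),
    val x = point_act (\pi_(PGL2 A) h) pinf & y = point_act (\pi_(PGL2 A) h) pzero].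
Proof.
move=> /pair_invP/GL2_of_det[m mE].
have [k [kE xk]] := GE2point_pinf x.
have m0 : mx m *m col2 1 0 = vec (val x).
  by rewrite mE mat2_col2 !mulr1 !mulr0 !addr0 -col2_eta.
have m1 : mx m *m col2 0 1 = vec y.
  by rewrite mE mat2_col2 !mulr1 !mulr0 !add0r -col2_eta.
have mG : GE2 m.
  have -> : m = (k * (k^-1 * m))%g by rewrite mulgA mulgV mul1g.
  apply: gen_mul => //; apply: GE2_upper.
  have [a [a' aa'] e] := (act_class k class_pinf (in_class_vec _)).2 (esym xk).
  have : mxV k *m (mx m *m col2 1 0) = a' *: col2 1 0.
    have -> : mx m *m col2 1 0 = a' *: (mx k *m col2 1 0).
      by rewrite m0 e scalerA mulrC aa' scale1r.
    by rewrite -scalemxAr mulmxA mxVr mul1mx.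
  rewrite mulmxA -[mxV k *m mx m]/(mx (k^-1 * m)%g).
  move: (mx _) => N; rewrite {1}[N]mat2_eta mat2_col2 !mulr1 !mulr0 !addr0 col2Z mulr0.
  by move=> /col2_inj[_ ->].
exists m, mG; split; first by rewrite row_mx_col2.
  apply/esym/(act_class m class_pinf (in_class_vec _)).
  by exists 1; [apply: is_unit1|rewrite scale1r].
apply/esym/(act_class m class_pzero (in_class_vec _)).
by exists 1; [apply: is_unit1|rewrite scale1r].
Qed.

Lemma trans0 (c : config Y 0) : exists g, config_act g (base0 A) = c.
Proof.
have [h [hE e]] := GE2point_pinf (tnth (val c) 0); exists (pge hE).
by apply: cpt_inj => i; rewrite cpt_act cpt_base0 (ord1 i) -e.
Qed.

Lemma trans1 (c : config Y 1) : exists g, config_act g (base1 A) = c.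
Proof.
have [h [hE [_ e0 e1]]] := edge_GE2 (cpt_rel c (isT : (0 : 'I_2) != 1)).
exists (pge hE); apply: cpt_inj => i; rewrite cpt_act.
have [->|->] : i = 0 \/ i = 1.
  by case: i => -[|[]] // Hi; [left|right]; apply: val_inj.
- by rewrite cpt_base1_0 -e0.
- by rewrite cpt_base1_1 -e1.
Qed.

Lemma stab_pinf h : point_act (\pi_(PGL2 A) h) pinf = pinf <-> mx h 1 0 = 0.
Proof.
split=> [/(act_class h class_pinf class_pinf)[a _]|h0].
  rewrite [mx h]mat2_eta mat2_col2 !mulr1 !mulr0 !addr0 col2Z mulr0 => /col2_inj[_].
  by rewrite mxE /= => ->.
have [a [b [c [d [hE u]]]]] := GL2_eta h; move: h0; rewrite hE mxE /= => c0.
apply/(act_class h class_pinf class_pinf); exists a.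
  by move: u; rewrite c0 mulr0 subr0; apply: is_unitMl.
by rewrite hE c0 mat2_col2 !mulr1 !mulr0 !addr0 col2Z mulr0 mulr1.
Qed.

Lemma stab_pzero h : point_act (\pi_(PGL2 A) h) pzero = pzero -> mx h 0 1 = 0.
Proof.
move=> /(act_class h class_pzero class_pzero)[a _].
rewrite [mx h]mat2_eta mat2_col2 !mulr1 !mulr0 !add0r col2Z mulr0 => /col2_inj[+ _].
by rewrite mxE /= => ->.
Qed.

Lemma pone_GE2_unimodular : GE2_unimodular (col2 1 1 : 'cV[A]_2).
Proof. by exists (elem false 1); [apply: GE2_elem|rewrite /mx /= col_mat2]. Qed.
Fact pone_umod_subproof : `[< unimodular (col2 1 1 : 'cV[A]_2) >].
Proof. by apply/asboolP; have [h _ e] := pone_GE2_unimodular; exists h. Qed.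
Definition pone_umod : umod A := exist _ (col2 1 1) pone_umod_subproof.
Definition pone : point A := \pi_(point A) pone_umod.
Lemma class_pone : in_class pone (col2 1 1).
Proof. by exists pone_umod. Qed.
Fact pone_GE2_subproof : pone \in @in_GE2point A.
Proof.
rewrite unfold_in; apply/asboolP; exists (col2 1 1); first exact: pone_GE2_unimodular.
exact: class_pone.
Qed.
Definition pone_GE2 : GE2point A := exist _ pone pone_GE2_subproof.

Lemma pair_inv_sym x y : pair_invertible x y -> pair_invertible y x.
Proof.
move=> /pair_invP[a e]; apply/pair_invP; exists (- a); rewrite -e; ring.
Qed.

Definition base2_tuple : 3.-tuple Y :=
  [tuple of [:: std_point A 0; std_point A 1; pone_GE2]].
Fact base2_subproof : in_config base2_tuple.
Proof.
have u1 : is_unit (1 : A) by apply: is_unit1.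
have r01 : pair_invertible pinf pzero.
  by apply: pair_invI class_pinf class_pzero _; rewrite !mxE /= mulr1 mulr0 subr0.
have r02 : pair_invertible pinf pone.
  by apply: pair_invI class_pinf class_pone _; rewrite !mxE /= mulr1 mulr0 subr0.
have r21 : pair_invertible pone pzero.
  by apply: pair_invI class_pone class_pzero _; rewrite !mxE /= mulr1 mul0r subr0.
apply/'forall_forallP => i j; apply/implyP.
case: i => -[|[|[|//]]] Hi; case: j => -[|[|[|//]]] Hj; rewrite //= => _;
  by [|apply: pair_inv_sym].
Qed.
Definition base2 : config Y 2 := exist _ base2_tuple base2_subproof.

Lemma cpt_base2_0 : cpt base2 0 = pinf. Proof. by []. Qed.
Lemma cpt_base2_1 : cpt base2 1 = pzero. Proof. by []. Qed.
Lemma cpt_base2_2 : cpt base2 2%:R = pone. Proof. by []. Qed.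

Lemma ord3P (P : 'I_3 -> Prop) : P 0 -> P 1 -> P 2%:R -> forall i, P i.
Proof.
move=> P0 P1 P2 i.
have [->|[->|->]] : i = 0 \/ i = 1 \/ i = 2%:R; rewrite //.
by case: i => -[|[|[]]] // Hi; [left|right; left|right; right]; apply: val_inj.
Qed.

(** Move the first two points to the coordinate points; the third one then has
    two unit coordinates, which a diagonal matrix turns into 1. *)
Lemma trans2 (c : config Y 2) : exists g, config_act g base2 = c.
Proof.
have [h [hE [hm e0 e1]]] := edge_GE2 (cpt_rel c (isT : (0 : 'I_3) != 1)).
have r02 := cpt_rel c (isT : (0 : 'I_3) != 2%:R).
have r12 := cpt_rel c (isT : (1 : 'I_3) != 2%:R).
set x := cpt c 0 in r02; set y := cpt c 1 in r12; set z := cpt c 2%:R in r02 r12.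
pose v := mxV h *m vec z; pose a := v 0 0; pose b := v 1 0.
have zE : vec z = mx h *m col2 a b by rewrite -col2_eta mulmxA mxrV mul1mx.
have hE2 : mx h = mat2 (vec x 0 0) (vec y 0 0) (vec x 1 0) (vec y 1 0).
  by rewrite hm row_mx_col2.
have zE0 : vec z 0 0 = vec x 0 0 * a + vec y 0 0 * b.
  by rewrite zE hE2 mat2_col2 mxE.
have zE1 : vec z 1 0 = vec x 1 0 * a + vec y 1 0 * b.
  by rewrite zE hE2 mat2_col2 mxE.
have ub : is_unit b.
  move/pair_invP: r02; rewrite zE0 zE1 => u.
  apply: (@is_unitMl A b (det2 (mx h))); move: u; rewrite hE2 det2E; congr is_unit; ring.
have ua : is_unit a.
  move/pair_invP: r12; rewrite zE0 zE1 => u.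
  apply: (@is_unitMl A a (- det2 (mx h))); move: u; rewrite hE2 det2E; congr is_unit; ring.
have [d dE] : exists d : GL2 A, mx d = mat2 a 0 0 b.
  by apply: GL2_of_det; rewrite mulr0 subr0; apply: is_unitM.
have hdE : GE2 (h * d)%g by apply: gen_mul => //; apply: GE2_diag dE.
exists (pge hdE); apply: cpt_inj; apply: ord3P; rewrite cpt_act.
- rewrite cpt_base2_0 /= pi_PGL2M point_actM [RHS]e0; congr point_act.
  by apply/stab_pinf; rewrite dE mxE.
- rewrite cpt_base2_1 /= pi_PGL2M point_actM [RHS]e1; congr point_act.
  apply/(act_class d class_pzero class_pzero); exists b => //.
  by rewrite dE mat2_col2 col2Z !(mulr0, mulr1, add0r).
- rewrite cpt_base2_2 /=; apply/(act_class _ class_pone (in_class_vec _)).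
  exists 1; first exact: is_unit1.
  rewrite mxM -mulmxA dE mat2_col2 !(mulr1, mul0r, addr0, add0r) scale1r.
  by rewrite -[cpt c _]/z zE.
Qed.

Lemma stab2_trivial g : config_act g base2 = base2 -> g = 1%g.
Proof.
have [h [hE ->]] := pgeP g => e.
have e_i i : point_act (\pi_(PGL2 A) h) (cpt base2 i) = cpt base2 i.
  by have := cpt_act base2 (pge hE) i; rewrite e => /esym.
have := e_i 0; rewrite cpt_base2_0 => /stab_pinf h10.
have := e_i 1; rewrite cpt_base2_1 => /stab_pzero h01.
have := e_i 2%:R; rewrite cpt_base2_2 => /(act_class h class_pone class_pone)[a ua].
rewrite [mx h]mat2_eta h10 h01 mat2_col2 !(mulr1, mul0r, addr0, add0r) col2Z !mulr1.
move=> /col2_inj[ha hd]; apply: val_inj; apply/esym/eqP/PGL2P; exists a => //.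
by rewrite [LHS]mat2_eta h10 h01 ha hd mx1 mat2_1 mat2Z !(mulr1, mulr0).
Qed.

End Configs.

(** * Exactness of the complex Y in degree zero *)

HB.lock Definition ccell (G : groupType) (X : gconf G) n (c : config X n) :
  conf_chain X n := << c >>.

Section ChainLin.
Variables (G : groupType) (X : gconf G).

Lemma ccellE n (c : config X n) : ccell c = << c >>.
Proof. by rewrite [ccell]unlock. Qed.

Lemma conf_chain_ind n (P : conf_chain X n -> Prop) : P 0 ->
    (forall x y, P x -> P y -> P (x - y)) -> (forall c, P (ccell c)) ->
  forall x, P x.
Proof. by move=> P0 PB PU; apply: free_ind => // c; move: (PU c); rewrite ccellE. Qed.

Lemma ccell_act g n (c : config X n) : chain_act g (ccell c) = ccell (config_act g c).
Proof. by rewrite !ccellE chain_actU. Qed.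

Lemma chain_diffB n (x y : conf_chain X n.+1) :
  chain_diff (x - y) = chain_diff x - chain_diff y.
Proof. exact: raddfB. Qed.
Lemma chain_diffD n (x y : conf_chain X n.+1) :
  chain_diff (x + y) = chain_diff x + chain_diff y.
Proof. exact: raddfD. Qed.
Lemma chain_diffN n (x : conf_chain X n.+1) : chain_diff (- x) = - chain_diff x.
Proof. exact: raddfN. Qed.
Lemma chain_diff0 n : chain_diff (0 : conf_chain X n.+1) = 0.
Proof. exact: raddf0. Qed.
Lemma chain_actB n g (x y : conf_chain X n) :
  chain_act g (x - y) = chain_act g x - chain_act g y.
Proof. exact: raddfB. Qed.
Lemma augmentationB (x y : conf_chain X 0) :
  augmentation (x - y) = augmentation x - augmentation y.
Proof. exact: raddfB. Qed.
Lemma augmentationU (c : config X 0) : augmentation (ccell c) = 1.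
Proof. by rewrite ccellE; exact: etrans (free_liftU _ _ _) (mulr1z _). Qed.

Lemma chain_diff1 (c : config X 1) :
  chain_diff (ccell c) = ccell (face 0 c) - ccell (face 1 c).
Proof. by rewrite !ccellE chain_diffU mulr1z; apply: alt_sum2. Qed.

Lemma chain_diff2 (c : config X 2) :
  chain_diff (ccell c) = ccell (face 0 c) - ccell (face 1 c) + ccell (face 2%:R c).
Proof. by rewrite !ccellE chain_diffU mulr1z; apply: alt_sum3. Qed.

End ChainLin.

Section AugExact.
Variable A : comPzRingType.
Local Notation Y := (Yconf A).

Definition zero0 : config Y 0 := face 0 (base1 A).

Lemma face1_base1 : face 1 (base1 A) = base0 A.
Proof.
apply: cpt_inj => i; rewrite cpt_base0 (ord1 i).
by rewrite /cpt tnth_mktuple /= tnth_mktuple; congr (\pi_(point A) (std_umod A _)); apply: val_inj.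
Qed.

Lemma cpt_zero0 i : cpt zero0 i = pzero A.
Proof.
rewrite (ord1 i) /cpt tnth_mktuple /= tnth_mktuple.
by congr (\pi_(point A) (std_umod A _)); apply: val_inj.
Qed.

Lemma chain_diff_base1 : chain_diff (ccell (base1 A)) = ccell zero0 - ccell (base0 A).
Proof. by rewrite chain_diff1 face1_base1. Qed.

Lemma act_base0_upper (g : PGE2 A) h : val g = \pi_(PGL2 A) h -> mx h 1 0 = 0 ->
  config_act g (base0 A) = base0 A.
Proof.
move=> gE h10; apply: cpt_inj => i; rewrite cpt_act cpt_base0 gE.
exact/stab_pinf.
Qed.

Lemma act_zero0_lower (g : PGE2 A) h : val g = \pi_(PGL2 A) h -> mx h 0 1 = 0 ->
  config_act g zero0 = zero0.
Proof.
move=> gE h01; apply: cpt_inj => i; rewrite cpt_act cpt_zero0 gE.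
have [a [b [c [d [hE u]]]]] := GL2_eta h; move: h01; rewrite hE mxE /= => b0.
apply/(act_class h (class_pzero A) (class_pzero A)); exists d.
  by move: u; rewrite b0 mul0r subr0; apply: is_unitMr.
by rewrite hE b0 mat2_col2 !mulr1 !mulr0 !add0r col2Z mulr0 mulr1.
Qed.

Definition connected (g : PGE2 A) := exists m : conf_chain Y 1,
  chain_diff m = ccell (config_act g (base0 A)) - ccell (base0 A).

Lemma connectedM g g' : connected g -> connected g' -> connected (g * g')%g.
Proof.
move=> [m mE] [m' m'E]; exists (chain_act g m' + m).
rewrite chain_diffD chain_diffJ m'E mE chain_actB !ccell_act config_actM.
by rewrite addrA subrK.
Qed.

Lemma connectedV g : connected g -> connected g^-1%g.
Proof.
move=> [m mE]; exists (- chain_act g^-1%g m).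
rewrite chain_diffN chain_diffJ mE chain_actB !ccell_act -config_actM mulVg config_act1.
by rewrite opprB.
Qed.

Lemma connected_stab g : config_act g (base0 A) = base0 A -> connected g.
Proof. by move=> e; exists 0; rewrite e subrr chain_diff0. Qed.

(** Elementary and diagonal matrices move the first coordinate point along at most
    two edges, because each of them fixes one of the coordinate points; paths
    can be translated and concatenated. *)
Lemma connected_GE2 h : GE2 h -> forall g : PGE2 A, val g = \pi_(PGL2 A) h -> connected g.
Proof.
elim=> {h} [h [[[] [r ->]]|/is_diag_mxP hD]|||] => [g gE|g gE|g gE|g gE|h k hE IHh kE IHk g gE|h hE IH g gE].
- by apply: connected_stab; apply: act_base0_upper gE _; rewrite /mx /= mxE.
- exists (ccell (base1 A) - chain_act g (ccell (base1 A))).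
  rewrite chain_diffB chain_diffJ chain_diff_base1 chain_actB !ccell_act.
  rewrite (act_zero0_lower gE) ?/mx /= ?mxE //.
  by rewrite opprB addrC addrA subrK.
- by apply: connected_stab; apply: act_base0_upper gE _; apply: hD.
- by apply: connected_stab; rewrite (_ : g = 1%g) ?config_act1 //; apply: val_inj.
- have -> : g = (pge hE * pge kE)%g by apply: val_inj; rewrite gE pi_PGL2M.
  by apply: connectedM; [apply: IHh|apply: IHk].
- have -> : g = (pge hE)^-1%g by apply: val_inj; rewrite gE pi_PGL2V.
  by apply/connectedV/IH.
Qed.

(** Since all points are connected to the base point, a chain of points is, up to
    boundaries, its augmentation times the base point. *)
Lemma aug_exact (m : conf_chain Y 0) : augmentation m = 0 ->
  exists m' : conf_chain Y 1, chain_diff m' = m.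
Proof.
have [m' m'E] : exists m', chain_diff m' = m - ccell (base0 A) *~ augmentation m.
  move: m; apply: conf_chain_ind => [|x y [x' xE] [y' yE]|c].
  - by exists 0; rewrite chain_diff0 (raddf0 (@augmentation _ Y)) mulr0z subrr.
  - exists (x' - y'); rewrite chain_diffB xE yE augmentationB mulrzBr.
    by rewrite !opprB addrACA [RHS]addrACA; congr (_ + _); rewrite addrC.
  rewrite augmentationU mulr1z; have [g <-] := trans0 c; have [h [hE gE]] := pgeP g.
  by rewrite gE; apply: (connected_GE2 hE).
by move=> m0; exists m'; rewrite m'E m0 mulr0z subr0.
Qed.

End AugExact.

(** * The three-column spectral sequence *)

Section Rows.
Variable A : comPzRingType.

Lemma augmentation_act (X : gconf (PGE2 A)) g (m : chain_gmod X 0) :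
  augmentation (gact g m) = augmentation m.
Proof.
have augU (c : config X 0) : augmentation << c >> = 1.
  exact: etrans (free_liftU _ _ _) (mulr1z _).
apply: (@free_additive_ext _ _ (@augmentation _ X \o @chain_act _ X g 0)
          (@augmentation _ X)) => c.
have e := congr1 (@augmentation _ X) (chain_actU g c 1).
exact: etrans e (etrans (augU _) (esym (augU c))).
Qed.

Lemma augmentation_diff (X : gconf (PGE2 A)) (m : conf_chain X 1) :
  augmentation (chain_diff m) = 0.
Proof.
have augU (c : config X 0) : augmentation << c >> = 1.
  exact: etrans (free_liftU _ _ _) (mulr1z _).
apply: (@free_additive_ext _ _ (@augmentation _ X \o @chain_diff _ X 0) \0) => c.
rewrite /= chain_diffU mulr1z alt_sum2; apply: etrans (raddfB _ _ _) _.
apply/eqP; rewrite subr_eq0; apply/eqP; exact: etrans (augU _) (esym (augU _)).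
Qed.

Lemma D_augB q (x y : D A 0 q) : D_aug (x - y) = D_aug x - D_aug y.
Proof. exact: raddfB. Qed.
Lemma D_augD q (x y : D A 0 q) : D_aug (x + y) = D_aug x + D_aug y.
Proof. exact: raddfD. Qed.
Lemma D_augN q (x : D A 0 q) : D_aug (- x) = - D_aug x.
Proof. exact: raddfN. Qed.
Lemma D_aug0 q : D_aug (0 : D A 0 q) = 0.
Proof. exact: raddf0. Qed.
Lemma D_aug_d_v q (x : D A 0 q.+1) : D_aug (d_v x) = bar_d (D_aug x).
Proof. by apply: bar_map_dG => // g m; apply: augmentation_act. Qed.
Lemma D_aug_d_h q (x : D A 1 q) : D_aug (d_h x) = 0.
Proof. by apply: bar_map_comp0 => m; apply: augmentation_diff. Qed.

Lemma D_aug_surj q (x : bar (triv_int (PGE2 A)) q) : exists y : D A 0 q, D_aug y = x.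
Proof.
apply: bar_map_lift => t; exists << x@_t *g base0 A >>.
by apply: etrans (free_liftU _ _ _) _; rewrite intz.
Qed.

Lemma row2_inj q (x : D A 2 q) : d_h x = 0 -> x = 0.
Proof. by apply: bar_map_inj => m /= m0; apply: val_inj. Qed.

Lemma row1_exact q (x : D A 1 q) : d_h x = 0 -> exists y : D A 2 q, d_h y = x.
Proof.
apply: bar_map_exact => m m0.
have mP : m \in @ker_pred _ _ _ (chain_hom (Yconf A) 0) by rewrite unfold_in; apply/eqP.
by exists (exist _ m mP).
Qed.

Lemma row0_exact q (x : D A 0 q) : D_aug x = 0 -> exists y : D A 1 q, d_h y = x.
Proof. by apply: bar_map_exact => m; apply: aug_exact. Qed.

Definition total3 (t03 : D A 0 3) (t12 : D A 1 2) (t21 : D A 2 1) p q : D A p q :=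
  match p, q with
  | 0, 3 => t03 | 1, 2 => t12 | 2, 1 => t21 | _, _ => 0
  end.

Definition total2 (t02 : D A 0 2) (t11 : D A 1 1) p q : D A p q :=
  match p, q with
  | 0, 2 => t02 | 1, 1 => t11 | _, _ => 0
  end.

(** A total cycle of degree 3 whose filtration is at most 2 is a triple of chains;
    the conditions in total degree 2 carry the signs [(-1)^q] of the total
    differential. *)
Lemma edge_to21P (x : H_PGE2 A 3) (h : E2 A 2 1) :
  @edge_to A 2 1 x h <-> exists (t03 : D A 0 3) (t12 : D A 1 2) (t21 : D A 2 1),
    [/\ has_class (D_aug t03) x, d_v t03 + d_h t12 = 0, d_h t21 = d_v t12,
        d_v t21 = 0 & E2_class t21 h].
Proof.
split=> [[t [[tc tx] t0 th]]|[t03 [t12 [t21 [xc e02 e11 e20 hc]]]]].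
  exists (t 0%N 3), (t 1%N 2), (t 2 1%N).
  have := tc 0%N 2 erefl; have := tc 1%N 1%N erefl; have := tc 2 0%N erefl.
  rewrite (t0 3 0%N) // d_h0 mul0rz addr0 expr1 mulrN1z sqrrN expr1n mulr1z => -> e11 ->.
  by split=> //; apply/eqP; rewrite -subr_eq0 -oppr_eq0 opprB e11.
exists (total3 t03 t12 t21); split=> //.
- split=> // [[|[|[|p]]]] // [|[|[|q]]] //= _.
  + by rewrite expr1 mulrN1z e11 subrr.
  + by rewrite d_h0 mul0rz addr0.
- by move=> [|[|[|p]]] //; case=> [|[|[|[|q]]]].
Qed.

Lemma edge_to11P (x : H_PGE2 A 2) (h : E2 A 1 1) :
  @edge_to A 1 1 x h <-> exists (t02 : D A 0 2) (t11 : D A 1 1),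
    [/\ has_class (D_aug t02) x, d_v t02 = d_h t11, d_v t11 = 0 & E2_class t11 h].
Proof.
split=> [[t [[tc tx] t0 th]]|[t02 [t11 [xc e01 e10 hc]]]].
  exists (t 0%N 2), (t 1%N 1%N).
  have := tc 0%N 1%N erefl; have := tc 1%N 0%N erefl.
  rewrite (t0 2 0%N) // d_h0 mul0rz addr0 expr1 mulrN1z => -> e01.
  by split=> //; apply/eqP; rewrite -subr_eq0 e01.
exists (total2 t02 t11); split=> //.
- split=> // [[|[|p]]] // [|[|q]] //= _.
  + by rewrite expr1 mulrN1z e01 subrr.
  + by rewrite d_h0 mul0rz addr0.
- by move=> [|[|p]] //; case=> [|[|[|q]]].
Qed.
End Rows.

(** * Edge maps, the second differential and exactness *)

Section Chase.
Variable A : comPzRingType.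

Let row0 := @row0_exact A.

Lemma class_augP n (x : bar (triv_int (PGE2 A)) n) :
  has_class x (0 : H_PGE2 A n) <->
  bar_out (triv_int (PGE2 A)) n x = 0 /\ exists y, bar_d y = x.
Proof. exact: has_class0P. Qed.

(** Lift a bounding chain through the augmentation; what remains is killed by the
    augmentation, hence comes from the next column. *)
Lemma aug_boundary_split q (t : D A 0 q) (u : bar (triv_int (PGE2 A)) q.+1) :
  bar_d u = D_aug t -> exists (U : D A 0 q.+1) (V : D A 1 q), t = d_v U + d_h V.
Proof.
move=> ut; have [U Uu] := D_aug_surj u.
have [V VE] : exists V : D A 1 q, d_h V = t - d_v U.
  by apply: row0; rewrite D_augB D_aug_d_v Uu ut subrr.
by exists U, V; rewrite VE addrC subrK.
Qed.

(** Climb the staircase from a lift of a cycle of [PGE2]: exactness of the rows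
    provides the next step, and since the last row map is injective the final
    component is a vertical cycle. *)
Lemma edge_to21_ex (x : H_PGE2 A 3) : exists h, @edge_to A 2 1 x h.
Proof.
have [c cx] := has_class_surj x; have [t03 tE] := D_aug_surj c.
have dc : bar_d c = 0 by apply: has_class_cycle cx.
have [s sE] : exists s : D A 1 2, d_h s = d_v t03.
  by apply: row0; rewrite D_aug_d_v tE dc.
have [t21 t21E] : exists t21 : D A 2 1, d_h t21 = d_v (- s).
  by apply: row1_exact; rewrite d_hv d_hN sE d_vN d_vv oppr0.
have d21 : d_v t21 = 0 by apply: row2_inj; rewrite d_hv t21E d_vv.
have [h th] := @E2_class_exS A 1 1 t21 (- s) d21 t21E.
exists h; apply/edge_to21P; exists t03, (- s), t21.
by split=> //; rewrite ?tE // d_hN sE subrr.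
Qed.

Lemma edge_to21B (x x' : H_PGE2 A 3) h h' :
  @edge_to A 2 1 x h -> @edge_to A 2 1 x' h' -> @edge_to A 2 1 (x - x') (h - h').
Proof.
move=> /edge_to21P[t03 [t12 [t21 [xc e02 e11 e20 hc]]]].
move=> /edge_to21P[t03' [t12' [t21' [xc' e02' e11' e20' hc']]]].
apply/edge_to21P; exists (t03 - t03'), (t12 - t12'), (t21 - t21').
have cB := has_classB xc xc'; have hB := E2_classB hc hc'.
split=> //; first by rewrite D_augB.
- by rewrite d_vB d_hB addrACA -opprD e02 e02' subrr.
- by rewrite d_hB d_vB e11 e11'.
- by rewrite d_vB e20 e20' subrr.
Qed.

Lemma edge_to21_0 h : @edge_to A 2 1 (0 : H_PGE2 A 3) h -> h = 0.
Proof.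
move=> /edge_to21P[t03 [t12 [t21 [/class_augP[_ [u uE]] e02 e11 e20 hc]]]].
have [U [V t03E]] := aug_boundary_split uE.
have [W WE] : exists W : D A 2 2, d_h W = t12 + d_v V.
  apply: row1_exact; rewrite d_hD d_hv addrC.
  by rewrite -e02 t03E d_vD d_vv add0r.
apply: (E2_class_d_v (y := W) hc).
apply/eqP; rewrite -subr_eq0; apply/eqP/row2_inj.
by rewrite d_hB d_hv WE d_vD d_vv addr0 e11 subrr.
Qed.

Lemma d2_ex (h : E2 A 2 1) : exists h', @d2_graph A 0 1 h h'.
Proof.
have [x xh] := E2_class_surj h; have [y xy] := E2_class_dh xh.
have [h' yh'] : exists h' : E2 A 0 2, E2_class (d_h y) h'.
  apply: E2_class_ex0; change (d_v (d_h y) = 0).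
  by rewrite -d_hv -xy d_hh0.
by exists h', x, y.
Qed.

Lemma d2B h1 h2 h1' h2' : @d2_graph A 0 1 h1 h1' -> @d2_graph A 0 1 h2 h2' ->
  @d2_graph A 0 1 (h1 - h2) (h1' - h2').
Proof.
move=> [x [y [xh xy yh]]] [x' [y' [xh' xy' yh']]]; exists (x - x'), (y - y').
split; first exact: E2_classB; first by rewrite d_hB d_vB xy xy'.
by rewrite d_hB; apply: E2_classB.
Qed.

Lemma d2_0 h' : @d2_graph A 0 1 (0 : E2 A 2 1) h' -> h' = 0.
Proof.
move=> [x [y [/E2_class0[a [b [_ xE]] xy yh]]]].
have db : d_h b = 0 by rewrite (D3_0 b) d_h0.
apply: (E2_class_bound (y := 0) (y' := y - d_h a) yh).
  change (d_v (y - d_h a) = 0).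
  by rewrite d_vB -xy xE db addr0 d_hv subrr.
by rewrite d_v0 add0r d_hB d_hh0 subr0.
Qed.

Lemma edge_from_ex (h : E2 A 0 2) : exists x, @edge_from A 2 h x.
Proof.
have [c ch] := E2_class_surj h; have dc := E2_class_out ch.
have [x cx] : exists x : H_PGE2 A 2, has_class (D_aug c) x.
  by apply: has_class_ex; change (bar_d (D_aug c) = 0); rewrite -D_aug_d_v [d_v c]dc D_aug0.
by exists x, c.
Qed.

Lemma edge_fromB h h' x x' : @edge_from A 2 h x -> @edge_from A 2 h' x' ->
  @edge_from A 2 (h - h') (x - x').
Proof.
move=> [c ch cx] [c' ch' cx']; exists (c - c'); first exact: E2_classB.
by rewrite D_augB; apply: has_classB.
Qed.

Lemma edge_from_0 x : @edge_from A 2 (0 : E2 A 0 2) x -> x = 0.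
Proof.
move=> [c /E2_class0[y [y' [_ cE]]] cx]; apply: has_class_uniq (cx) _.
apply/class_augP; split; first exact: has_class_cycle cx.
by exists (D_aug y); rewrite cE D_augD D_aug_d_h addr0 D_aug_d_v.
Qed.

Section EdgeTo11.
Hypothesis col20 : forall (x : D A 2 0) (y : D A 1 1),
  d_h x = d_v y -> exists w : D A 2 1, d_v w = x.

(** The staircase may leave a component in bidegree [(2, 0)]; it is removed with
    [col20], which says that this entry of the second page vanishes. *)
Lemma edge_to11_ex (x : H_PGE2 A 2) : exists h, @edge_to A 1 1 x h.
Proof.
have [c cx] := has_class_surj x; have [t02 tE] := D_aug_surj c.
have dc : bar_d c = 0 by apply: has_class_cycle cx.
have [s sE] : exists s : D A 1 1, d_h s = d_v t02.
  by apply: row0; rewrite D_aug_d_v tE dc.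
have [t20 t20E] : exists t20 : D A 2 0, d_h t20 = d_v s.
  by apply: row1_exact; rewrite d_hv sE d_vv.
have [w wE] := col20 t20E.
have e01 : d_h (s - d_h w) = d_v t02 by rewrite d_hB d_hh0 subr0.
have e10 : d_v (s - d_h w) = 0 by rewrite d_vB -t20E -wE d_hv subrr.
have [h th] := @E2_class_exS A 0 1 (s - d_h w) t02 e10 e01.
exists h; apply/edge_to11P; exists t02, (s - d_h w).
by split; rewrite ?tE.
Qed.

Lemma edge_to11B (x x' : H_PGE2 A 2) h h' :
  @edge_to A 1 1 x h -> @edge_to A 1 1 x' h' -> @edge_to A 1 1 (x - x') (h - h').
Proof.
move=> /edge_to11P[t02 [t11 [xc e01 e10 hc]]].
move=> /edge_to11P[t02' [t11' [xc' e01' e10' hc']]].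
apply/edge_to11P; exists (t02 - t02'), (t11 - t11').
have cB := has_classB xc xc'; have hB := E2_classB hc hc'.
split=> //; first by rewrite D_augB.
- by rewrite d_hB d_vB e01 e01'.
- by rewrite d_vB e10 e10' subrr.
Qed.

Lemma edge_to11_0 h : @edge_to A 1 1 (0 : H_PGE2 A 2) h -> h = 0.
Proof.
move=> /edge_to11P[t02 [t11 [/class_augP[_ [u uE]] e01 e10 hc]]].
have [U [V t02E]] := aug_boundary_split uE.
have [W WE] : exists W : D A 2 1, d_h W = t11 - d_v V.
  by apply: row1_exact; rewrite d_hB d_hv -e01 t02E d_vD d_vv add0r subrr.
have dW : d_v W = 0 by apply: row2_inj; rewrite d_hv WE d_vB e10 d_vv subrr.
by apply: (E2_class_bound hc dW (y := V)); rewrite WE addrC subrK.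
Qed.

End EdgeTo11.

Lemma edge_to21_d2 x h : @edge_to A 2 1 x h -> @d2_graph A 0 1 h 0.
Proof.
move=> /edge_to21P[t03 [t12 [t21 [xc e02 e11 e20 hc]]]].
exists t21, t12; split=> //.
have [h' ch'] : exists h' : E2 A 0 2, E2_class (d_h t12) h'.
  by apply: E2_class_ex0; change (d_v (d_h t12) = 0); rewrite -d_hv -e11 d_hh0.
rewrite -(_ : h' = 0) //; apply: (E2_class_d_v (y := - t03) ch').
by rewrite d_vN; apply/eqP; rewrite -addr_eq0 addrC e02.
Qed.

(** The two correction terms of [E2_class0] are exactly what is needed to complete
    the chains [x] and [y] to a total cycle. *)
Lemma d2_edge_to21 h : @d2_graph A 0 1 h 0 -> exists x, @edge_to A 2 1 x h.
Proof.
move=> [x [y [xh xy /E2_class0[a [b [db yE]]]]]].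
have e02 : d_v (- a) + d_h (y - b) = 0 by rewrite d_hB yE addrK d_vN addNr.
have [c cE] : exists c : H_PGE2 A 3, has_class (D_aug (- a)) c.
  apply: has_class_ex; change (bar_d (D_aug (- a)) = 0).
  have -> : bar_d (D_aug (- a)) = - D_aug (d_h (y - b)).
    rewrite -D_aug_d_v -D_augN; congr D_aug.
    by apply/eqP; rewrite -addr_eq0 e02.
  by rewrite D_aug_d_h oppr0.
exists c; apply/edge_to21P; exists (- a), (y - b), x; split=> //.
- by rewrite d_vB xy [d_v b]db subr0.
- exact: E2_class_out xh.
Qed.

Lemma d2_edge_from h h' : @d2_graph A 0 1 h h' -> @edge_from A 2 h' 0.
Proof.
move=> [x [y [xh xy yh]]]; exists (d_h y) => //; rewrite D_aug_d_h.
by apply/class_augP; split; [apply: raddf0|exists 0; apply: bar_d0].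
Qed.

(** A bounding chain downstairs splits [c] into a vertical boundary and a
    horizontal image [d_h V]; the vertical boundary of [V] then comes from the
    last column, and gives the preimage. *)
Lemma edge_from_d2 h : @edge_from A 2 h 0 -> exists h', @d2_graph A 0 1 h' h.
Proof.
move=> [c ch /class_augP[_ [u uE]]]; have [U [V cE]] := aug_boundary_split uE.
have dc : d_v c = 0 by apply: E2_class_out ch.
have [X XE] : exists X : D A 2 1, d_h X = d_v V.
  by apply: row1_exact; rewrite d_hv; move: dc; rewrite cE d_vD d_vv add0r.
have dX : d_v X = 0 by apply: row2_inj; rewrite d_hv XE d_vv.
have [h' Xh'] := @E2_class_exS A 1 1 X V dX XE.
exists h', X, V; split=> //.
have [k kE] : exists k : E2 A 0 2, E2_class (d_h V) k.
  by apply: E2_class_ex0; change (d_v (d_h V) = 0); rewrite -d_hv -XE d_hh0.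
suff -> : h = k by [].
apply/eqP; rewrite -subr_eq0; apply/eqP/(E2_class_d_v (y := U) (E2_classB ch kE)).
by rewrite cE addrK.
Qed.

Lemma edge_from_to11 h x : @edge_from A 2 h x -> @edge_to A 1 1 x 0.
Proof.
move=> [c ch cx]; have dc : d_v c = 0 by apply: E2_class_out ch.
apply/edge_to11P; exists c, 0; split=> //; rewrite ?d_h0 ?d_v0 //.
have [h' h'E] : exists h' : E2 A 1 1, E2_class (0 : D A 1 1) h'.
  by apply: (@E2_class_exS A 0 1 0 0); rewrite ?d_h0 ?d_v0 //; apply: raddf0.
rewrite -(_ : h' = 0) //; apply: (E2_class_d_v (y := 0) h'E).
by rewrite d_v0.
Qed.

Lemma edge_to11_from x : @edge_to A 1 1 x 0 -> exists h, @edge_from A 2 h x.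
Proof.
move=> /edge_to11P[t02 [t11 [xc e01 e10 /E2_class0[V [W [dW t11E]]]]]].
have dW0 : d_h (d_h W) = 0 by apply: d_hh0.
have [h hE] : exists h : E2 A 0 2, E2_class (t02 - d_h V) h.
  apply: E2_class_ex0; change (d_v (t02 - d_h V) = 0).
  by rewrite d_vB e01 t11E d_hD d_hv dW0 addr0 subrr.
by exists h, (t02 - d_h V) => //; rewrite D_augB D_aug_d_h subr0.
Qed.

Lemma edge_to11_surj h : exists x, @edge_to A 1 1 x h.
Proof.
have [t11 th] := E2_class_surj h; have [t02 e01] := E2_class_dh th.
have [x xE] : exists x : H_PGE2 A 2, has_class (D_aug t02) x.
  apply: has_class_ex; change (bar_d (D_aug t02) = 0).
  by rewrite -D_aug_d_v -e01 D_aug_d_h.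
exists x; apply/edge_to11P; exists t02, t11; split=> //.
exact: E2_class_out th.
Qed.

End Chase.

(** * Quotient modules and semidirect products *)

Section Cokernel.
Variables (U V : zmodType) (f : {additive U -> V}).

Definition im_pred : {pred V} := fun y => `[< exists x, f x = y >].

Fact im_pred_closed : zmod_closed im_pred.
Proof.
split=> [|x y]; rewrite !unfold_in; first by apply/asboolP; exists 0; rewrite raddf0.
move=> /asboolP[u fu] /asboolP[v fv]; apply/asboolP; exists (u - v).
by rewrite raddfB fu fv.
Qed.
HB.instance Definition _ := GRing.isZmodClosed.Build V im_pred im_pred_closed.

Definition coker := Quotient.quot im_pred.
HB.instance Definition _ := Choice.on coker.
HB.instance Definition _ := EqQuotient.on coker.
HB.instance Definition _ := GRing.Zmodule.on coker.
HB.instance Definition _ := ZmodQuotient.on coker.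

Definition coker_pi (y : V) : coker := \pi_coker y.
Fact coker_pi_additive : zmod_morphism coker_pi.
Proof. by move=> x y; rewrite /coker_pi raddfB. Qed.
HB.instance Definition _ := GRing.isZmodMorphism.Build V coker coker_pi coker_pi_additive.

Lemma coker_piB x y : coker_pi (x - y) = coker_pi x - coker_pi y.
Proof. exact: raddfB. Qed.

Lemma coker_pi_eq0 y : coker_pi y = 0 <-> exists x, f x = y.
Proof.
rewrite /coker_pi -(raddf0 (\pi_coker)); split=> [/eqP|e].
  by rewrite -Quotient.idealrBE subr0 unfold_in => /asboolP.
by apply/eqP; rewrite -Quotient.idealrBE subr0 unfold_in; apply/asboolP.
Qed.

Lemma coker_piK x : coker_pi (repr x) = x.
Proof. by rewrite /coker_pi reprK. Qed.
End Cokernel.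

Section CokernelModule.
Variables (G : groupType) (M N : gmod G) (f : gmod_hom M N).
Local Notation coker := (coker f).
Local Notation coker_pi := (coker_pi f).

Definition coker_act g (x : coker) : coker := coker_pi (gact g (repr x)).

Lemma coker_act_pi g y : coker_act g (coker_pi y) = coker_pi (gact g y).
Proof.
apply/eqP; rewrite -subr_eq0 -coker_piB; apply/eqP/coker_pi_eq0.
have [u uE] : exists u, f u = repr (coker_pi y) - y.
  by apply/coker_pi_eq0; rewrite coker_piB coker_piK subrr.
by exists (gact g u); rewrite gmod_funJ uE raddfB.
Qed.

Fact coker_act_additive g : zmod_morphism (coker_act g).
Proof.
move=> x y; rewrite -[x]coker_piK -[y]coker_piK -coker_piB !coker_act_pi.
by rewrite raddfB coker_piB.
Qed.
HB.instance Definition _ g :=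
  GRing.isZmodMorphism.Build coker coker (coker_act g) (coker_act_additive g).

Fact coker_act1 x : coker_act 1%g x = x.
Proof. by rewrite -[x]coker_piK coker_act_pi gact1. Qed.
Fact coker_actM g h x : coker_act (g * h)%g x = coker_act g (coker_act h x).
Proof. by rewrite -[x]coker_piK !coker_act_pi gactM. Qed.

Definition coker_gmod : gmod G := Gmod coker_act1 coker_actM.
End CokernelModule.

Section GactLin.
Variables (G : groupType) (M : gmod G).
Lemma gactB g (x y : M) : gact g (x - y) = gact g x - gact g y.
Proof. exact: raddfB. Qed.
Lemma gactN g (x : M) : gact g (- x) = - gact g x.
Proof. exact: raddfN. Qed.
Lemma gact0 g : gact g (0 : M) = 0.
Proof. exact: raddf0. Qed.
End GactLin.

Section Semidirect.
Variables (G : groupType) (M : gmod G).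

(** A crossed homomorphism to [M] over a homomorphism to [G] is the same as a
    homomorphism to this group, so that one can be defined on generators. *)
Definition semidirect : Type := (M * G)%type.
HB.instance Definition _ := Choice.on semidirect.

Definition sd_mul (x y : semidirect) : semidirect := (x.1 + gact x.2 y.1, (x.2 * y.2)%g).
Definition sd_one : semidirect := (0, 1%g).
Definition sd_inv (x : semidirect) : semidirect := (- gact x.2^-1%g x.1, x.2^-1%g).

Fact sd_mulA : associative sd_mul.
Proof. by move=> x y z; rewrite /sd_mul /= raddfD gactM addrA mulgA. Qed.
Fact sd_mul1 : left_id sd_one sd_mul.
Proof. by move=> [m g]; rewrite /sd_mul /= gact1 add0r mul1g. Qed.
Fact sd_mulr1 : right_id sd_one sd_mul.
Proof. by move=> [m g]; rewrite /sd_mul /= raddf0 addr0 mulg1. Qed.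
Fact sd_mulV : left_inverse sd_one sd_inv sd_mul.
Proof. by move=> [m g]; rewrite /sd_mul /= addNr mulVg. Qed.
Fact sd_mulrV : right_inverse sd_one sd_inv sd_mul.
Proof. by move=> [m g]; rewrite /sd_mul /= raddfN -gactM mulgV gact1 subrr. Qed.
HB.instance Definition _ :=
  isGroup.Build semidirect sd_mulA sd_mul1 sd_mulr1 sd_mulV sd_mulrV.

Lemma sdM1 (x y : semidirect) : (x * y)%g.1 = x.1 + gact x.2 y.1. Proof. by []. Qed.
Lemma sdM2 (x y : semidirect) : (x * y)%g.2 = (x.2 * y.2)%g. Proof. by []. Qed.
Lemma sdV1 (x : semidirect) : (x^-1)%g.1 = - gact x.2^-1%g x.1. Proof. by []. Qed.
Lemma sdV2 (x : semidirect) : (x^-1)%g.2 = (x.2^-1)%g. Proof. by []. Qed.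

Lemma sd_conj1 (x y : semidirect) :
  (x * (y * x^-1))%g.1 = x.1 + gact x.2 (y.1 - gact y.2 (gact x.2^-1%g x.1)).
Proof. by rewrite !sdM1 sdV1 gactN. Qed.

Lemma sd_ker_mul (x y : semidirect) : x.1 = 0 -> y.1 = 0 -> (x * y)%g.1 = 0.
Proof. by rewrite sdM1 => -> ->; rewrite raddf0 addr0. Qed.
Lemma sd_ker_inv (x : semidirect) : x.1 = 0 -> (x^-1)%g.1 = 0.
Proof. by rewrite sdV1 => ->; rewrite raddf0 oppr0. Qed.
End Semidirect.

Section PresentedEval.
Variables (X : choiceType) (rels : word X -> word X -> Prop).
Variables (G : groupType) (f : X -> G).
Hypothesis f_rels : forall u v, rels u v -> word_eval f u = word_eval f v.

Lemma word_eval_inv (w : word X) : word_eval f (word_inv w) = (word_eval f w)^-1%g.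
Proof.
apply/esym/mulg1_eq; rewrite -word_eval_cat.
by rewrite (word_eval_equiv f_rels (word_invr rels w)) /word_eval big_nil.
Qed.

Lemma pres_evalM (x y : presented rels) :
  pres_eval f (x * y)%g = (pres_eval f x * pres_eval f y)%g.
Proof.
rewrite -[x]reprK -[y]reprK -[(_ * _)%g]/(pres_mul _ _) pres_mulE.
by rewrite !(pres_evalE f_rels) word_eval_cat.
Qed.

Lemma pres_evalV (x : presented rels) : pres_eval f x^-1%g = (pres_eval f x)^-1%g.
Proof.
rewrite -[x]reprK -[(_^-1)%g]/(pres_inv _) pres_invE.
by rewrite !(pres_evalE f_rels) word_eval_inv.
Qed.

Lemma pres_eval1 : pres_eval f (1%g : presented rels) = 1%g.
Proof. by rewrite -[1%g]/(pres_one _) (pres_evalE f_rels) /word_eval big_nil. Qed.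
End PresentedEval.

(** * Universality for GE2 kills the first homology of Y *)

Lemma two_triangles (V : zmodType) (x y a b : V) :
  x - y + a = 0 -> y - x + b = 0 -> b = - a.
Proof. by move=> /addr0_eq <- /addr0_eq <-; rewrite opprK opprB. Qed.

Lemma triangle_sub (V : zmodType) (e x y : V) : e - x + y = 0 -> x - y = e.
Proof. by move=> /addr0_eq <-; rewrite !opprB addrC subrK. Qed.

Lemma triangle_cancel (V : zmodType) (e x y z : V) :
  z - y + x = 0 -> e - x + (y - z) = e.
Proof. by move=> /addr0_eq <-; rewrite opprB subrK. Qed.

Section H1Y.
Variable A : comPzRingType.
Local Notation Y := (Yconf A).
Variables (M0 : gmod (PGE2 A)) (p : gmod_hom (chain_gmod Y 1) M0).
Hypothesis p_diff : forall x : conf_chain Y 2, p (chain_diff x) = 0.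
Implicit Types (g : PGE2 A) (u r s : A).

Let edge (c : config Y 1) : M0 := p (ccell c).

Lemma edge_act g (c : config Y 1) : gact g (edge c) = edge (config_act g c).
Proof.
rewrite /edge -gmod_funJ; have -> // : gact g (ccell c : chain_gmod Y 1) = ccell (config_act g c).
exact: ccell_act.
Qed.

Lemma triangle (c : config Y 2) :
  edge (face 0 c) - edge (face 1 c) + edge (face 2%:R c) = 0.
Proof. by rewrite /edge -(raddfB p) -(raddfD p) -chain_diff2 p_diff. Qed.

Definition pelem (ij : bool) r : PGE2 A := pge (@GE2_elem A ij r).

Lemma cpt_face n (c : config Y n.+1) i j : cpt (face i c) j = cpt c (lift i j).
Proof. by rewrite /cpt tnth_mktuple. Qed.

Lemma config1P (c c' : config Y 1) : cpt c 0 = cpt c' 0 -> cpt c 1 = cpt c' 1 -> c = c'.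
Proof.
move=> e0 e1; apply: cpt_inj => i.
have [->|->] // : i = 0 \/ i = 1.
by case: i => -[|[|//]] Hi; [left|right]; apply: val_inj.
Qed.

Lemma lift3 : [/\ lift (0 : 'I_3) (0 : 'I_2) = 1, lift (0 : 'I_3) (1 : 'I_2) = 2%:R,
  lift (1 : 'I_3) (0 : 'I_2) = 0, lift (1 : 'I_3) (1 : 'I_2) = 2%:R &
  lift (2%:R : 'I_3) (0 : 'I_2) = 0 /\ lift (2%:R : 'I_3) (1 : 'I_2) = 1].
Proof. by do !split; apply: val_inj. Qed.

(** The boundary of the translate by [h] of the base triangle, with its edges
    written as translates of the base edge. The scalars [a0], ..., [b2] are there
    because a point determines its column only up to a unit. *)
Lemma triangle_mx (g0 g1 g2 g : PGE2 A) (h0 h1 h2 h : GL2 A) a b c d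
    a0 b0 a1 b1 a2 b2 :
    val g = \pi_(PGL2 A) h -> mx h = mat2 a b c d ->
    val g0 = \pi_(PGL2 A) h0 -> val g1 = \pi_(PGL2 A) h1 -> val g2 = \pi_(PGL2 A) h2 ->
    is_unit a0 -> is_unit b0 -> is_unit a1 -> is_unit b1 -> is_unit a2 -> is_unit b2 ->
    mx h0 = mat2 (a0 * b) (b0 * (a + b)) (a0 * d) (b0 * (c + d)) ->
    mx h1 = mat2 (a1 * a) (b1 * (a + b)) (a1 * c) (b1 * (c + d)) ->
    mx h2 = mat2 (a2 * a) (b2 * b) (a2 * c) (b2 * d) ->
  edge (config_act g0 (base1 A)) - edge (config_act g1 (base1 A))
    + edge (config_act g2 (base1 A)) = 0.
Proof.
move=> gE hE g0E g1E g2E ua0 ub0 ua1 ub1 ua2 ub2 h0E h1E h2E.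
have [l00 l01 l10 l11 [l20 l21]] := lift3.
have cl k v : in_class (cpt (base2 A) k) v ->
    in_class (cpt (config_act g (base2 A)) k) (mx h *m v).
  by move=> xv; rewrite cpt_act gE; apply: in_class_act.
have inf_cl := class_pinf A; have zero_cl := class_pzero A; have one_cl := class_pone A.
have c0 := cl 0 _ inf_cl; have c1 := cl 1 _ zero_cl; have c2 := cl 2%:R _ one_cl.
rewrite hE mat2_col2 !(mulr1, mulr0, addr0, add0r) in c0.
rewrite hE mat2_col2 !(mulr1, mulr0, addr0, add0r) in c1.
rewrite hE mat2_col2 !(mulr1, mulr0, addr0, add0r) in c2.
have aux (g' : PGE2 A) (h' : GL2 A) i x v w : val g' = \pi_(PGL2 A) h' ->
    in_class (cpt (base1 A) i) v -> in_class x w ->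
    (exists2 k, is_unit k & mx h' *m v = k *: w) ->
    cpt (config_act g' (base1 A)) i = x.
  by move=> e xv xw /(act_class h' xv xw); rewrite cpt_act e.
have inf1 : in_class (cpt (base1 A) 0) (col2 1 0) by rewrite cpt_base1_0.
have zero1 : in_class (cpt (base1 A) 1) (col2 0 1) by rewrite cpt_base1_1.
have e0 : config_act g0 (base1 A) = face 0 (config_act g (base2 A)).
  apply: config1P; rewrite cpt_face ?l00 ?l01.
    apply: (aux _ _ _ _ _ _ g0E inf1 c1); exists a0 => //.
    by rewrite h0E mat2_col2 col2Z !(mulr1, mulr0, addr0, add0r).
  apply: (aux _ _ _ _ _ _ g0E zero1 c2); exists b0 => //.
  by rewrite h0E mat2_col2 col2Z !(mulr1, mulr0, addr0, add0r).
have e1 : config_act g1 (base1 A) = face 1 (config_act g (base2 A)).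
  apply: config1P; rewrite cpt_face ?l10 ?l11.
    apply: (aux _ _ _ _ _ _ g1E inf1 c0); exists a1 => //.
    by rewrite h1E mat2_col2 col2Z !(mulr1, mulr0, addr0, add0r).
  apply: (aux _ _ _ _ _ _ g1E zero1 c2); exists b1 => //.
  by rewrite h1E mat2_col2 col2Z !(mulr1, mulr0, addr0, add0r).
have e2 : config_act g2 (base1 A) = face 2%:R (config_act g (base2 A)).
  apply: config1P; rewrite cpt_face ?l20 ?l21.
    apply: (aux _ _ _ _ _ _ g2E inf1 c0); exists a2 => //.
    by rewrite h2E mat2_col2 col2Z !(mulr1, mulr0, addr0, add0r).
  apply: (aux _ _ _ _ _ _ g2E zero1 c1); exists b2 => //.
  by rewrite h2E mat2_col2 col2Z !(mulr1, mulr0, addr0, add0r).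
by rewrite e0 e1 e2 triangle.
Qed.

Let e : M0 := edge (base1 A).
Let pswap : PGE2 A := pge (GE2_swap A).

Lemma gact_e g : gact g e = edge (config_act g (base1 A)).
Proof. exact: edge_act. Qed.

(** Diagonal matrices fix the base edge. *)
Lemma gact_e_eq (g g' : PGE2 A) (h h' : GL2 A) a b : val g = \pi_(PGL2 A) h -> val g' = \pi_(PGL2 A) h' ->
    is_unit a -> is_unit b -> mx h = mx h' *m mat2 a 0 0 b -> gact g e = gact g' e.
Proof.
move=> gE g'E ua ub hE; rewrite !gact_e; congr edge.
have [d dE] : exists d : GL2 A, mx d = mat2 a 0 0 b.
  by apply: GL2_of_det; rewrite mulr0 subr0; apply: is_unitM.
have -> : g = (g' * pge (GE2_diag dE))%g.
  by apply: val_inj; rewrite gE [RHS]/= g'E -pi_PGL2M; congr (\pi_(PGL2 A) _); apply: mx_inj; rewrite hE mxM dE.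
rewrite config_actM; congr config_act; apply: config1P; rewrite cpt_act /=.
  by rewrite cpt_base1_0; apply/stab_pinf; rewrite dE mxE.
rewrite cpt_base1_1; apply/(act_class d (class_pzero A) (class_pzero A)); exists b => //.
by rewrite dE mat2_col2 col2Z !(mulr1, mulr0, add0r, addr0, mul0r).
Qed.

(** The triangles on infinity, 0, 1 and on 0, infinity, 1 have two edges in common,
    with opposite signs; so reversing an edge changes its sign. *)
Lemma gact_e_swap : gact pswap e = - e.
Proof.
have un1 : is_unit (1 : A) by apply: is_unit1.
have [h0 h0E] : exists h : GL2 A, mx h = mat2 0 1 1 1.
  by apply: GL2_of_det; exists (-1); ring.
have [h1 h1E] : exists h : GL2 A, mx h = mat2 1 1 0 1.
  by apply: GL2_of_det; exists 1; ring.
have G0 : GE2 h0.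
  have -> : h0 = (swap A * h1)%g.
    by apply: mx_inj; rewrite mxM h0E h1E [mx (swap A)]/mx /= mat2M; congr mat2; ring.
  by apply: gen_mul; [apply: GE2_swap|apply: GE2_upper; rewrite h1E mxE].
have G1 : GE2 h1 by apply: GE2_upper; rewrite h1E mxE.
have t1 := @triangle_mx (pge G0) (pge G1) 1%g 1%g h0 h1 1%g 1%g 1 0 0 1 1 1 1 1 1 1
  erefl (mat2_1 A) erefl erefl erefl un1 un1 un1 un1 un1 un1.
have t2 := @triangle_mx (pge G1) (pge G0) pswap pswap h1 h0 (swap A) (swap A) 0 1 1 0 1 1 1 1 1 1
  erefl erefl erefl erefl erefl un1 un1 un1 un1 un1 un1.
rewrite !(mul1r, addr0, add0r, mulr0) mx1 mat2_1 config_act1 in t1.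
rewrite !(mul1r, addr0, add0r, mulr0) in t2.
have {}t1 := t1 h0E h1E erefl; have {}t2 := t2 h1E h0E erefl.
rewrite gact_e; exact: (two_triangles t1 t2).
Qed.

Lemma is_unitN (a : A) : is_unit a -> is_unit (- a).
Proof. by move=> [b ab]; exists (- b); rewrite mulrNN. Qed.

Let un1 : is_unit (1 : A) := is_unit1 A.
Let unl u u' : u * u' = 1 -> is_unit u. Proof. by exists u'. Qed.
Let unr u u' : u * u' = 1 -> is_unit u'. Proof. by exists u; rewrite mulrC. Qed.

Lemma mx_elem_true r : mx (elem true r) = mat2 1 r 0 1. Proof. by []. Qed.
Lemma mx_elem_false r : mx (elem false r) = mat2 1 0 r 1. Proof. by []. Qed.

Lemma triangle12 u u' : u * u' = 1 ->
  e - gact (pelem true u) e + gact (pelem true u * pelem false (- u'))%g e = 0.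
Proof.
move=> uu'; have uu := unl uu'; have uu1 := unr uu'; have nu1 := is_unitN uu1.
have [h hE] : exists h : GL2 A, mx h = mat2 u 0 0 1.
  by apply: GL2_of_det; rewrite mulr1 mulr0 subr0.
have t := @triangle_mx (pelem true u * pelem false (- u'))%g (pelem true u) 1%g
  (pge (GE2_diag hE)) (elem true u * elem false (- u'))%g (elem true u) 1%g h u 0 0 1
  (- u') 1 u' 1 u' 1 erefl hE (esym (pi_PGL2M _ _)) erefl erefl
  nu1 un1 uu1 un1 uu1 un1.
rewrite mx1 mat2_1 config_act1 in t; rewrite !gact_e /e.
rewrite -[LHS](_ : edge (config_act (pelem true u * pelem false (- u'))%g (base1 A)) -
  edge (config_act (pelem true u) (base1 A)) + edge (base1 A) = _).
  by apply: t; rewrite ?mxM ?mx_elem_true ?mx_elem_false ?mat2M; congr mat2; ring: uu'.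
by rewrite addrC addrA addrAC.
Qed.

Lemma triangle21 u u' : u * u' = 1 ->
  gact (pelem false u * pelem true (- u') * pelem false u)%g e
    - gact (pelem false u * pelem true (- u'))%g e + gact (pelem false u) e = 0.
Proof.
move=> uu'; have uu := unl uu'; have uu1 := unr uu'; have nu1 := is_unitN uu1.
have [h hE] : exists h : GL2 A, mx h = mat2 1 0 u (- u).
  by apply: GL2_of_det; rewrite mul1r mul0r subr0; apply: is_unitN.
have hG : GE2 h.
  have [k kE] : exists k : GL2 A, mx k = mat2 1 0 0 (- u).
    by apply: GL2_of_det; rewrite mul1r mul0r subr0; apply: is_unitN.
  have -> : h = (elem false u * k)%g.
    by apply: mx_inj; rewrite mxM mx_elem_false kE hE mat2M; congr mat2; ring.
  by apply: gen_mul; [apply: GE2_elem|apply: GE2_diag kE].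
have t := @triangle_mx (pelem false u * pelem true (- u') * pelem false u)%g
  (pelem false u * pelem true (- u'))%g (pelem false u) (pge hG)
  (elem false u * elem true (- u') * elem false u)%g
  (elem false u * elem true (- u'))%g (elem false u) h 1 0 u (- u)
  (- 1) (- u') 1 (- u') 1 (- u') erefl hE.
rewrite !gact_e; apply: t => //; try exact: is_unitN.
- by rewrite !pi_PGL2M.
- by rewrite !pi_PGL2M.
- by rewrite !mxM mx_elem_true !mx_elem_false !mat2M; congr mat2; ring: uu'.
- by rewrite !mxM mx_elem_true !mx_elem_false !mat2M; congr mat2; ring: uu'.
- by rewrite mx_elem_false; congr mat2; ring: uu'.
Qed.

Definition pw (ij : bool) u u' : PGE2 A :=
  (pelem ij u * pelem (~~ ij) (- u') * pelem ij u)%g.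

Lemma gact_pw_e ij u u' : u * u' = 1 -> gact (pw ij u u') e = - e.
Proof.
move=> uu'; rewrite -gact_e_swap; have uu := unl uu'; have uu1 := unr uu'.
pose h := (elem ij u * elem (~~ ij) (- u') * elem ij u)%g : GL2 A.
have hE : val (pw ij u u') = \pi_(PGL2 A) h by rewrite !pi_PGL2M.
case: ij @h hE => h hE.
  apply: (@gact_e_eq _ _ _ (swap A) (- u') u hE) => //; first exact: is_unitN.
  by rewrite !mxM mx_elem_true mx_elem_false /mx /= !mat2M; congr mat2; ring: uu'.
apply: (@gact_e_eq _ _ _ (swap A) u (- u') hE) => //; first exact: is_unitN.
by rewrite !mxM mx_elem_true mx_elem_false /mx /= !mat2M; congr mat2; ring: uu'.
Qed.

Lemma gact_pwV_e ij u u' : u * u' = 1 -> gact (pw ij u u')^-1%g e = - e.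
Proof.
move=> /(gact_pw_e ij) pe; apply: oppr_inj; rewrite opprK -raddfN -pe -gactM mulVg.
exact: gact1.
Qed.

(** The displacement of the point at infinity, that is, the class of a path from it
    to its image. The generator [x_12(r)] fixes it; [x_21(r)] fixes the point 0,
    and the path goes along the edge to 0 and back along the translated edge. *)
Definition disp_gen (l : bool * A) : semidirect M0 :=
  if l.1 then (0, pelem true l.2) else (e - gact (pelem false l.2) e, pelem false l.2).

Lemma disp_gen2 ij r : (disp_gen (ij, r)).2 = pelem ij r.
Proof. by case: ij. Qed.
Lemma disp_gen_true r : (disp_gen (true, r)).1 = 0. Proof. by []. Qed.
Lemma disp_gen_false r : (disp_gen (false, r)).1 = e - gact (pelem false r) e.
Proof. by []. Qed.

Lemma pelemD ij r s : (pelem ij r * pelem ij s)%g = pelem ij (r + s).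
Proof.
apply: val_inj; rewrite /= -pi_PGL2M; congr (\pi_(PGL2 A) _); apply: mx_inj.
by case: ij; rewrite mxM ?mx_elem_true ?mx_elem_false mat2M; congr mat2; ring.
Qed.

Lemma word_eval1 (X : choiceType) (G : groupType) (f : X -> G) x :
  word_eval f [:: (false, x)] = f x.
Proof. by rewrite /word_eval big_cons big_nil mulg1. Qed.

Lemma word_eval1V (X : choiceType) (G : groupType) (f : X -> G) x :
  word_eval f [:: (true, x)] = (f x)^-1%g.
Proof. by rewrite /word_eval big_cons big_nil mulg1. Qed.

Lemma word_eval_wl ij u u' :
  word_eval disp_gen (wl ij u u') =
  (disp_gen (ij, u) * (disp_gen (~~ ij, (- u')%R) * disp_gen (ij, u)))%g.
Proof. by rewrite /wl !word_eval_cat !word_eval1. Qed.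

(** All the elements [w_ij(u)] exchange the two coordinate points, so their
    displacement is the base edge, whatever the unit is. *)
Lemma disp_w ij u u' : u * u' = 1 -> (word_eval disp_gen (wl ij u u')).1 = e.
Proof.
move=> uu'; rewrite word_eval_wl !sdM1 !disp_gen2.
case: ij; rewrite [~~ _]/= disp_gen_true disp_gen_false.
  rewrite gact0 addr0 add0r gactB -gactM.
  exact: triangle_sub (triangle12 uu').
rewrite add0r -(gactM (pelem false u)) gactB -(gactM (_ * _)%g).
exact: triangle_cancel (triangle21 uu').
Qed.

Lemma disp_w2 ij u u' : (word_eval disp_gen (wl ij u u')).2 = pw ij u u'.
Proof. by rewrite word_eval_wl !sdM2 !disp_gen2 mulgA. Qed.

Lemma PGE2_valM g h : val (g * h)%g = (val g * val h)%g. Proof. by []. Qed.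
Lemma PGE2_valV g : val g^-1%g = (val g)^-1%g. Proof. by []. Qed.

Lemma disp_val (w : word (bool * A)%type) :
  val (word_eval disp_gen w).2 = \pi_(PGL2 A) (word_eval (fun l => elem l.1 l.2) w).
Proof.
elim: w => [|[b [ij r]] w IH]; first by rewrite /word_eval !big_nil.
rewrite -cat1s !word_eval_cat sdM2 pi_PGL2M PGE2_valM IH; congr (_ * _)%g.
case: b; last by rewrite !word_eval1 disp_gen2.
by rewrite !word_eval1V pi_PGL2V sdV2 disp_gen2 PGE2_valV.
Qed.

Lemma sd_eqP (G : groupType) (M : gmod G) (x y : semidirect M) :
  x.1 = y.1 -> x.2 = y.2 -> x = y.
Proof. by case: x y => [? ?] [? ?] /= -> ->. Qed.

Lemma disp_conj1 ij u u' (x : semidirect M0) : u * u' = 1 ->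
  (word_eval disp_gen (wl ij u u') * (x * (word_eval disp_gen (wl ij u u'))^-1))%g.1 =
  e + gact (pw ij u u') (x.1 + gact x.2 e).
Proof.
move=> uu'; rewrite sd_conj1 disp_w2 (disp_w ij uu') (gact_pwV_e ij uu').
by rewrite (gactN x.2) opprK.
Qed.

(** The displacement of [x_21] is a coboundary, so it is additive. The conjugation
    relation holds because the displacement of [w_ij(u)] is the edge [e] and its
    action reverses [e]. *)
Lemma disp_rels v w : St_rels v w -> word_eval disp_gen v = word_eval disp_gen w.
Proof.
move=> vw; have e2 : (word_eval disp_gen v).2 = (word_eval disp_gen w).2.
  by apply: val_inj; rewrite !disp_val (St_rels_GL2 vw).
apply: sd_eqP (e2); case: vw e2 => [ij r s|ij u u' r uu'] e2.
  rewrite word_eval_cat !word_eval1 sdM1 disp_gen2.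
  case: ij in e2 *; first by rewrite !disp_gen_true gact0 addr0.
  by rewrite !disp_gen_false gactB -gactM pelemD addrA subrK.
have inv_rels : forall x y, (fun _ _ : word (bool * A)%type => False) x y ->
    word_eval disp_gen x = word_eval disp_gen y by [].
move: e2; rewrite (word_eval_cat _ (wl ij u u')) (word_eval_cat _ (xl _ r)) (word_eval_inv inv_rels) !word_eval1 disp_conj1 // disp_gen2.
rewrite !sdM2 sdV2 disp_w2 !disp_gen2; case: ij => [_|e2].
  rewrite [~~ _]/= disp_gen_false disp_gen_true subrK.
  by rewrite (gact_pw_e true uu') subrr.
rewrite [~~ _]/= disp_gen_false disp_gen_true add0r -e2 !gactM (gact_pwV_e false uu').
by rewrite !gactN opprK.
Qed.

Definition disp : St A -> semidirect M0 := pres_eval disp_gen.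

Lemma dispM (k l : St A) : disp (k * l)%g = (disp k * disp l)%g.
Proof. exact: (pres_evalM disp_rels). Qed.
Lemma dispV (k : St A) : disp k^-1%g = (disp k)^-1%g.
Proof. exact: (pres_evalV disp_rels). Qed.
Lemma disp1 : disp 1%g = 1%g.
Proof. exact: (pres_eval1 disp_rels). Qed.
Lemma disp_x ij r : disp (St_x ij r) = disp_gen (ij, r).
Proof. by rewrite /disp /St_x (pres_evalE disp_rels) word_eval1. Qed.

Lemma disp_St_val (k : St A) : val (disp k).2 = \pi_(PGL2 A) (St_to_GL2 k).
Proof.
by rewrite -[k]reprK /disp /St_to_GL2 (pres_evalE disp_rels) (pres_evalE (@St_rels_GL2 A)) disp_val.
Qed.

Lemma St_to_GL2M (k l : St A) : St_to_GL2 (k * l)%g = (St_to_GL2 k * St_to_GL2 l)%g.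
Proof. exact: (pres_evalM (@St_rels_GL2 A)). Qed.
Lemma St_to_GL2V (k : St A) : St_to_GL2 k^-1%g = (St_to_GL2 k)^-1%g.
Proof. exact: (pres_evalV (@St_rels_GL2 A)). Qed.

Lemma St_to_GL2_1 : St_to_GL2 (1%g : St A) = 1%g.
Proof. exact: (pres_eval1 (@St_rels_GL2 A)). Qed.

Lemma disp_w12 u u' : u * u' = 1 -> (disp (St_w12 u u')).1 = e.
Proof.
move=> uu'; rewrite -(disp_w true uu') word_eval_wl.
by rewrite /St_w12 !dispM !disp_x mulgA.
Qed.

Lemma disp_w12_2 u u' : (disp (St_w12 u u')).2 = pw true u u'.
Proof. by rewrite /St_w12 !dispM !disp_x !sdM2 !disp_gen2. Qed.

Lemma disp_h12 u u' : u * u' = 1 -> (disp (St_h12 u u')).1 = 0.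
Proof.
move=> uu'; rewrite /St_h12 dispM sdM1 !disp_w12 ?mulrNN ?mulr1 // disp_w12_2.
by rewrite (gact_pw_e true uu') subrr.
Qed.

Hypothesis univ : universal_for_GE2 A.

(** The element [h_12(u)] goes along an edge and comes back, so the Steinberg
    symbols have no displacement; by universality they generate [K2]. This is
    the only use of universality. *)
Lemma disp_K2 (k : St A) : K2 k -> (disp k).1 = 0.
Proof.
move=> /univ; elim=> {k} [k [u [u' [v [v' [uu' vv' ->]]]]]||k l _ kE _ lE|k _ kE].
- have uv : (u * v) * (u' * v') = 1 by rewrite mulrACA uu' vv' mulr1.
  rewrite (dispM (_ * _)%g) (dispM (St_h12 _ _)) (dispV (St_h12 u u')) (dispV (St_h12 v v')).
  exact: (sd_ker_mul (sd_ker_mul (disp_h12 uv) (sd_ker_inv (disp_h12 uu')))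
    (sd_ker_inv (disp_h12 vv'))).
- by rewrite disp1.
- by rewrite dispM; apply: sd_ker_mul.
- by rewrite dispV; apply: sd_ker_inv.
Qed.

Definition is_diag (h : GL2 A) := exists a d, mx h = mat2 a 0 0 d.

Lemma is_diagV h : is_diag h -> is_diag h^-1%g.
Proof.
move=> [a [d hE]]; have [k kE] := det2_unit h.
move: kE; rewrite hE det2E mul0r subr0 => kE.
exists (d * k), (a * k).
have hN : mx h *m mat2 (d * k) 0 0 (a * k) = 1%:M.
  by rewrite hE mat2M mat2_1; congr mat2; ring: kE.
by rewrite -[RHS]mul1mx -(mxVr h) -mulmxA hN mulmx1.
Qed.

Lemma is_diagM h k : is_diag h -> is_diag k -> is_diag (h * k)%g.
Proof.
move=> [a [d hE]] [a' [d' kE]]; exists (a * a'), (d * d').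
by rewrite mxM hE kE mat2M; congr mat2; ring.
Qed.

Lemma elemV ij r : (elem ij r)^-1%g = elem ij (- r) :> GL2 A.
Proof. by apply: mx_inj; case: ij. Qed.

Lemma diag_elem h ij r : is_diag h -> exists r', (h * elem ij r = elem ij r' * h)%g.
Proof.
move=> [a [d hE]]; have [k kE] := det2_unit h.
move: kE; rewrite hE det2E mul0r subr0 => kE.
exists (if ij then a * r * (a * k) else d * r * (d * k)); apply: mx_inj.
by case: ij; rewrite !mxM hE ?mx_elem_true ?mx_elem_false !mat2M; congr mat2; ring: kE.
Qed.

Lemma diag_St h (k : St A) : is_diag h ->
  exists k', (h * St_to_GL2 k = St_to_GL2 k' * h)%g.
Proof.
move=> hD; rewrite -[k]reprK; elim: (repr k) => [|[b [ij r]] w [k' IH]].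
  exists 1%g; have -> : \pi_(St A) [::] = 1%g by [].
  by rewrite St_to_GL2_1 mulg1 mul1g.
have [r' r'E] := diag_elem ij (if b then - r else r) hD.
exists (St_x ij r' * k')%g; rewrite St_to_GL2M St_to_GL2_x -mulgA -IH mulgA -r'E.
rewrite -mulgA; congr (_ * _)%g.
rewrite /St_to_GL2 !(pres_evalE (@St_rels_GL2 A)) -cat1s word_eval_cat; congr (_ * _)%g.
by case: b {r'E}; rewrite ?word_eval1 ?word_eval1V ?elemV.
Qed.

(** Diagonal matrices normalise the elementary subgroup, so its elements can be
    collected on the left. *)
Lemma GE2_St h : GE2 h -> forall k : St A,
  exists k' d, is_diag d /\ (h * St_to_GL2 k = St_to_GL2 k' * d)%g.
Proof.
pose P (h : GL2 A) := forall k : St A,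
  exists k' d, is_diag d /\ (h * St_to_GL2 k = St_to_GL2 k' * d)%g.
suff PP h' : GE2 h' -> P h' /\ P h'^-1%g by move=> /PP[].
have diag1 : is_diag 1%g by exists 1, 1; rewrite mx1 mat2_1.
have PM a b : P a -> P b -> P (a * b)%g.
  move=> Pa Pb k; have [k1 [d1 [d1D e1]]] := Pb k; have [k2 [d2 [d2D e2]]] := Pa k1.
  exists k2, (d2 * d1)%g; split; first exact: is_diagM.
  by rewrite -mulgA e1 mulgA e2 mulgA.
elim=> {h'} [h' [[ij [r ->]]|hD]||a b _ [Pa Pa'] _ [Pb Pb']|a _ [Pa Pa']].
- split=> k; first by exists (St_x ij r * k)%g, 1%g; rewrite St_to_GL2M St_to_GL2_x mulg1.
  by exists ((St_x ij r)^-1 * k)%g, 1%g; rewrite St_to_GL2M St_to_GL2V St_to_GL2_x mulg1.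
- have {}hD : is_diag h'.
    exists (mx h' 0 0), (mx h' 1 1); rewrite {1}[mx h']mat2_eta.
    move/is_diag_mxP: hD => hD.
    by rewrite (hD 0 1 (isT : (0 : 'I_2) != 1)) (hD 1 0 (isT : (1 : 'I_2) != 0)).
  split=> k.
    by have [k' e'] := diag_St k hD; exists k', h'.
  have hD' := is_diagV hD.
  by have [k' e'] := diag_St k hD'; exists k', h'^-1%g.
- by rewrite invg1; split=> k; exists k, 1%g; rewrite mulg1 mul1g.
- by rewrite invgM; split; apply: PM.
- by rewrite invgK.
Qed.

Lemma det2_St (k : St A) : det2 (mx (St_to_GL2 k)) = 1.
Proof.
rewrite -[k]reprK /St_to_GL2 (pres_evalE (@St_rels_GL2 A)).
elim: (repr k) => [|[b [ij r]] w IH]; first by rewrite /word_eval big_nil det2_1.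
rewrite -cat1s word_eval_cat mxM det2M IH mulr1.
have dE s : det2 (mx (elem ij s)) = 1 :> A.
  by case: ij; rewrite ?mx_elem_true ?mx_elem_false det2E; ring.
by case: b; rewrite ?word_eval1 ?word_eval1V ?elemV dE.
Qed.

Lemma St_w12_GL2 u u' : u * u' = 1 -> mx (St_to_GL2 (St_w12 u u')) = mat2 0 u (- u') 0.
Proof.
move=> uu'; rewrite /St_w12 !St_to_GL2M !St_to_GL2_x !mxM !mx_elem_true !mx_elem_false !mat2M.
by congr mat2; ring: uu'.
Qed.

Lemma St_h12_GL2 u u' : u * u' = 1 -> mx (St_to_GL2 (St_h12 u u')) = mat2 u 0 0 u'.
Proof.
move=> uu'; rewrite /St_h12 St_to_GL2M mxM !St_w12_GL2 ?mulrNN ?mulr1 // mat2M.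
by congr mat2; ring.
Qed.

(** The image in [GL2] of such an element is upper triangular of determinant 1, so
    it is also the image of some [h_12(a) x_12(r)], which has no displacement; the
    two lifts differ by an element of [K2]. *)
Lemma disp_stab (k : St A) :
  config_act (disp k).2 (base0 A) = base0 A -> (disp k).1 = 0.
Proof.
move=> ek; have h10 : mx (St_to_GL2 k) 1 0 = 0.
  apply/stab_pinf; have := cpt_act (base0 A) (disp k).2 0.
  by rewrite ek cpt_base0 disp_St_val => /esym.
have := det2_St k; rewrite [mx _]mat2_eta h10 det2E mulr0 subr0.
set a := mx _ 0 0; pose b := mx (St_to_GL2 k) 0 1; set d := mx _ 1 1 => ad.
pose l : St A := (St_h12 a d * St_x true (d * b))%g.
have lE : St_to_GL2 l = St_to_GL2 k.
  apply: mx_inj; rewrite /l St_to_GL2M St_to_GL2_x mxM St_h12_GL2 // mx_elem_true mat2M.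
  rewrite [RHS]mat2_eta h10 -/a -/b -/d.
  by congr mat2; ring: ad.
have l0 : (disp l).1 = 0.
  by rewrite dispM; apply: sd_ker_mul; [apply: disp_h12|rewrite disp_x].
have kl0 : (disp (k * l^-1)%g).1 = 0.
  by apply: disp_K2; rewrite /K2 St_to_GL2M St_to_GL2V lE mulgV.
have -> : disp k = (disp (k * l^-1)%g * disp l)%g by rewrite -dispM -mulgA mulVg mulg1.
exact: sd_ker_mul.
Qed.

Lemma St_reaches (c : config Y 1) : exists k : St A, config_act (disp k).2 (base1 A) = c.
Proof.
have [g gE] := trans1 c; have [h [hE gh]] := pgeP g.
have [k [d [[a [b dE]] e']]] := GE2_St hE 1%g; exists k.
have he : h = (St_to_GL2 k * d)%g.
  by rewrite -e' St_to_GL2_1 mulg1.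
rewrite -gE gh; apply: config1P; rewrite !cpt_act disp_St_val [val (pge hE)]/= he pi_PGL2M point_actM;
  congr point_act; apply/esym.
  by rewrite cpt_base1_0; apply/stab_pinf; rewrite dE mxE.
have [u uE] := det2_unit d; rewrite dE det2E mul0r subr0 in uE.
rewrite cpt_base1_1; apply/(act_class d (class_pzero A) (class_pzero A)); exists b.
  by exists (u * a); ring: uE.
by rewrite dE mat2_col2 col2Z !(mulr1, mulr0, add0r, addr0, mul0r).
Qed.

Lemma St_reaches0 (c : config Y 0) : exists k : St A, config_act (disp k).2 (base0 A) = c.
Proof.
have [g gE] := trans0 c; have [k kE] := St_reaches (config_act g (base1 A)).
by exists k; rewrite -gE -face1_base1 -!face_act kE.
Qed.

(** The displacement of [k] only depends on the image of the base point: this is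
    the content of [disp_stab]. *)
Definition potential (c : config Y 0) : M0 := (disp (sval (cid (St_reaches0 c)))).1.

Lemma potential_disp (k : St A) : potential (config_act (disp k).2 (base0 A)) = (disp k).1.
Proof.
rewrite /potential; case: cid => l /= lE.
have -> : disp k = (disp l * disp (l^-1 * k)%g)%g by rewrite -dispM mulgA mulgV mul1g.
have lk0 : (disp (l^-1 * k)%g).1 = 0.
  apply: disp_stab; rewrite dispM dispV sdM2 config_actM -lE -config_actM sdV2 mulVg.
  exact: config_act1.
by rewrite sdM1 lk0 gact0 addr0.
Qed.

Lemma edge_potential (c : config Y 1) :
  edge c = potential (face 0 c) - potential (face 1 c).
Proof.
have [k <-] := St_reaches c; rewrite !face_act face1_base1 potential_disp.
have u1 : 1 * 1 = 1 :> A by rewrite mulr1.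
have -> : face 0 (base1 A) = config_act (disp (St_w12 1 1)).2 (base0 A).
  apply: cpt_inj => i; rewrite -/(zero0 A) cpt_zero0 cpt_act cpt_base0 disp_St_val.
  apply/esym/(act_class _ (class_pinf A) (class_pzero A)); exists (-1); first exact: is_unitN.
  by rewrite St_w12_GL2 // mat2_col2 col2Z; congr col2; ring.
rewrite -config_actM -sdM2 -dispM potential_disp dispM sdM1 disp_w12 // gact_e.
by rewrite addrAC subrr add0r.
Qed.

(** Edges are differences of potentials, so [p] factors through the boundary. *)
Lemma H1_vanish (m : conf_chain Y 1) : chain_diff m = 0 -> p m = 0.
Proof.
pose Q : {additive conf_chain Y 0 -> M0} := free_lift potential.
have QU c : Q (ccell c) = potential c.
  by rewrite ccellE; exact: etrans (free_liftU _ _ _) (mulr1z _).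
have -> : p m = Q (chain_diff m).
  elim/conf_chain_ind: m => [|x y IHx IHy|c].
  - by rewrite chain_diff0 (raddf0 p) (raddf0 Q).
  - by rewrite chain_diffB (raddfB p) (raddfB Q) /= IHx IHy.
  - by rewrite chain_diff1 (raddfB Q) /= !QU -edge_potential.
by move=> ->; rewrite raddf0.
Qed.

End H1Y.

(** Apply [H1_vanish] to the projection onto the cokernel of the boundary from
    triples to pairs. *)
Lemma Y_exact1 (A : comPzRingType) : universal_for_GE2 A ->
  forall m : conf_chain (Yconf A) 1, chain_diff m = 0 ->
  exists m' : conf_chain (Yconf A) 2, chain_diff m' = m.
Proof.
move=> univ m dm; pose f := chain_hom (Yconf A) 1.
have pJ g x : coker_pi f (gact g x) = @gact _ (coker_gmod f) g (coker_pi f x).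
  by rewrite -coker_act_pi.
pose p : gmod_hom (chain_gmod (Yconf A) 1) (coker_gmod f) := @GmodHom _ _ (coker_gmod f) (coker_pi f) pJ.
apply/(coker_pi_eq0 f m); apply: (@H1_vanish A (coker_gmod f) p _ univ m dm) => x.
by apply/(coker_pi_eq0 f); exists x.
Qed.

(** * The first homology of pairs of points and the square roots of one *)

Section Units.
Variable A : comPzRingType.

(** The unit group, written additively so that it can be the target of additive
    maps; the inverse is part of the data, as for [GL2]. *)
Definition units := {p : A * A | p.1 * p.2 == 1}.
HB.instance Definition _ := SubType.on units.
HB.instance Definition _ := Choice.on units.

Definition uval (u : units) : A := (val u).1.
Definition uinv (u : units) : A := (val u).2.
Lemma uvalK u : uval u * uinv u = 1. Proof. exact/eqP/(valP u). Qed.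
Lemma uinvK u : uinv u * uval u = 1. Proof. by rewrite mulrC uvalK. Qed.

Lemma uval_inj : injective uval.
Proof.
move=> u v e; have eV : uinv u = uinv v.
  by rewrite -[LHS]mulr1 -(uvalK v) -e mulrA uinvK mul1r.
by apply: val_inj; move: e eV; rewrite /uval /uinv; case: (val u) (val v) => [? ?] [? ?] /= -> ->.
Qed.

Fact mk_unit_subproof (a b : A) : a * b = 1 -> (a, b).1 * (a, b).2 == 1.
Proof. by move=> /eqP. Qed.
Definition mk_unit (a b : A) (ab : a * b = 1) : units := exist _ (a, b) (mk_unit_subproof ab).

Fact unit_add_subproof (u v : units) : (uval u * uval v) * (uinv u * uinv v) = 1.
Proof. by rewrite mulrACA !uvalK mulr1. Qed.
Definition unit_add (u v : units) : units := mk_unit (unit_add_subproof u v).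
Definition unit_opp (u : units) : units := mk_unit (uinvK u).
Definition unit_zero : units := mk_unit (mulr1 1).

Fact unit_addA : associative unit_add.
Proof. by move=> u v w; apply: uval_inj; apply: mulrA. Qed.
Fact unit_addC : commutative unit_add.
Proof. by move=> u v; apply: uval_inj; apply: mulrC. Qed.
Fact unit_add0 : left_id unit_zero unit_add.
Proof. by move=> u; apply: uval_inj; apply: mul1r. Qed.
Fact unit_addN : left_inverse unit_zero unit_opp unit_add.
Proof. by move=> u; apply: uval_inj; apply: uinvK. Qed.
HB.instance Definition _ :=
  GRing.isZmodule.Build units unit_addA unit_addC unit_add0 unit_addN.

Lemma uvalD u v : uval (u + v) = uval u * uval v. Proof. by []. Qed.
Lemma uvalN u : uval (- u) = uinv u. Proof. by []. Qed.
Lemma uval0 : uval 0 = 1. Proof. by []. Qed.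
Lemma uval_unit u : is_unit (uval u). Proof. by exists (uinv u); apply: uvalK. Qed.

Lemma unit_ex a : is_unit a -> exists u, uval u = a.
Proof.
by move=> [b ab]; exists (mk_unit ab).
Qed.
End Units.

Section Cocycles.
Variable A : comPzRingType.
Local Notation Y := (Yconf A).
Implicit Types g h : PGE2 A.

Local Notation rmx g := (mx (repr (val g))).

Fact lam_subproof g x : exists u : units A,
  rmx g *m vec (point_act (val g^-1%g) x) = uval u *: vec x.
Proof.
have [a ua e] := act_vec (repr (val g)) (point_act (val g^-1%g) x).
have [u uE] := unit_ex ua; exists u; rewrite uE e reprK PGE2_valV.
by rewrite -point_actM mulgV point_act1.
Qed.
(** The scalar by which the chosen matrix of [g] moves the chosen vector of
    [g^-1 x] to that of [x]. It is a cocycle up to the scalar [cscal], which comes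
    from the choice of matrices. *)
Definition lam g x : units A := sval (cid (lam_subproof g x)).
Lemma lamE g x : rmx g *m vec (point_act (val g^-1%g) x) = uval (lam g x) *: vec x.
Proof. exact: (svalP (cid (lam_subproof g x))). Qed.

Fact udet_subproof g : exists u : units A, uval u = det2 (rmx g).
Proof. exact: unit_ex (det2_unit _). Qed.
Definition udet g : units A := sval (cid (udet_subproof g)).
Lemma udetE g : uval (udet g) = det2 (rmx g).
Proof. exact: (svalP (cid (udet_subproof g))). Qed.

Fact cscal_subproof g h : exists u : units A, rmx g *m rmx h = uval u *: rmx (g * h)%g.
Proof.
have [a ua e] := repr_PGL2 (repr (val g) * repr (val h))%g.
have [u uE] := unit_ex ua; exists u; rewrite uE -mxM e PGE2_valM.
by rewrite pi_PGL2M !reprK.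
Qed.
Definition cscal g h : units A := sval (cid (cscal_subproof g h)).
Lemma cscalE g h : rmx g *m rmx h = uval (cscal g h) *: rmx (g * h)%g.
Proof. exact: (svalP (cid (cscal_subproof g h))). Qed.

Lemma lamM g h x :
  lam (g * h)%g x + cscal g h = lam g x + lam h (point_act (val g^-1%g) x).
Proof.
apply: uval_inj; rewrite !uvalD; apply: (vec_free (x := x)).
rewrite mulrC -[LHS]scalerA -lamE scalemxAl -cscalE -mulmxA.
have -> : point_act (val (g * h)^-1%g) x = point_act (val h^-1%g) (point_act (val g^-1%g) x).
  by rewrite -point_actM !PGE2_valV PGE2_valM invgM.
by rewrite lamE -scalemxAr lamE scalerA mulrC.
Qed.

Lemma udetM g h : udet (g * h)%g + (cscal g h + cscal g h) = udet g + udet h.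
Proof.
apply: uval_inj; rewrite !uvalD !udetE -det2M cscalE det2Z expr2; ring.
Qed.

Definition lam_map : bar (chain_gmod Y 0) 1 -> units A :=
  bar_lift (fun t c => lam (tnth t 0) (cpt c 0)).
(** The isomorphism [H_1(PGE2, Y_1) -> H_1(T) = A^*] for the torus [T] of the
    matrices [diag(u, 1)]. The indeterminacy of [lam] cancels in the difference. *)
Definition phi : bar (chain_gmod Y 1) 1 -> units A :=
  bar_lift (fun t c => lam (tnth t 0) (cpt c 0) - lam (tnth t 0) (cpt c 1)).
(** The character [a / d] of the Borel subgroup, as [a^2 / (a d)]: dividing by the
    determinant cancels the indeterminacy of the square of [lam]. *)
Definition chi : bar (chain_gmod Y 0) 1 -> units A :=
  bar_lift (fun t c => lam (tnth t 0) (cpt c 0) + lam (tnth t 0) (cpt c 0) - udet (tnth t 0)).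

Lemma lam_mapU c g : lam_map (pcell c (tup1 g)) = lam g (cpt c 0).
Proof. exact: bar_liftU. Qed.
Lemma phiU c g : phi (pcell c (tup1 g)) = lam g (cpt c 0) - lam g (cpt c 1).
Proof. exact: bar_liftU. Qed.
Lemma chiU c g : chi (pcell c (tup1 g)) = lam g (cpt c 0) + lam g (cpt c 0) - udet g.
Proof. exact: bar_liftU. Qed.
Lemma lam_mapB (x y : bar _ 1) : lam_map (x - y) = lam_map x - lam_map y. Proof. exact: raddfB. Qed.
Lemma lam_map0 : lam_map 0 = 0. Proof. exact: raddf0. Qed.
Lemma phiB (x y : bar _ 1) : phi (x - y) = phi x - phi y. Proof. exact: raddfB. Qed.
Lemma phiD (x y : bar _ 1) : phi (x + y) = phi x + phi y. Proof. exact: raddfD. Qed.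
Lemma phi0 : phi 0 = 0. Proof. exact: raddf0. Qed.
Lemma chiB (x y : bar _ 1) : chi (x - y) = chi x - chi y. Proof. exact: raddfB. Qed.
Lemma chiD (x y : bar _ 1) : chi (x + y) = chi x + chi y. Proof. exact: raddfD. Qed.
Lemma chi0 : chi 0 = 0. Proof. exact: raddf0. Qed.

Lemma phi_d x : phi (bar_d x) = 0.
Proof.
elim/bar_ind: x => [|x y IHx IHy|c t]; first by rewrite bar_d0 phi0.
  by rewrite bar_dB phiB IHx IHy subrr.
elim/tuple2_ind: t => g h; rewrite pcell_d2 phiD phiB !phiU !cpt_act.
have e i := lamM g h (cpt c i).
have {}e i : lam h (point_act (val g^-1%g) (cpt c i)) =
    lam (g * h)%g (cpt c i) + cscal g h - lam g (cpt c i).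
  by rewrite e addrAC subrr add0r.
rewrite !e; zmodule.
Qed.

Lemma chi_d x : chi (bar_d x) = 0.
Proof.
elim/bar_ind: x => [|x y IHx IHy|c t]; first by rewrite bar_d0 chi0.
  by rewrite bar_dB chiB IHx IHy subrr.
elim/tuple2_ind: t => g h; rewrite pcell_d2 chiD chiB !chiU !cpt_act.
have -> : lam h (point_act (val g^-1%g) (cpt c 0)) =
    lam (g * h)%g (cpt c 0) + cscal g h - lam g (cpt c 0).
  by rewrite lamM addrAC subrr add0r.
have -> : udet (g * h)%g = udet g + udet h - (cscal g h + cscal g h).
  by rewrite -udetM addrK.
zmodule.
Qed.

Lemma phi_d_v (y : D A 1 2) : phi (d_v y) = 0. Proof. exact: phi_d. Qed.
Lemma chi_d_v (y : D A 0 2) : chi (d_v y) = 0. Proof. exact: chi_d. Qed.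

Lemma d_h_pcell k (c : config Y 1) (t : k.-tuple (PGE2 A)) :
  d_h (pcell c t : D A 1 k) = pcell (face 0 c) t - pcell (face 1 c) t :> D A 0 k.
Proof.
rewrite !pcellE; apply: etrans (bar_mapU _ _ _ _) _.
have -> : map_tuple idfun t = t by apply: val_inj; rewrite /= map_id.
pose U : {additive chain_gmod Y 0 -> bar (chain_gmod Y 0) k} := mkmalgU t.
have e : E_diff A 0 << c >> = << face 0 c >> - << face 1 c >> :> chain_gmod Y 0.
  by have := chain_diff1 c; rewrite !ccellE.
exact: etrans (congr1 U e) (raddfB U _ _).
Qed.

(** The cocycle [phi] is a difference of values at the two endpoints, so it
    factors through [d_h]. This makes it vanish on what comes from the last
    column. *)
Lemma phi_d_h (x : D A 1 1) : phi x = - lam_map (d_h x).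
Proof.
elim/bar_ind: x => [|x y IHx IHy|c t].
- by rewrite phi0 d_h0 lam_map0 oppr0.
- by rewrite phiB IHx IHy d_hB lam_mapB opprB opprK addrC.
elim/tuple1_ind: t => g; rewrite phiU d_h_pcell lam_mapB !lam_mapU !cpt_face opprB.
by congr (lam g (cpt c _) - lam g (cpt c _)); apply: val_inj.
Qed.

End Cocycles.

Section Torus.
Variable A : comPzRingType.
Local Notation Y := (Yconf A).
Local Notation T := (Algebra.to_multiplicative (units A)).
Implicit Types (g : PGE2 A) (u v : units A).

Fact tdiag_subproof1 u : mat2 (uval u) 0 0 1 *m mat2 (uinv u) 0 0 1 = 1%:M.
Proof. by rewrite mat2M mat2_1 uvalK; congr mat2; ring. Qed.
Fact tdiag_subproof2 u : mat2 (uinv u) 0 0 1 *m mat2 (uval u) 0 0 1 = 1%:M.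
Proof. by rewrite mat2M mat2_1 uinvK; congr mat2; ring. Qed.
Definition tmx u : GL2 A := mkGL2 (tdiag_subproof1 u) (tdiag_subproof2 u).
Lemma tmxE u : mx (tmx u) = mat2 (uval u) 0 0 1. Proof. by []. Qed.
Definition tdiag (u : T) : PGE2 A := pge (GE2_diag (tmxE u)).

Lemma tdiagM (u v : T) : tdiag (u * v)%g = (tdiag u * tdiag v)%g.
Proof.
apply: val_inj; rewrite PGE2_valM /= -pi_PGL2M; congr (\pi_(PGL2 A) _); apply: mx_inj.
by rewrite mxM !tmxE mat2M uvalD; congr mat2; ring.
Qed.

Lemma tdiag1 : tdiag 0 = 1%g.
Proof. by apply: val_inj; congr (\pi_(PGL2 A) _); apply: mx_inj; rewrite tmxE mx1 mat2_1. Qed.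

Lemma tdiag_pinf u : point_act (val (tdiag u)) (pinf A) = pinf A.
Proof. by apply/stab_pinf; rewrite tmxE mxE. Qed.

Lemma tdiag_pzero u : point_act (val (tdiag u)) (pzero A) = pzero A.
Proof.
apply/(act_class (tmx u) (class_pzero A) (class_pzero A)); exists 1; first exact: is_unit1.
by rewrite tmxE mat2_col2 col2Z; congr col2; ring.
Qed.

Lemma tdiag_base0 u : config_act (tdiag u) (base0 A) = base0 A.
Proof. by apply: cpt_inj => i; rewrite cpt_act cpt_base0 tdiag_pinf. Qed.
Lemma tdiag_zero0 u : config_act (tdiag u) (zero0 A) = zero0 A.
Proof. by apply: cpt_inj => i; rewrite cpt_act cpt_zero0 tdiag_pzero. Qed.
Lemma tdiag_base1 u : config_act (tdiag u) (base1 A) = base1 A.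
Proof.
by apply: config1P; rewrite cpt_act ?cpt_base1_0 ?cpt_base1_1 ?tdiag_pinf ?tdiag_pzero.
Qed.

Lemma tdiagV u : (tdiag u)^-1%g = tdiag (- u).
Proof. by apply: mulg1_eq; rewrite -tdiagM -tdiag1; congr tdiag; apply: subrr. Qed.

Lemma tdiag_inj : injective tdiag.
Proof.
move=> u v /(congr1 val) /= /eqP/PGL2P[a _]; rewrite !tmxE mat2Z => /mat2_inj[e _ _].
by rewrite mulr1 => a1; apply: uval_inj; rewrite e -a1 mul1r.
Qed.

Lemma stab_tdiag g : config_act g (base1 A) = base1 A -> exists u : T, tdiag u = g.
Proof.
have [h [hE ->]] := pgeP g => e.
have e_i i : point_act (\pi_(PGL2 A) h) (cpt (base1 A) i) = cpt (base1 A) i.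
  by have := cpt_act (base1 A) (pge hE) i; rewrite e => /esym.
have := e_i 0; rewrite cpt_base1_0 => /stab_pinf h10.
have := e_i 1; rewrite cpt_base1_1 => /stab_pzero h01.
have [k kE] := det2_unit h; rewrite /det2 h10 h01 mul0r subr0 in kE.
set a := mx h 0 0 in kE; set d := mx h 1 1 in kE.
have [u uE] : exists u, uval u = a * (a * k).
  apply: unit_ex; exists (d * (d * k)); ring: kE.
exists u; apply: val_inj; apply/eqP/PGL2P; exists d; first by exists (a * k); ring: kE.
by rewrite tmxE uE mat2Z [LHS]mat2_eta h10 h01 -/a -/d; congr mat2; ring: kE.
Qed.

(** The chosen matrix of [diag(u, 1)] is [k * diag(u, 1)] for some unit [k], which
    both [phi] and [chi] eliminate. *)
Lemma lam_diag u : exists k, [/\ is_unit k,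
  uval (lam (tdiag u) (pinf A)) = k * uval u, uval (lam (tdiag u) (pzero A)) = k &
  uval (udet (tdiag u)) = k ^+ 2 * uval u].
Proof.
have [k' [k kk'] kE] := repr_PGL2 (tmx u).
have hE : mx (repr (val (tdiag u))) = k *: mat2 (uval u) 0 0 1.
  by rewrite -tmxE kE scalerA mulrC kk' scale1r.
exists k; split; first by exists k'; rewrite mulrC.
- have := lamE (tdiag u) (pinf A); rewrite tdiagV tdiag_pinf hE.
  have [a [a' aa'] aE] := vec_class (class_pinf A).
  have -> : vec (pinf A) = a' *: col2 1 0 by rewrite aE scalerA mulrC aa' scale1r.
  rewrite mat2Z !col2Z mat2_col2 => /col2_inj[e _].
  move: e; set l := uval (lam _ _) => e; have -> : l = l * (a' * 1) * a by ring: aa'.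
  by rewrite -e; ring: aa'.
- have := lamE (tdiag u) (pzero A); rewrite tdiagV tdiag_pzero hE.
  have [a [a' aa'] aE] := vec_class (class_pzero A).
  have -> : vec (pzero A) = a' *: col2 0 1 by rewrite aE scalerA mulrC aa' scale1r.
  rewrite mat2Z !col2Z mat2_col2 => /col2_inj[_ e].
  move: e; set l := uval (lam _ _) => e; have -> : l = l * (a' * 1) * a by ring: aa'.
  by rewrite -e; ring: aa'.
- by rewrite udetE hE det2Z det2E; ring.
Qed.

Lemma phi_tdiag u : phi (pcell (base1 A) (tup1 (tdiag u))) = u.
Proof.
rewrite phiU cpt_base1_0 cpt_base1_1; have [k [uk e1 e2 _]] := lam_diag u.
apply/eqP; rewrite subr_eq; apply/eqP/uval_inj.
by rewrite uvalD e1 e2 mulrC.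
Qed.

Lemma chi_base0 u : chi (pcell (base0 A) (tup1 (tdiag u))) = u.
Proof.
rewrite chiU cpt_base0; have [k [uk e1 _ e3]] := lam_diag u.
by apply/eqP; rewrite subr_eq; apply/eqP/uval_inj; rewrite !uvalD e1 e3; ring.
Qed.

Lemma chi_zero0 u : chi (pcell (zero0 A) (tup1 (tdiag u))) = - u.
Proof.
rewrite chiU cpt_zero0; have [k [uk _ e2 e3]] := lam_diag u.
apply/eqP; rewrite subr_eq; apply/eqP/uval_inj.
by rewrite !uvalD uvalN e2 e3; have := uvalK u => e; ring: e.
Qed.

(** Modulo boundaries, sums of one-cells can be collected to a single cell. *)
Lemma bar_triv1 (S : groupType) (y : bar (triv_int S) 1) :
  exists a (z : bar (triv_int S) 2), y = tcell (tup1 a) + bar_d z.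
Proof.
elim/bar_triv_ind: y => [|x y [a [z ->]] [b [z' ->]]|t].
- exists 1%g, (- tcell (tup2 1%g 1%g)); rewrite bar_dN tcell_d2 mulg1; zmodule.
- exists (a / b)%g, (z - z' - tcell (tup2 (a / b)%g b)).
  rewrite !bar_dB tcell_d2 mulgVK; zmodule.
- by elim/tuple1_ind: t => a; exists a, 0; rewrite bar_d0 addr0.
Qed.

Lemma H1_Y1 (x : bar (chain_gmod Y 1) 1) : bar_d x = 0 ->
  exists u (z : bar (chain_gmod Y 1) 2), x = pcell (base1 A) (tup1 (tdiag u)) + bar_d z.
Proof.
move=> dx; have [y [z ->]] := shapiro_surj1 (@trans1 A) stab_tdiag dx.
have [u [w ->]] := bar_triv1 y; exists u, (shapiro (base1 A) tdiag w + z).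
rewrite bar_dD -(shapiro_d tdiagM tdiag_base1) -shapiroU1 addrA; congr (_ + _).
exact: raddfD.
Qed.

(** By Shapiro's lemma [H_1(PGE2, Y_1)] is a quotient of the torus, on which [phi] is
    the identity. *)
Lemma phi_detects (x : bar (chain_gmod Y 1) 1) : bar_d x = 0 -> phi x = 0 ->
  exists z : bar (chain_gmod Y 1) 2, bar_d z = x.
Proof.
move=> dx; have [u [z ->]] := H1_Y1 dx; rewrite phiD phi_d addr0 phi_tdiag => ->.
exists (pcell (base1 A) (tup2 1%g 1%g) + z).
by rewrite bar_dD pcell_d2_1 tdiag1.
Qed.

Let w : PGE2 A := pge (GE2_swap A).

Lemma swap_base0 : config_act w^-1%g (zero0 A) = base0 A.
Proof.
have -> : zero0 A = config_act w (base0 A); last by rewrite -config_actM mulVg config_act1.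
apply: cpt_inj => i; rewrite cpt_act cpt_zero0 cpt_base0.
apply/esym/(act_class (swap A) (class_pinf A) (class_pzero A)); exists 1; first exact: is_unit1.
by rewrite [mx (swap A)]/mx /= mat2_col2 col2Z; congr col2; ring.
Qed.

Lemma swap_tdiag u : (tdiag u * w)%g = (w * tdiag (- u))%g.
Proof.
apply: val_inj; rewrite !PGE2_valM /= -!pi_PGL2M; apply/esym/eqP/PGL2P.
exists (uval u); first exact: uval_unit.
rewrite !mxM !tmxE [mx (swap A)]/mx /= !mat2M mat2Z uvalN; have := uvalK u => e.
by congr mat2; ring: e.
Qed.

Definition mu2_units (a : mu2 A) : units A.
Proof. by apply: (@mk_unit A (val a) (val a)); rewrite -expr2; apply/eqP/(valP a). Defined.

Lemma uval_mu2 a : uval (mu2_units a) = val a. Proof. by []. Qed.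

Lemma mu2_tdiag a : mu2_PGE2 a = tdiag (mu2_units a).
Proof. by apply: val_inj; congr (\pi_(PGL2 A) _); apply: mx_inj. Qed.

Lemma mu2_unitsN a : - mu2_units a = mu2_units a.
Proof. exact: uval_inj. Qed.

Definition mu2_cell (a : mu2 A) : D A 1 1 := pcell (base1 A) (tup1 (tdiag (mu2_units a))).

Lemma mu2_graphE a (h : E2 A 1 1) : mu2_graph a h <-> E2_class (mu2_cell a) h.
Proof. by rewrite /mu2_graph /mu2_cell pcellE -mu2_tdiag. Qed.

Lemma d_v_tcell u : d_v (pcell (base1 A) (tup1 (tdiag u)) : D A 1 1) = 0.
Proof. by rewrite /d_v [bar_d _]pcell_d1 tdiagV tdiag_base1 subrr. Qed.

Lemma d_h_tcell k (t : k.-tuple (PGE2 A)) : d_h (pcell (base1 A) t : D A 1 k) =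
  pcell (zero0 A) t - pcell (base0 A) t :> D A 0 k.
Proof. by rewrite d_h_pcell face1_base1. Qed.

(** Since [a] is its own inverse, [diag(a, 1)] commutes with the swap modulo scalars,
    and the swap exchanges the two endpoints of the base edge. *)
Lemma mu2_cell_bound a : exists y : bar (chain_gmod Y 0) 2,
  pcell (zero0 A) (tup1 (tdiag (mu2_units a)))
    - pcell (base0 A) (tup1 (tdiag (mu2_units a))) = bar_d y.
Proof.
pose g := tdiag (mu2_units a).
have gz : config_act g^-1%g (zero0 A) = zero0 A by rewrite /g tdiagV tdiag_zero0.
have gw : (g * w)%g = (w * g)%g by rewrite /g swap_tdiag mu2_unitsN.
exists (pcell (zero0 A) (tup2 g w) - pcell (zero0 A) (tup2 w g)).
exact: pcell_conj gz swap_base0 gw.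
Qed.

Lemma mu2_graph_ex a : exists h : E2 A 1 1, mu2_graph a h.
Proof.
have [y yE] := mu2_cell_bound a.
have {}yE : d_h (mu2_cell a) = d_v (y : D A 0 2) by rewrite d_h_tcell; apply: yE.
have [h hE] := @E2_class_exS A 0 1 (mu2_cell a) y (d_v_tcell _) yE.
by exists h; apply/mu2_graphE.
Qed.

Lemma mu2_graph_uniq a (h : E2 A 1 1) h' : mu2_graph a h -> mu2_graph a h' -> h = h'.
Proof.
move=> /mu2_graphE ah /mu2_graphE ah'; apply/eqP; rewrite -subr_eq0; apply/eqP.
by apply: (E2_class_d_v (y := 0) (E2_classB ah ah')); rewrite subrr d_v0.
Qed.

Lemma pcell_sub3 (V : zmodType) (x y z : V) : x - y - z = - (z - x + y).
Proof. by rewrite opprD opprB addrAC. Qed.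

Lemma mu2_graphM a b (h : E2 A 1 1) h' : mu2_graph a h -> mu2_graph b h' ->
  mu2_graph (a * b)%g (h + h').
Proof.
move=> /mu2_graphE ah /mu2_graphE bh; have [k ke] := mu2_graph_ex (a * b)%g.
suff -> : h + h' = k by [].
move/mu2_graphE: ke => abk.
pose ta := tdiag (mu2_units a); pose tb := tdiag (mu2_units b).
pose y : D A 1 2 := - pcell (base1 A) (tup2 ta tb).
have yE : mu2_cell (a * b)%g - mu2_cell a - mu2_cell b = d_v y.
  have ab : mu2_units (a * b)%g = mu2_units a + mu2_units b by apply: uval_inj.
  have tab : tdiag (mu2_units (a * b)%g) = (ta * tb)%g by rewrite ab tdiagM.
  have taV : config_act ta^-1%g (base1 A) = base1 A by rewrite /ta tdiagV tdiag_base1.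
  by rewrite /y d_vN /d_v [bar_d _]pcell_d2 taV /mu2_cell tab pcell_sub3.
have /eqP := E2_class_d_v (E2_classB (E2_classB abk ah) bh) yE.
by rewrite -addrA -opprD subr_eq0 => /eqP ->.
Qed.

Lemma mu2_graph_inj a : mu2_graph a (0 : E2 A 1 1) -> a = 1%g.
Proof.
move=> /mu2_graphE/E2_class0[y [y' [dy' e]]].
have : phi (mu2_cell a) = 0.
  by rewrite e phiD phi_d_v add0r phi_d_h d_hh0 lam_map0 oppr0.
rewrite phi_tdiag => /(congr1 (@uval A)); rewrite uval_mu2 uval0 => a1.
by apply: val_inj.
Qed.

(** The two endpoints carry inverse characters, so [chi] takes the horizontal
    boundary of the class of [u] to [u^-2]; for a class that survives to the
    second page this is 1. *)
Lemma mu2_graph_surj (h : E2 A 1 1) : exists a, mu2_graph a h.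
Proof.
have [x xh] := E2_class_surj h.
have dx : bar_d x = 0 by apply: E2_class_out xh.
have [y xy] := E2_class_dh xh.
have [u [z xE0]] := H1_Y1 dx.
have xE : x = (pcell (base1 A) (tup1 (tdiag u)) : D A 1 1) + d_v (z : D A 1 2) by exact: xE0.
have u2 : u + u = 0.
  have : chi (d_h x) = 0 by rewrite xy chi_d_v.
  rewrite xE d_hD d_hv d_h_tcell chiD chi_d_v addr0.
  by rewrite chiB chi_base0 chi_zero0 -opprD => /eqP; rewrite oppr_eq0 => /eqP.
have aP : uval u ^+ 2 == 1.
  by move/(congr1 (@uval A)): u2; rewrite uvalD uval0 expr2 => ->.
pose a : mu2 A := exist _ (uval u) aP; exists a.
have [k ka] := mu2_graph_ex a; suff -> : h = k by [].
move/mu2_graphE: ka => ka.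
have aE : mu2_units a = u by apply: uval_inj.
have e : x - mu2_cell a = d_v (z : D A 1 2) by rewrite xE /mu2_cell aE addrAC subrr add0r.
by have /eqP := E2_class_d_v (E2_classB xh ka) e; rewrite subr_eq0 => /eqP.
Qed.

End Torus.

(** * Symmetric cocycles *)

Section TwoCocycle.
Variables (V M : zmodType) (B : V -> V -> M).
Hypothesis cocycle : forall a b c, B a b + B (a + b) c = B b c + B a (b + c).

Let br a b := B a b - B b a.

(** The antisymmetrisation of a two-cocycle is the commutator pairing of the
    corresponding central extension, which is bilinear. *)
Lemma cocycle_bracketD a b c : br (a + b) c = br a c + br b c.
Proof.
have e1 := cocycle a b c; have e2 := cocycle a c b; have e3 := cocycle c a b.
have {}e1 : B (a + b) c = B b c + B a (b + c) - B a b by rewrite -e1 addrAC subrr add0r.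
have {}e3 : B c (a + b) = B c a + B (c + a) b - B a b by rewrite e3 addrAC subrr add0r.
have {}e2 : B a (b + c) = B a c + B (c + a) b - B c b.
  by rewrite (addrC b c) (addrC c a) e2 addrAC subrr add0r.
rewrite /br e1 e2 e3; zmodule.
Qed.

Lemma cocycle_bracketNN a b : br (- a) (- b) = br a b.
Proof.
have brC x y : br x y = - br y x by rewrite /br opprB.
have br0 y : br 0 y = 0.
  by have := cocycle_bracketD 0 0 y; rewrite addr0 => /eqP; rewrite -subr_eq0 opprD addrA subrr sub0r oppr_eq0 => /eqP.
have brN x y : br (- x) y = - br x y.
  by apply/eqP; rewrite -addr_eq0 -cocycle_bracketD addNr br0.
by rewrite brN brC brN opprK -brC.
Qed.
End TwoCocycle.

Record sym_cocycle (V M : zmodType) := SymCocycle {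
  sc_fun :> V -> V -> M;
  sc_sym : forall a b, sc_fun a b = sc_fun b a;
  sc_cocycle : forall a b c, sc_fun a b + sc_fun (a + b) c = sc_fun b c + sc_fun a (b + c) }.

Section TwistedSum.
Variables (V M : zmodType) (f : sym_cocycle V M).

(** The abelian extension of [V] by [M] classified by [f]. *)
Definition twisted : Type := (M * V)%type.
HB.instance Definition _ := Choice.on twisted.

Definition tw_add (x y : twisted) : twisted := (x.1 + y.1 + f x.2 y.2, x.2 + y.2).
Definition tw_zero : twisted := (- f 0 0, 0).
Definition tw_opp (x : twisted) : twisted := (- x.1 - f (- x.2) x.2 - f 0 0, - x.2).

Lemma sc_f0 a : f 0 a = f 0 0.
Proof. by have := sc_cocycle f 0 0 a; rewrite !add0r => /addIr ->. Qed.

Fact tw_addA : associative tw_add.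
Proof.
move=> [m a] [n b] [k c]; rewrite /tw_add /=; congr (_, _); last exact: addrA.
have e : f b c = f a b + f (a + b) c - f a (b + c) by rewrite sc_cocycle addrK.
rewrite e; zmodule.
Qed.
Fact tw_addC : commutative tw_add.
Proof. by move=> [m a] [n b]; rewrite /tw_add /= sc_sym (addrC n) (addrC b). Qed.
Fact tw_add0 : left_id tw_zero tw_add.
Proof. by move=> [m a]; rewrite /tw_add /= add0r sc_f0; congr (_, _); zmodule. Qed.
Fact tw_addN : left_inverse tw_zero tw_opp tw_add.
Proof. by move=> [m a]; rewrite /tw_add /tw_zero /= addNr; congr (_, _); zmodule. Qed.
HB.instance Definition _ :=
  GRing.isZmodule.Build twisted tw_addA tw_addC tw_add0 tw_addN.

Definition tw_inj (m : M) : twisted := (m - f 0 0, 0).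
Fact tw_inj_additive : zmod_morphism tw_inj.
Proof.
move=> m n; apply/eqP; rewrite -subr_eq; apply/eqP.
rewrite opprK -[LHS]/(tw_add _ _) /tw_add /tw_inj /= addr0; congr (_, _); zmodule.
Qed.
HB.instance Definition _ := GRing.isZmodMorphism.Build M twisted tw_inj tw_inj_additive.

Definition tw_sect (a : V) : twisted := (0, a).

Lemma tw_sectD a b : tw_sect a + tw_sect b = tw_inj (f a b) + tw_sect (a + b).
Proof.
rewrite -[LHS]/(tw_add _ _) -[RHS]/(tw_add _ _) /tw_add /= sc_f0; congr (_, _); last first.
  by rewrite add0r.
zmodule.
Qed.

Lemma tw_inj_eq0 m : tw_inj m = 0 -> m = 0.
Proof. by move=> [] /eqP; rewrite subr_eq addNr => /eqP. Qed.

Local Notation T := (Algebra.to_multiplicative V).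

(** The extension [twisted] is abelian, so the map from the free abelian group on [V]
    to it that sends the generator of [a] to [(0, a)] makes sense; the image of the
    boundary of a chain is the value of the cocycle on this chain. *)
Lemma sym_cocycle_cycles (F : {additive bar (triv_int T) 2 -> M}) (y : bar (triv_int T) 2) :
  (forall a b : V, F (tcell (tup2 (a : T) (b : T))) = f a b) -> bar_d y = 0 -> F y = 0.
Proof.
move=> FU dy; pose s : {additive bar (triv_int T) 1 -> twisted} :=
  free_lift (fun t : 1.-tuple T => tw_sect (tnth t 0)).
have sU a : s (tcell (tup1 a)) = tw_sect a.
  by rewrite tcellE; exact: etrans (free_liftU _ _ _) (mulr1z _).
have sd : s (bar_d y) = tw_inj (F y).
  elim/bar_triv_ind: {dy} y => [|x y IHx IHy|t].
  - by rewrite bar_d0 (raddf0 s) (raddf0 F) (raddf0 tw_inj).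
  - by rewrite bar_dB (raddfB s) (raddfB F) (raddfB tw_inj) /= IHx IHy.
  elim/tuple2_ind: t => a b; rewrite tcell_d2 (raddfD s) (raddfB s) /= !sU FU.
  apply/eqP; rewrite addrAC subr_eq addrC; apply/eqP; exact: tw_sectD.
by apply: tw_inj_eq0; rewrite -sd dy (raddf0 s).
Qed.
End TwistedSum.

Section Conjugation.
Variables (G : groupType) (X : gconf G) (n : nat).
Implicit Type c : config X n.

(** The homotopy between the identity and the conjugation by [w], in degree 2. *)
Lemma pcell_conj2 c c' (g h w g' h' : G) : config_act g^-1%g c = c ->
    config_act w^-1%g c = c' -> (g * w)%g = (w * g')%g -> (h * w)%g = (w * h')%g ->
  bar_d (pcell c (tup3 w g' h') - pcell c (tup3 g w h') + pcell c (tup3 g h w)) =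
  pcell c' (tup2 g' h') - pcell c (tup2 g h)
   + (pcell c (tup2 w (g' * h')%g) - pcell c (tup2 (g * h)%g w)
   + (pcell c (tup2 g w) + pcell c (tup2 h w) - (pcell c (tup2 w g') + pcell c (tup2 w h')))).
Proof.
move=> gc <- gw hw; rewrite bar_dD bar_dB !pcell_d3 gc.
set x := pcell c (tup2 (g * w)%g h'); set y := pcell c (tup2 g (w * h')%g).
have -> : pcell c (tup2 (w * g')%g h') = x by rewrite /x gw.
have -> : pcell c (tup2 g (h * w)%g) = y by rewrite /y hw.
zmodule.
Qed.
End Conjugation.

(** * Second homology: the two inclusions of the torus agree *)

Section TorusH2.
Variable A : comPzRingType.
Local Notation Y := (Yconf A).
Local Notation T := (Algebra.to_multiplicative (units A)).
Implicit Types a b c : units A.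

Section Quotient.
Variables (N : zmodType) (pr : {additive bar (chain_gmod Y 0) 2 -> N}).
Hypothesis pr_d : forall z, pr (bar_d z) = 0.

Let B (p : config Y 0) a b : N := pr (pcell p (tup2 (tdiag a) (tdiag b))).

Let tdiagD a b : (tdiag a * tdiag b)%g = tdiag (a + b).
Proof. exact: esym (tdiagM a b). Qed.

Let B_cocycle p : (forall u, config_act (tdiag u) p = p) ->
  forall a b c, B p a b + B p (a + b) c = B p b c + B p a (b + c).
Proof.
move=> tp a b c; have := pr_d (pcell p (tup3 (tdiag a) (tdiag b) (tdiag c))).
rewrite pcell_d3 tdiagV tp !tdiagD (raddfB pr) (raddfD pr) (raddfB pr) /=.
rewrite -/(B p b c) -/(B p (a + b) c) -/(B p a (b + c)) -/(B p a b).
move=> /eqP; rewrite subr_eq0 => /eqP <-; zmodule.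
Qed.

Let z0 := zero0 A.
Let p0 := base0 A.
Let w : PGE2 A := pge (GE2_swap A).

(* The correction term of the conjugation homotopy; what matters about it is that
   it is symmetric in [a] and [b]. *)
Let S a b : N :=
  pr (pcell z0 (tup2 w (tdiag (- (a + b))))) - pr (pcell z0 (tup2 (tdiag (a + b)) w))
  + (pr (pcell z0 (tup2 (tdiag a) w)) + pr (pcell z0 (tup2 (tdiag b) w))
  - (pr (pcell z0 (tup2 w (tdiag (- a)))) + pr (pcell z0 (tup2 w (tdiag (- b)))))).

Let S_sym a b : S a b = S b a.
Proof. by rewrite /S (addrC a b) (addrC (pr (pcell z0 (tup2 (tdiag a) w)))) (addrC (pr (pcell z0 (tup2 w (tdiag (- a)))))). Qed.

Let B_conj a b : B z0 a b = B p0 (- a) (- b) + S a b.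
Proof.
have ta : config_act (tdiag a)^-1%g z0 = z0 by rewrite tdiagV tdiag_zero0.
have := pcell_conj2 ta (swap_base0 A) (swap_tdiag a) (swap_tdiag b) => /(congr1 pr).
rewrite pr_d !tdiagD -opprD !(raddfD pr, raddfN pr) /=.
rewrite -/w -/(B p0 (- a) (- b)) -/(B z0 a b) -/(S a b) addrAC => /esym/eqP.
by rewrite subr_eq0 => /eqP.
Qed.

Let f_sym a b : B z0 a b - B p0 a b = B z0 b a - B p0 b a.
Proof.
have p_cocycle := B_cocycle (@tdiag_base0 A).
have := cocycle_bracketNN p_cocycle a b.
rewrite (B_conj a b) (B_conj b a) (S_sym b a).
move=> e; apply/eqP; rewrite subr_eq -addrA; apply/eqP.
have -> : B p0 (- a) (- b) = B p0 (- b) (- a) + (B p0 a b - B p0 b a).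
  by rewrite -e addrC subrK.
zmodule.
Qed.

Let f_cocycle a b c :
  B z0 a b - B p0 a b + (B z0 (a + b) c - B p0 (a + b) c) =
  B z0 b c - B p0 b c + (B z0 a (b + c) - B p0 a (b + c)).
Proof.
have e1 := B_cocycle (@tdiag_base0 A) a b c; have e2 := B_cocycle (@tdiag_zero0 A) a b c.
by rewrite addrACA -opprD e1 e2 opprD addrACA.
Qed.

(** By Shapiro's lemma the cycle comes from the torus, where its image is the
    difference of the cocycles [B z0] and [B p0]. Conjugation by the swap identifies
    [B z0 a b] with [B p0 (- a) (- b)] up to a symmetric term, and the antisymmetric
    part of a cocycle is bilinear, hence unchanged when both arguments are
    negated. So the difference is symmetric and vanishes on cycles. *)
Lemma pr_d_h_cycle (y : D A 1 2) : d_v y = 0 -> pr (d_h y) = 0.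
Proof.
move=> dy; have [x [z [dx yE]]] :=
  shapiro_surj2 (@trans1 A) (@tdiagM A) (@tdiag_inj A) (@stab_tdiag A) dy.
pose D12 : D A 1 2 := shapiro (base1 A) (@tdiag A) x.
have -> : d_h y = d_h D12 + d_v (d_h (z : D A 1 3)).
  by rewrite -d_hv -d_hD; congr d_h; apply: yE.
have pr_dv (u : D A 0 3) : pr (d_v u) = 0 by apply: pr_d.
rewrite (raddfD pr) /= pr_dv addr0.
pose F : {additive bar (triv_int T) 2 -> N} :=
  pr \o (@d_h A 0 2 \o @shapiro (PGE2 A) T Y 1 (base1 A) (@tdiag A) 2).
apply: (@sym_cocycle_cycles _ _ (SymCocycle f_sym f_cocycle) F x _ dx) => a b.
have e : d_h (shapiro (base1 A) (@tdiag A) (tcell (tup2 (a : T) (b : T))) : D A 1 2) =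
    pcell z0 (tup2 (tdiag a) (tdiag b)) - pcell p0 (tup2 (tdiag a) (tdiag b)).
  by rewrite shapiroU2; apply: d_h_tcell.
exact: etrans (congr1 pr e) (raddfB pr _ _).
Qed.
End Quotient.

(** The differential [d^1] from [E^1_(1,2)] to [E^1_(0,2)] is therefore zero. *)
Lemma d_h_cycle_bound (y : D A 1 2) : d_v y = 0 -> exists z : D A 0 3, d_v z = d_h y.
Proof.
move=> dy; pose f : {additive bar (chain_gmod Y 0) 3 -> bar (chain_gmod Y 0) 2} :=
  @bar_d _ (chain_gmod Y 0) 2.
apply/(coker_pi_eq0 f (d_h y)); apply: pr_d_h_cycle dy => z.
by apply/(coker_pi_eq0 f); exists z.
Qed.

End TorusH2.

(** * The corner term and the Borel subgroup *)

Section Borel.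
Variable A : comPzRingType.
Local Notation Y := (Yconf A).
Local Notation PB := (PB2 A).

Lemma PB2_PGE2M (a b : PB) : PB2_PGE2 (a * b)%g = (PB2_PGE2 a * PB2_PGE2 b)%g.
Proof. exact: val_inj. Qed.

Lemma PB2_PGE2_inj : injective (@PB2_PGE2 A).
Proof. by move=> a b /(congr1 val) /= e; apply: val_inj. Qed.

Lemma PB2_base0 (a : PB) : config_act (PB2_PGE2 a) (base0 A) = base0 A.
Proof.
have := valP a; rewrite unfold_in => /asboolP[h hT hE].
exact: (@act_base0_upper A (PB2_PGE2 a) h (esym hE) hT).
Qed.

Lemma stab_PB2 (g : PGE2 A) : config_act g (base0 A) = base0 A -> exists a, PB2_PGE2 a = g.
Proof.
have [h [hE ->]] := pgeP g => e.
have h10 : mx h 1 0 = 0.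
  by apply/stab_pinf; have := cpt_act (base0 A) (pge hE) 0; rewrite e cpt_base0 => /esym.
have hB : \pi_(PGL2 A) h \in @in_PB2 A by rewrite unfold_in; apply/asboolP; exists h.
by exists (exist _ (\pi_(PGL2 A) h) hB); apply: val_inj.
Qed.

Definition borel_chain k (x : bar (triv_int PB) k) : D A 0 k := shapiro (base0 A) (@PB2_PGE2 A) x.

Lemma borel_chain_d (x : bar (triv_int PB) 3) : borel_chain (bar_d x) = d_v (borel_chain x).
Proof. exact: (shapiro_d PB2_PGE2M PB2_base0). Qed.

Lemma borel_chain_cycle (x : bar (triv_int PB) 2) : bar_d x = 0 -> d_v (borel_chain x) = 0.
Proof.
move=> dx; have := shapiro_d PB2_PGE2M PB2_base0 x; rewrite dx => e.
apply: etrans (esym e) _; exact: raddf0.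
Qed.

Lemma borel_chainB k (x y : bar (triv_int PB) k) : borel_chain (x - y) = borel_chain x - borel_chain y.
Proof. exact: raddfB. Qed.

Lemma PB2_graphE (a : H_PB2 A 2) (h : E2 A 0 2) :
  PB2_graph a h <-> exists2 x, has_class x a & E2_class (borel_chain x) h.
Proof. by []. Qed.

Lemma PB2_graph_ex (a : H_PB2 A 2) : exists h, PB2_graph a h.
Proof.
have [x xa] := has_class_surj a; have dx : bar_d x = 0 by apply: has_class_cycle xa.
have [h xh] := E2_class_ex0 (borel_chain_cycle dx : bar_out (E A 0) 2 (borel_chain x) = 0).
by exists h, x.
Qed.

Lemma PB2_graphB (a a' : H_PB2 A 2) h h' : PB2_graph a h -> PB2_graph a' h' ->
  PB2_graph (a - a') (h - h').
Proof.
move=> /PB2_graphE[x xa xh] /PB2_graphE[y ya yh]; apply/PB2_graphE.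
exists (x - y); first exact: (has_classB xa ya).
by rewrite borel_chainB; apply: E2_classB.
Qed.

Lemma PB2_class0P (x : bar (triv_int PB) 2) :
  has_class x (0 : H_PB2 A 2) <-> bar_d x = 0 /\ exists y, bar_d y = x.
Proof. exact: has_class0P. Qed.

Lemma PB2_graph0 h : PB2_graph (0 : H_PB2 A 2) h -> h = 0.
Proof.
move=> /PB2_graphE[x /PB2_class0P[_ [y yx]] xh].
by apply: (E2_class_d_v (y := borel_chain y) xh); rewrite -borel_chain_d yx.
Qed.

Lemma PB2_graph_inj (a : H_PB2 A 2) : PB2_graph a 0 -> a = 0.
Proof.
move=> /PB2_graphE[x xa /E2_class0[y [y' [dy' e]]]].
have [z zE] := d_h_cycle_bound dy'.
have e' : borel_chain x = d_v (y + z) by rewrite d_vD zE.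
have [v xE] := shapiro_inj2 (@trans0 A) PB2_PGE2M PB2_PGE2_inj PB2_base0 stab_PB2 e'.
apply: has_class_uniq xa _; apply/PB2_class0P; split; last by exists v.
by rewrite xE bar_dd.
Qed.

Lemma PB2_graph_surj h : exists a : H_PB2 A 2, PB2_graph a h.
Proof.
have [c ch] := E2_class_surj h; have dc : d_v c = 0 by apply: E2_class_out ch.
have [x [z [dx cE]]] := shapiro_surj2 (@trans0 A) PB2_PGE2M PB2_PGE2_inj stab_PB2 dc.
have [a xa] : exists a : H_PB2 A 2, has_class x a by apply: has_class_ex.
exists a; apply/PB2_graphE; exists x => //.
have [k xk] := E2_class_ex0 (borel_chain_cycle dx : bar_out (E A 0) 2 (borel_chain x) = 0).
have e : c - borel_chain x = d_v (z : D A 0 3).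
  by apply/eqP; rewrite subr_eq addrC; apply/eqP; apply: cE.
have /eqP := E2_class_d_v (E2_classB ch xk) e.
by rewrite subr_eq0 => /eqP ->.
Qed.

End Borel.

(** * Coinvariants under PGL2 and under PGE2 *)

Section Cosets.
Variable A : comPzRingType.
Implicit Types (k g : PGL2 A) (x y : point A).

Local Notation inE k := (k \in @in_PGE2 A).

Lemma inE1 : inE (1%g : PGL2 A).
Proof. by have [] := in_PGE2_closed A. Qed.
Lemma inEM k g : inE k -> inE g -> inE (k * g)%g.
Proof. exact: (group_closedM (in_PGE2_closed A)). Qed.
Lemma inEV k : inE k -> inE k^-1%g.
Proof. exact: (group_closedV (in_PGE2_closed A)). Qed.

Lemma pick_one_ex (P : PGL2 A -> Prop) :
  exists k, ((exists k, P k) -> P k) /\ (P 1%g -> k = 1%g).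
Proof.
case: (pselect (P 1%g)) => [p1|n1]; first by exists 1%g.
case: (pselect (exists k, P k)) => [[k pk]|n]; first by exists k.
by exists 1%g.
Qed.
Definition pick_one P : PGL2 A := sval (cid (pick_one_ex P)).

Lemma pick_oneP P : (exists k, P k) -> P (pick_one P).
Proof. by rewrite /pick_one; case: cid => k /= [h _]. Qed.
Lemma pick_one1 (P : PGL2 A -> Prop) : P 1%g -> pick_one P = 1%g.
Proof. by rewrite /pick_one; case: cid => k /= [_ h]. Qed.

(** The choice of [1] in the trivial coset makes the retraction below the identity
    on chains of [GE2]-points. *)
Definition crep k : PGL2 A := pick_one (fun k' => inE (k^-1 * k')%g).

Lemma crepP k : inE (k^-1 * crep k)%g.
Proof. by apply: (@pick_oneP (fun k' => inE (k^-1 * k')%g)); exists k; rewrite mulVg inE1. Qed.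

Lemma crep_eq k k' : inE (k^-1 * k')%g -> crep k = crep k'.
Proof.
move=> kk'; congr pick_one; apply/funext => l; apply/propext; split=> h.
  have -> : (k'^-1 * l = (k^-1 * k')^-1 * (k^-1 * l))%g.
    by rewrite invgM invgK -mulgA (mulgA k) mulgV mul1g.
  exact: inEM (inEV kk') h.
have -> : (k^-1 * l = (k^-1 * k') * (k'^-1 * l))%g.
  by rewrite -mulgA (mulgA k') mulgV mul1g.
exact: inEM kk' h.
Qed.

Lemma crep1 k : inE k -> crep k = 1%g.
Proof.
move=> kE; rewrite -(@crep_eq 1%g) ?invg1 ?mul1g //.
by apply: pick_one1; rewrite invg1 mul1g inE1.
Qed.

Lemma GE2point_pinfP x : x \in @in_GE2point A <->
  exists2 k, inE k & x = point_act k (pinf A).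
Proof.
split=> [xE|[k kE ->]].
  have [h [hE e]] := GE2point_pinf (exist _ x xE); exists (\pi_(PGL2 A) h) => //.
  by rewrite unfold_in; apply/asboolP; exists h.
exact: (valP (GE2point_act (exist _ k kE) (std_point A 0))).
Qed.

Lemma inE_stab k : point_act k (pinf A) = pinf A -> inE k.
Proof.
rewrite -[k]reprK => /stab_pinf e; rewrite unfold_in; apply/asboolP.
by exists (repr k) => //; apply: GE2_upper.
Qed.

(** The stabiliser of the point at infinity consists of upper triangular matrices,
    which lie in [GE2]. *)
Lemma inE_act k x : x \in @in_GE2point A -> point_act k x \in @in_GE2point A -> inE k.
Proof.
move=> /GE2point_pinfP[g gE ->] /GE2point_pinfP[g' g'E e].
rewrite -[k]mul1g -(mulgV g') -mulgA; apply: inEM => //.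
rewrite -[(_ * k)%g]mulg1 -(mulgV g) mulgA; apply: inEM; last exact: inEV.
by apply: inE_stab; rewrite !point_actM e -point_actM mulVg point_act1.
Qed.

Lemma inE_act_point k x : inE k -> x \in @in_GE2point A -> point_act k x \in @in_GE2point A.
Proof.
move=> kE /GE2point_pinfP[g gE ->]; apply/GE2point_pinfP.
by exists (k * g)%g; [apply: inEM|rewrite point_actM].
Qed.

Lemma point_pinf x : exists k, x = point_act k (pinf A).
Proof.
have [g e] := vec_GL2 x; exists (\pi_(PGL2 A) g).
apply/esym/(act_class g (class_pinf A) (in_class_vec x)); exists 1; first exact: is_unit1.
by rewrite scale1r e colE delta0_col2.
Qed.

(** The coset of [PGE2] that moves the [GE2]-points to the connected component of [x],
    through its chosen representative. *)
Definition comp x : PGL2 A := crep (sval (cid (point_pinf x))).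

Lemma comp_eq k x : x \in @in_GE2point A -> comp (point_act k x) = crep k.
Proof.
move=> xE; rewrite /comp; case: cid => l /= e; apply/esym/crep_eq.
apply: (@inE_act _ (pinf A)); first by apply/GE2point_pinfP; exists 1%g; rewrite ?inE1 ?point_act1.
by rewrite point_actM -e -point_actM mulVg point_act1.
Qed.

Lemma comp_GE2 x : point_act (comp x)^-1%g x \in @in_GE2point A.
Proof.
rewrite /comp; case: cid => l /= e; apply/GE2point_pinfP.
exists ((crep l)^-1 * l)%g; last by rewrite point_actM -e.
have -> : ((crep l)^-1 * l = (l^-1 * crep l)^-1)%g by rewrite invgM invgK.
exact: inEV (crepP l).
Qed.

Lemma comp_act g x : comp (point_act g x) = crep (g * comp x)%g.
Proof.
rewrite -{1}[x]point_act1 -(mulgV (comp x)) point_actM -point_actM.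
exact: comp_eq (comp_GE2 x).
Qed.

(** By [edge_GE2] a point that is joined to a [GE2]-point is a [GE2]-point; the
    general case follows by translation. *)
Lemma comp_pair x y : pair_invertible x y -> comp x = comp y.
Proof.
move=> xy; pose k := comp x.
have kxy : pair_invertible (point_act k^-1%g x) (point_act k^-1%g y).
  exact: point_act_rel.
pose x' : GE2point A := Sub (point_act k^-1%g x) (comp_GE2 x).
have [h [hE [_ _ e]]] := @edge_GE2 A x' _ kxy.
have yE : point_act k^-1%g y \in @in_GE2point A.
  rewrite e; apply: inE_act_point; last exact: (valP (std_point A 1)).
  by rewrite unfold_in; apply/asboolP; exists h.
have ey : y = point_act k (point_act k^-1%g y) by rewrite -point_actM mulgV point_act1.
have ex : x = point_act k (point_act k^-1%g x) by rewrite -point_actM mulgV point_act1.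
by rewrite ey ex !comp_eq // comp_GE2.
Qed.

End Cosets.

Section Retraction.
Variable A : comPzRingType.
Local Notation X := (Lconf A).
Local Notation Y := (Yconf A).
Implicit Types k g : PGL2 A.

Definition ccomp n (c : config X n) : PGL2 A := comp (tnth (val c) 0).

Lemma ccompE n (c : config X n) i : comp (tnth (val c) i) = ccomp c.
Proof.
case: (eqVneq i 0) => [->//|i0]; apply: comp_pair.
by have /'forall_forallP/(_ i 0)/implyP/(_ i0) := valP c.
Qed.

Lemma config_incl_inj n : injective (@config_incl A n).
Proof.
move=> c c' /(congr1 val) /= e; apply: cpt_inj => i.
by have := congr1 (fun t => tnth t i) e; rewrite !tnth_map.
Qed.

Lemma config_incl_ex n (c : config X n) :
  exists c' : config Y n, config_incl c' = config_act (ccomp c)^-1%g c.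
Proof.
have cE i : point_act (ccomp c)^-1%g (tnth (val c) i) \in @in_GE2point A.
  by rewrite -(ccompE c i) comp_GE2.
pose p i : GE2point A := Sub (point_act (ccomp c)^-1%g (tnth (val c) i)) (cE i).
pose t : n.+1.-tuple Y := [tuple p i | i < n.+1].
have tE i : val (tnth t i) = point_act (ccomp c)^-1%g (tnth (val c) i).
  by rewrite tnth_mktuple.
have tC : in_config t.
  apply/'forall_forallP => i j; apply/implyP => ij.
  have := valP (config_act (ccomp c)^-1%g c) => /'forall_forallP/(_ i j)/implyP/(_ ij).
  rewrite (tnth_map _ (val c) i) (tnth_map _ (val c) j).
  by change (pair_invertible (point_act (ccomp c)^-1%g (tnth (val c) i))
      (point_act (ccomp c)^-1%g (tnth (val c) j)) ->
    pair_invertible (val (tnth t i)) (val (tnth t j))); rewrite -!tE.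
exists (exist _ t tC); apply: val_inj; apply: eq_from_tnth => i.
exact: etrans (tnth_map _ t i) (etrans (tE i) (esym (tnth_map _ (val c) i))).
Qed.

Definition retr n (c : config X n) : config Y n := sval (cid (config_incl_ex c)).
Lemma retrE n (c : config X n) : config_incl (retr c) = config_act (ccomp c)^-1%g c.
Proof. exact: (svalP (cid (config_incl_ex c))). Qed.

Lemma config_incl_face n (i : 'I_n.+2) (c : config Y n.+1) :
  config_incl (face i c) = face i (config_incl c).
Proof. by apply: val_inj; apply: eq_from_tnth => j; rewrite tnth_map !tnth_mktuple tnth_map. Qed.

Lemma config_incl_act n (p : PGE2 A) (c : config Y n) :
  config_incl (config_act p c) = config_act (val p) (config_incl c).
Proof. by apply: val_inj; apply: eq_from_tnth => j; rewrite !tnth_map. Qed.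

Lemma ccomp_face n (i : 'I_n.+2) (c : config X n.+1) : ccomp (face i c) = ccomp c.
Proof. by rewrite /ccomp tnth_mktuple ccompE. Qed.

Lemma ccomp_act n g (c : config X n) : ccomp (config_act g c) = crep (g * ccomp c)%g.
Proof. by rewrite /ccomp tnth_map comp_act. Qed.

Lemma ccomp_incl n (c : config Y n) : ccomp (config_incl c) = 1%g.
Proof.
rewrite /ccomp tnth_map; set x := tnth _ _.
by rewrite -[X in comp X]point_act1 (comp_eq 1%g (valP x)) crep1 // inE1.
Qed.

Lemma retr_face n (i : 'I_n.+2) (c : config X n.+1) : retr (face i c) = face i (retr c).
Proof.
by apply: config_incl_inj; rewrite config_incl_face !retrE ccomp_face face_act.
Qed.

Lemma retr_incl n (c : config Y n) : retr (config_incl c) = c.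
Proof.
by apply: config_incl_inj; rewrite retrE ccomp_incl invg1 config_act1.
Qed.

Fact twist_subproof g k : ((crep (g * k))^-1 * (g * k))%g \in @in_PGE2 A.
Proof.
have -> : ((crep (g * k))^-1 * (g * k) = ((g * k)^-1 * crep (g * k))^-1)%g.
  by rewrite (invgM (g * k)^-1%g) invgK.
exact: inEV (crepP _).
Qed.
(** The element of [PGE2] by which [g] acts on the component of [k], once this
    component and its image are both identified with the base component. *)
Definition twist g k : PGE2 A := Sub ((crep (g * k))^-1 * (g * k))%g (twist_subproof g k).

Lemma retr_act n g (c : config X n) :
  retr (config_act g c) = config_act (twist g (ccomp c)) (retr c).
Proof.
apply: config_incl_inj; rewrite config_incl_act !retrE ccomp_act -!config_actM.
by rewrite /= -!mulgA mulgV mulg1.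
Qed.

End Retraction.

Lemma bar0B (G : groupType) (M : gmod G) (x y : M) :
  << x - y *g tup0 >> = << x *g tup0 >> - << y *g tup0 >> :> bar M 0.
Proof. exact: monalgUB. Qed.
Lemma bar0D (G : groupType) (M : gmod G) (x y : M) :
  << x + y *g tup0 >> = << x *g tup0 >> + << y *g tup0 >> :> bar M 0.
Proof. exact: monalgUD. Qed.
Lemma bar00 (G : groupType) (M : gmod G) : << (0 : M) *g tup0 >> = 0 :> bar M 0.
Proof. exact: monalgU0. Qed.

Lemma malgU_inj (K : choiceType) (V : zmodType) (k : K) (x y : V) :
  << x *g k >> = << y *g k >> :> {malg V[K]} -> x = y.
Proof. by move=> /(congr1 (fun m : {malg V[K]} => m@_k)); rewrite !mcoeffUU. Qed.

Lemma bar0_inj (G : groupType) (M : gmod G) (x y : M) :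
  << x *g tup0 >> = << y *g tup0 >> :> bar M 0 -> x = y.
Proof. exact: (@malgU_inj (0.-tuple G) M tup0). Qed.

Lemma malgU_full (K : choiceType) (V : zmodType) (k : K) (x : {malg V[K]}) :
  (forall k', k' = k) -> x = << x@_k *g k >>.
Proof. by move=> kE; apply/malgP => k'; rewrite (kE k') mcoeffUU. Qed.

Lemma bar0_ex (G : groupType) (M : gmod G) (x : bar M 0) : exists m, x = << m *g tup0 >>.
Proof. by exists x@_tup0; apply: malgU_full; apply: tup0E. Qed.

Lemma bar_d_coinvariants (G : groupType) (M : gmod G) (I : Type) (s : seq I)
    (a : I -> G) (m : I -> M) :
  exists e : bar M 1,
    bar_d e = << \sum_(i <- s) (gact (a i) (m i) - m i) *g tup0 >>.
Proof.
elim: s => [|i s [e eE]].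
  by exists 0; rewrite bar_d0 big_nil; apply/esym/bar00.
exists (<< m i *g tup1 (a i)^-1%g >> + e).
by rewrite bar_dD eE bar_d1E invgK big_cons bar0D bar0B.
Qed.

Definition cproj_gen (A : comPzRingType) n k (c : config (Lconf A) n) :
  conf_chain (Yconf A) n := if ccomp c == k then ccell (retr c) else 0.

HB.lock Definition cproj (A : comPzRingType) n k :
    conf_chain (Lconf A) n -> conf_chain (Yconf A) n :=
  free_lift (@cproj_gen A n k).
HB.lock Definition cretr (A : comPzRingType) n :
    conf_chain (Lconf A) n -> conf_chain (Yconf A) n :=
  free_lift (fun c : config (Lconf A) n => ccell (retr c)).
HB.lock Definition cincl (A : comPzRingType) n :
  conf_chain (Yconf A) n -> conf_chain (Lconf A) n := @Y_incl A n.

Section ChainRetraction.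
Variable A : comPzRingType.
Local Notation X := (Lconf A).
Local Notation Y := (Yconf A).
Implicit Types k g : PGL2 A.

Lemma cprojB n k (x y : conf_chain X n) : cproj k (x - y) = cproj k x - cproj k y.
Proof. by rewrite [cproj]unlock; apply: raddfB. Qed.
Lemma cretrB n (x y : conf_chain X n) : cretr (x - y) = cretr x - cretr y.
Proof. by rewrite [cretr]unlock; apply: raddfB. Qed.
Lemma cinclB n (x y : conf_chain Y n) : cincl (x - y) = cincl x - cincl y.
Proof. by rewrite [cincl]unlock; apply: (raddfB (free_lift _)). Qed.

Lemma cincl_def n (x : conf_chain Y n) : cincl x = Y_incl x.
Proof. by rewrite [cincl]unlock. Qed.

Lemma cprojU n k (c : config X n) : cproj k (ccell c) = cproj_gen k c.
Proof. by rewrite [cproj]unlock ccellE free_liftU mulr1z. Qed.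
Lemma cretrU n (c : config X n) : cretr (ccell c) = ccell (retr c).
Proof. by rewrite [cretr]unlock ccellE free_liftU mulr1z. Qed.
Lemma cinclU n (c : config Y n) : cincl (ccell c) = ccell (config_incl c).
Proof. by rewrite [cincl]unlock !ccellE; apply: etrans (free_liftU _ _ _) (mulr1z _). Qed.

Lemma cprojD n k (x y : conf_chain X n) : cproj k (x + y) = cproj k x + cproj k y.
Proof. by rewrite [cproj]unlock; apply: raddfD. Qed.
Lemma cretrD n (x y : conf_chain X n) : cretr (x + y) = cretr x + cretr y.
Proof. by rewrite [cretr]unlock; apply: raddfD. Qed.
Lemma cinclD n (x y : conf_chain Y n) : cincl (x + y) = cincl x + cincl y.
Proof. by rewrite [cincl]unlock; apply: (raddfD (free_lift _)). Qed.
Lemma cproj0 n k : @cproj A n k 0 = 0. Proof. by rewrite -(subrr 0) cprojB subrr. Qed.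
Lemma cretr0 n : @cretr A n 0 = 0. Proof. by rewrite -(subrr 0) cretrB subrr. Qed.
Lemma cincl0 n : @cincl A n 0 = 0. Proof. by rewrite -(subrr 0) cinclB subrr. Qed.
Lemma chain_act0 (G : groupType) (Z : gconf G) n (g : G) :
  chain_act g (0 : conf_chain Z n) = 0.
Proof. exact: raddf0. Qed.

Lemma chain_diff_cproj k (x : conf_chain X 2) :
  cproj k (chain_diff x) = chain_diff (cproj k x).
Proof.
elim/conf_chain_ind: x => [|x y IHx IHy|c].
- by rewrite chain_diff0 !cproj0 chain_diff0.
- by rewrite chain_diffB !cprojB chain_diffB IHx IHy.
rewrite chain_diff2 cprojD cprojB !cprojU /cproj_gen !ccomp_face !retr_face.
by case: eqP => _; rewrite ?chain_diff2 // subrr add0r chain_diff0.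
Qed.

Lemma chain_diff_cretr (x : conf_chain X 2) : cretr (chain_diff x) = chain_diff (cretr x).
Proof.
elim/conf_chain_ind: x => [|x y IHx IHy|c].
- by rewrite chain_diff0 !cretr0 chain_diff0.
- by rewrite chain_diffB !cretrB chain_diffB IHx IHy.
by rewrite chain_diff2 cretrD cretrB !cretrU !retr_face chain_diff2.
Qed.

Lemma chain_diff_cincl (x : conf_chain Y 2) : cincl (chain_diff x) = chain_diff (cincl x).
Proof.
elim/conf_chain_ind: x => [|x y IHx IHy|c].
- by rewrite chain_diff0 !cincl0 chain_diff0.
- by rewrite chain_diffB !cinclB chain_diffB IHx IHy.
by rewrite chain_diff2 cinclD cinclB !cinclU !config_incl_face chain_diff2.
Qed.

Lemma cincl_act n (p : PGE2 A) (x : conf_chain Y n) :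
  cincl (chain_act p x) = chain_act (val p) (cincl x).
Proof.
elim/conf_chain_ind: x => [|x y IHx IHy|c].
- by rewrite chain_act0 !cincl0 chain_act0.
- by rewrite chain_actB !cinclB chain_actB IHx IHy.
by rewrite !cinclU !ccell_act cinclU config_incl_act.
Qed.

Lemma cretr_incl n (x : conf_chain Y n) : cretr (cincl x) = x.
Proof.
elim/conf_chain_ind: x => [|x y IHx IHy|c].
- by rewrite cincl0 cretr0.
- by rewrite cinclB cretrB IHx IHy.
by rewrite cinclU cretrU retr_incl.
Qed.

(** The points of a configuration all lie in one component, so a chain is the sum
    of translates of chains on the base component. *)
Lemma cproj_decomp n (x : conf_chain X n) : exists s : seq (PGL2 A),
  [/\ x = \sum_(k <- s) chain_act k (cincl (cproj k x)),
      cretr x = \sum_(k <- s) cproj k x &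
      forall g, cretr (chain_act g x) =
        \sum_(k <- s) chain_act (twist g k) (cproj k x)].
Proof.
suff [s0 s0P] : exists s0 : seq (PGL2 A), forall s, uniq s -> {subset s0 <= s} ->
    [/\ x = \sum_(k <- s) chain_act k (cincl (cproj k x)),
      cretr x = \sum_(k <- s) cproj k x &
      forall g, cretr (chain_act g x) =
        \sum_(k <- s) chain_act (twist g k) (cproj k x)].
  by exists (undup s0); apply: s0P; rewrite ?undup_uniq // => k; rewrite mem_undup.
elim/conf_chain_ind: x => [|x y [s1 IH1] [s2 IH2]|c].
- exists [::] => s _ _; split=> [||g]; apply/esym.
  + by apply: big1 => k _; rewrite cproj0 cincl0 chain_act0.
  + by rewrite cretr0; apply: big1 => k _; rewrite cproj0.
  + by rewrite chain_act0 cretr0; apply: big1 => k _; rewrite cproj0 chain_act0.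
- exists (s1 ++ s2) => s us ss.
  have [|e1 e2 e3] := IH1 s us _; first by move=> k ks; apply: ss; rewrite mem_cat ks.
  have [|f1 f2 f3] := IH2 s us _; first by move=> k ks; apply: ss; rewrite mem_cat ks orbT.
  split=> [||g].
  + rewrite {1}e1 {1}f1 -sumrB; apply: eq_bigr => k _.
    by rewrite cprojB cinclB chain_actB.
  + by rewrite cretrB e2 f2 -sumrB; apply: eq_bigr => k _; rewrite cprojB.
  + rewrite chain_actB cretrB e3 f3 -sumrB; apply: eq_bigr => k _.
    by rewrite cprojB chain_actB.
exists [:: ccomp c] => s us ss; have cs : ccomp c \in s by apply: ss; rewrite mem_head.
have p0 k : k != ccomp c -> cproj k (ccell c) = 0.
  by rewrite cprojU /cproj_gen eq_sym => /negPf->.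
have p1 : cproj (ccomp c) (ccell c) = ccell (retr c) by rewrite cprojU /cproj_gen eqxx.
split=> [||g]; rewrite (bigD1_seq _ cs us) /= p1 big1 ?addr0.
- by rewrite cinclU retrE ccell_act -config_actM mulgV config_act1.
- by move=> k /p0->; rewrite cincl0 chain_act0.
- by rewrite cretrU.
- by move=> k /p0->.
- by rewrite !ccell_act cretrU retr_act.
- by move=> k /p0->; rewrite chain_act0.
Qed.

End ChainRetraction.

Section ScissorsCoinvariants.
Variable A : comPzRingType.

Lemma Z2_GL2P (z : Z2_GL2 A) : chain_diff (val z) = 0.
Proof. by apply/eqP; have := valP z. Qed.
Lemma Z2_GE2P (z : Z2_GE2 A) : chain_diff (val z) = 0.
Proof. by apply/eqP; have := valP z. Qed.

Definition mkZL (m : conf_chain (Lconf A) 2) (mP : chain_diff m = 0) : Z2_GL2 A :=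
  exist _ m (introT eqP mP).
Definition mkZE (m : conf_chain (Yconf A) 2) (mP : chain_diff m = 0) : Z2_GE2 A :=
  exist _ m (introT eqP mP).

Fact cprojZ_subproof k (z : Z2_GL2 A) : chain_diff (cproj k (val z)) = 0.
Proof. by rewrite -chain_diff_cproj Z2_GL2P cproj0. Qed.
Definition cprojZ k z : Z2_GE2 A := mkZE (cprojZ_subproof k z).

Fact cretrZ_subproof (z : Z2_GL2 A) : chain_diff (cretr (val z)) = 0.
Proof. by rewrite -chain_diff_cretr Z2_GL2P cretr0. Qed.
Definition cretrZ z : Z2_GE2 A := mkZE (cretrZ_subproof z).

Fact cinclZ_subproof (z : Z2_GE2 A) : chain_diff (cincl (val z)) = 0.
Proof. by rewrite -chain_diff_cincl Z2_GE2P cincl0. Qed.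
Definition cinclZ z : Z2_GL2 A := mkZL (cinclZ_subproof z).

Fact cretrZ_additive : zmod_morphism cretrZ.
Proof. by move=> x y; apply: val_inj; apply: cretrB. Qed.
HB.instance Definition _ :=
  GRing.isZmodMorphism.Build (Z2_GL2 A) (Z2_GE2 A) cretrZ cretrZ_additive.
Fact cinclZ_additive : zmod_morphism cinclZ.
Proof. by move=> x y; apply: val_inj; apply: cinclB. Qed.
HB.instance Definition _ :=
  GRing.isZmodMorphism.Build (Z2_GE2 A) (Z2_GL2 A) cinclZ cinclZ_additive.

Lemma val_sum_ZL (s : seq (PGL2 A)) (f : PGL2 A -> Z2_GL2 A) :
  val (\sum_(k <- s) f k) = \sum_(k <- s) val (f k).
Proof. exact: (raddf_sum (ker_incl (chain_hom (Lconf A) 1))). Qed.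
Lemma val_sum_ZE (s : seq (PGL2 A)) (f : PGL2 A -> Z2_GE2 A) :
  val (\sum_(k <- s) f k) = \sum_(k <- s) val (f k).
Proof. exact: (raddf_sum (ker_incl (chain_hom (Yconf A) 1))). Qed.

(** Replace each translate in [cproj_decomp] by the untranslated chain. *)
Lemma scissors_surj (z : Z2_GL2 A) : exists (z' : Z2_GE2 A) (e : bar (Z2_GL2 A) 1),
  bar_d e = << z *g tup0 >> - << cinclZ z' *g tup0 >>.
Proof.
have [s [zE _ _]] := cproj_decomp (val z).
have [e eE] := @bar_d_coinvariants _ (Z2_GL2 A) _ s id (fun k => cinclZ (cprojZ k z)).
exists (\sum_(k <- s) cprojZ k z), e.
have -> : cinclZ (\sum_(k <- s) cprojZ k z) = \sum_(k <- s) cinclZ (cprojZ k z).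
  exact: raddf_sum.
have e1 : z = \sum_(k <- s) gact k (cinclZ (cprojZ k z)).
  by apply: val_inj; rewrite val_sum_ZL {1}zE.
rewrite eE sumrB -e1; exact: bar0B.
Qed.

(** The retraction is not equivariant, but it takes [g z] to the sum of the parts of
    [z] moved by elements of [PGE2], so it respects coinvariants. *)
Lemma cretr_coinvariants (e : bar (Z2_GL2 A) 1) :
  exists (z : Z2_GL2 A) (e' : bar (Z2_GE2 A) 1),
    bar_d e = << z *g tup0 >> /\ bar_d e' = << cretrZ z *g tup0 >>.
Proof.
rewrite [e]monalgE; apply: (big_ind (fun e : bar (Z2_GL2 A) 1 =>
  exists (z : Z2_GL2 A) (e' : bar (Z2_GE2 A) 1),
    bar_d e = << z *g tup0 >> /\ bar_d e' = << cretrZ z *g tup0 >>)).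
- exists 0, 0; rewrite !bar_d0 (raddf0 cretrZ).
  by split; apply/esym; apply: bar00.
- move=> x y [z [e1 [xE e1E]]] [t [e2 [yE e2E]]]; exists (z + t), (e1 + e2).
  rewrite !bar_dD xE yE e1E e2E (raddfD cretrZ).
  by split; apply/esym; apply: bar0D.
move=> t _; move: (e@_t) => z; elim/tuple1_ind: t => g.
have [s [_ zE zgE]] := cproj_decomp (val z).
have [e' e'E] := @bar_d_coinvariants _ (Z2_GE2 A) _ s (twist g^-1%g) (fun k => cprojZ k z).
exists (gact g^-1%g z - z), e'; rewrite bar_d1E e'E; split.
  exact/esym/bar0B.
congr (<< _ *g _ >>); rewrite sumrB (raddfB cretrZ); congr (_ - _); apply: val_inj.
  by rewrite val_sum_ZE; apply/esym/zgE.
by rewrite val_sum_ZE; apply/esym/zE.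
Qed.

Lemma scissors_inj (z' : Z2_GE2 A) (e : bar (Z2_GL2 A) 1) :
    bar_d e = << cinclZ z' *g tup0 >> ->
  exists e' : bar (Z2_GE2 A) 1, bar_d e' = << z' *g tup0 >>.
Proof.
have [z [e' [-> e'E]]] := cretr_coinvariants e.
move=> /bar0_inj zE.
exists e'; rewrite e'E zE; congr (<< _ *g _ >>); apply: val_inj.
exact: cretr_incl.
Qed.

Lemma scissors_push (z' : Z2_GE2 A) (e' : bar (Z2_GE2 A) 1) :
    bar_d e' = << z' *g tup0 >> ->
  exists e : bar (Z2_GL2 A) 1, bar_d e = << cinclZ z' *g tup0 >>.
Proof.
move=> e'E; pose F n := @bar_map _ _ (Z2_GE2 A) (Z2_GL2 A) (val : PGE2 A -> PGL2 A) (@cinclZ) n.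
exists (F 1%N e'); have FE : F 0%N (bar_d e') = bar_d (F 1%N e').
  apply: bar_map_dG => // g m; apply: val_inj; apply: cincl_act.
rewrite -FE e'E; apply: etrans (bar_mapU _ _ _ _) _.
by congr (<< _ *g _ >>); apply: tup0E.
Qed.

End ScissorsCoinvariants.

(** * The scissors congruence group on the second page *)

Lemma six_faces (V : zmodType) (x00 x10 x01 x11 x02 x12 : V) :
  x01 = x00 -> x02 = x10 -> x12 = x11 -> x00 - x10 - (x01 - x11) + (x02 - x12) = 0.
Proof. by move=> -> -> ->; zmodule. Qed.

Section ScissorsPage.
Variable A : comPzRingType.
Hypothesis A_univ : universal_for_GE2 A.
Local Notation Y := (Yconf A).

Lemma csumB n (x y : conf_chain Y n) :
  csum (x - y : chain_gmod Y n) = csum (x : chain_gmod Y n) - csum (y : chain_gmod Y n).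
Proof. exact: raddfB. Qed.
Lemma csumD n (x y : conf_chain Y n) :
  csum (x + y : chain_gmod Y n) = csum (x : chain_gmod Y n) + csum (y : chain_gmod Y n).
Proof. exact: raddfD. Qed.
Lemma csum_ccell n (c : config Y n) : csum (ccell c : chain_gmod Y n) = 1.
Proof. by rewrite ccellE csumU. Qed.

(** A triangle has three faces, with signs 1, -1, 1. *)
Lemma csum_chain_diff (m : conf_chain Y 2) :
  csum (chain_diff m : chain_gmod Y 1) = csum (m : chain_gmod Y 2).
Proof.
elim/conf_chain_ind: m => [|x y IHx IHy|c].
- by rewrite chain_diff0 !raddf0.
- by rewrite chain_diffB !csumB IHx IHy.
by rewrite chain_diff2 csumD csumB !csum_ccell subrr add0r.
Qed.

Lemma face_face (c : config Y 2) : [/\ face 0 (face 1 c) = face 0 (face 0 c),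
  face 0 (face 2%:R c) = face 1 (face 0 c) & face 1 (face 2%:R c) = face 1 (face 1 c)].
Proof.
by split; apply: cpt_inj => i; rewrite !cpt_face (ord1 i); congr cpt; apply: val_inj.
Qed.

Lemma chain_diff_diff (m : conf_chain Y 2) : chain_diff (chain_diff m) = 0.
Proof.
elim/conf_chain_ind: m => [|x y IHx IHy|c].
- by rewrite !chain_diff0.
- by rewrite !chain_diffB IHx IHy subrr.
rewrite chain_diff2 chain_diffD chain_diffB !chain_diff1.
have [e1 e2 e3] := face_face c.
exact: six_faces (congr1 (@ccell _ _ _) e1) (congr1 (@ccell _ _ _) e2) (congr1 (@ccell _ _ _) e3).
Qed.

Definition bar2 q : bar (chain_gmod Y 2) q -> D A 1 q :=
  @bar_map _ _ _ _ idfun (chain_hom Y 1) q.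

Lemma bar2B q (x y : bar (chain_gmod Y 2) q) : bar2 (x - y) = bar2 x - bar2 y.
Proof. exact: raddfB. Qed.
Lemma bar2_d q (x : bar (chain_gmod Y 2) q.+1) : bar2 (bar_d x) = d_v (bar2 x).
Proof. exact: bar_map_d. Qed.
Lemma d_h_bar2 q (x : bar (chain_gmod Y 2) q) : d_h (bar2 x : D A 1 q) = 0.
Proof. by apply: bar_map_comp0 => m; apply: chain_diff_diff. Qed.
Lemma bar2_exact q (x : D A 1 q) : d_h x = 0 -> exists c, bar2 c = x.
Proof. by apply: bar_map_exact => m; apply: Y_exact1. Qed.
Lemma bar_map0 (M N : gmod (PGE2 A)) (f : gmod_hom M N) m :
  bar_map idfun f (<< m *g tup0 >> : bar M 0) = << f m *g tup0 >>.
Proof. by apply: etrans (bar_mapU _ _ _ _) _; rewrite (tup0E (map_tuple _ _)). Qed.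

Lemma bar2E (m : chain_gmod Y 2) (n : chain_gmod Y 1) : chain_diff m = n ->
  bar2 << m *g tup0 >> = << n *g tup0 >>.
Proof. by move=> <-; apply: (bar_map0 (chain_hom Y 1)). Qed.

Definition Z2_incl q : bar (Z2_GE2 A) q -> bar (chain_gmod Y 2) q :=
  @bar_map _ _ _ _ idfun (ker_incl (chain_hom Y 1)) q.

Lemma Z2_inclE (z : Z2_GE2 A) : Z2_incl << z *g tup0 >> = << val z *g tup0 >>.
Proof. exact: (bar_map0 (ker_incl (chain_hom Y 1))). Qed.
Lemma Z2_incl_d q (x : bar (Z2_GE2 A) q.+1) : Z2_incl (bar_d x) = bar_d (Z2_incl x).
Proof. exact: bar_map_d. Qed.
Lemma Z2_inclB q (x y : bar (Z2_GE2 A) q) : Z2_incl (x - y) = Z2_incl x - Z2_incl y.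
Proof. exact: raddfB. Qed.
Lemma bar2_Z2_incl q (x : bar (Z2_GE2 A) q) : bar2 (Z2_incl x) = 0.
Proof. by apply: bar_map_comp0 => m; apply: Z2_GE2P. Qed.
Lemma bar2_ker q (x : bar (chain_gmod Y 2) q) : bar2 x = 0 -> exists y, Z2_incl y = x.
Proof. by apply: bar_map_exact => m m0; exists (mkZE m0). Qed.
Lemma Z2_incl_inj q (x y : bar (Z2_GE2 A) q) : Z2_incl x = Z2_incl y -> x = y.
Proof.
move=> e; apply/eqP; rewrite -subr_eq0; apply/eqP.
apply: (@bar_map_inj _ _ _ (ker_incl (chain_hom Y 1)) q).
  by move=> m m0; apply: val_inj.
by change (Z2_incl (x - y) = 0); rewrite Z2_inclB e subrr.
Qed.

Lemma coinvariants_Y2 (m : conf_chain Y 2) : csum (chain_diff m : chain_gmod Y 1) = 0 ->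
  exists c : bar (chain_gmod Y 2) 1, bar_d c = << m *g tup0 >>.
Proof. by rewrite csum_chain_diff; apply: coinvariants_csum0 (@trans2 A) _. Qed.

(** The element is the boundary of a chain [n] of triples. Its coefficient sum is
    that of the boundary, which vanishes since the boundary dies in the
    coinvariants of pairs; so [n] dies in the coinvariants of triples. *)
Lemma col20 (x : D A 2 0) (y : D A 1 1) : d_h x = d_v y -> exists w : D A 2 1, d_v w = x.
Proof.
have [m ->] := bar0_ex x => xy.
have dhx : d_h (<< m *g tup0 >> : D A 2 0) = << val m *g tup0 >>.
  exact: (bar_map0 (ker_incl (chain_hom Y 0))).
have m0 : chain_diff (val m) = 0 by apply/eqP; have := valP m.
have [n nE] := Y_exact1 A_univ m0.
have [c cE] : exists c : bar (chain_gmod Y 2) 1, bar_d c = << n *g tup0 >>.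
  apply: coinvariants_Y2; rewrite nE; move: (csum_bar_d (y : bar (chain_gmod Y 1) 1)).
  by rewrite -[bar_d _]xy dhx; apply: etrans; congr csum; apply/esym/mcoeffUU.
have [w wE] := row1_exact (d_h_bar2 c).
exists w; apply/eqP; rewrite -subr_eq0; apply/eqP/row2_inj.
rewrite d_hB d_hv wE dhx -bar2_d cE; apply/eqP; rewrite subr_eq0; apply/eqP.
exact: bar2E nE.
Qed.

(** A cycle of triples has coefficient sum zero, so it dies in the coinvariants of
    triples: the connecting map is onto. That the class it comes from survives to
    the second page follows from [phi], which detects [H_1(PGE2, Y_1)] and vanishes
    on cycles of pairs. *)
Lemma scissors_graph_of (z' : Z2_GE2 A) (a : scissors A) :
  has_class (<< cinclZ z' *g tup0 >> : bar (Z2_GL2 A) 0) a ->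
  exists h, scissors_graph a h.
Proof.
move=> za; have [c cE] : exists c : bar (chain_gmod Y 2) 1, bar_d c = << val z' *g tup0 >>.
  by apply: coinvariants_Y2; rewrite Z2_GE2P raddf0.
have [w wE] := row1_exact (d_h_bar2 c).
have vc : d_v (bar2 c) = 0 by rewrite -bar2_d cE -Z2_inclE bar2_Z2_incl.
have dw : d_v w = 0 by apply: row2_inj; rewrite d_hv wE.
have [y yE] : exists y, d_v y = bar2 c.
  by apply: phi_detects vc _; rewrite phi_d_h d_h_bar2 lam_map0 oppr0.
have wy : d_h w = d_v y by rewrite wE yE.
have [h wh] := @E2_class_exS A 1 1 w y dw wy.
exists h, (cinclZ z'), z', c, w; split=> //.
by rewrite -cincl_def.
Qed.

Lemma scissors_class0 (x : bar (Z2_GL2 A) 0) :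
  has_class x (0 : scissors A) <-> exists e, bar_d e = x.
Proof. by split=> [/has_class0P[]|e] //; apply/has_class0P. Qed.

Lemma scissors_graph_ex (a : scissors A) : exists h, scissors_graph a h.
Proof.
have [x xa] := has_class_surj a; have [z zE] := bar0_ex x; rewrite zE in xa.
have [z' [e eE]] := scissors_surj z; apply: (@scissors_graph_of z').
have e0 : has_class (bar_d e) (0 : scissors A) by apply/scissors_class0; exists e.
have := has_classB xa e0; by rewrite eE subr0 subKr.
Qed.

Lemma scissors_graph_surj (h : E2 A 2 1) : exists a, scissors_graph a h.
Proof.
have [w wh] := E2_class_surj h; have dw : d_v w = 0 by apply: E2_class_out wh.
have [c cE] := bar2_exact (d_hh0 w).
have [x xE] : exists x, Z2_incl x = bar_d c.
  by apply: bar2_ker; rewrite bar2_d cE -d_hv dw d_h0.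
have [z' z'E] := bar0_ex x.
have [a za] := has_class_ex (@bar_d _ (Z2_GL2 A) 0)
  (erefl : bar_out (Z2_GL2 A) 0 (<< cinclZ z' *g tup0 >> : bar (Z2_GL2 A) 0) = 0).
exists a, (cinclZ z'), z', c, w; split=> //; first by rewrite -cincl_def.
by rewrite -xE z'E; apply: Z2_inclE.
Qed.

Lemma scissors_graphB (a a' : scissors A) h h' : scissors_graph a h -> scissors_graph a' h' ->
  scissors_graph (a - a') (h - h').
Proof.
move=> [z [z' [c [w [za zz' cE wE wh]]]]] [t [t' [d [v [ta tt' dE vE vh]]]]].
exists (z - t), (z' - t'), (c - d), (w - v); split.
- have -> : << z - t *g tup0 >> = << z *g tup0 >> - << t *g tup0 >> :> bar (Z2_GL2 A) 0.
    exact: bar0B.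
  exact: has_classB.
- have e : val (z - t) = val z - val t by [].
  have e' : val (z' - t') = val z' - val t' by [].
  by rewrite e e' zz' tt' -!cincl_def cinclB.
- have e' : val (z' - t') = val z' - val t' by [].
  by rewrite bar_dB cE dE e'; apply/esym/bar0B.
- by rewrite d_hB wE vE; apply/esym/bar2B.
- exact: E2_classB.
Qed.

Lemma cinclZ_eq (z : Z2_GL2 A) (z' : Z2_GE2 A) : val z = Y_incl (val z') -> z = cinclZ z'.
Proof. by move=> e; apply: val_inj; rewrite e -cincl_def. Qed.

(** The action on triples is simply transitive, so their [H_1] vanishes and the
    connecting map is injective. *)
Lemma scissors_graph0 h : scissors_graph (0 : scissors A) h -> h = 0.
Proof.
move=> [z [z' [c [w [/scissors_class0[e eE] /cinclZ_eq zz' cE wE wh]]]]].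
rewrite zz' in eE; have [e' e'E] := scissors_inj eE.
have [y yE] : exists y : bar (chain_gmod Y 2) 2, bar_d y = c - Z2_incl e'.
  apply: (free_H1 (@trans2 A) (@stab2_trivial A)).
  by rewrite bar_dB -Z2_incl_d e'E Z2_inclE cE; apply: subrr.
have wy : d_h w = d_v (bar2 y).
  by rewrite -bar2_d yE bar2B bar2_Z2_incl subr0; apply: wE.
have [w' w'E] := row1_exact (d_h_bar2 y).
apply: (E2_class_d_v (y := w') wh); apply/eqP; rewrite -subr_eq0; apply/eqP/row2_inj.
by rewrite d_hB d_hv w'E wy subrr.
Qed.

(** The third column being the last one, a class that vanishes on the second page
    is a vertical boundary; correcting [c] by a lift of it gives a chain of cycles. *)
Lemma scissors_graph_inj (a : scissors A) : scissors_graph a 0 -> a = 0.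
Proof.
move=> [z [z' [c [w [za /cinclZ_eq zz' cE wE /E2_class0[y [y' [_ wy]]]]]]]].
have {}wy : w = d_v y by rewrite wy (D3_0 y') d_h0 addr0.
have [f fE] := bar2_exact (d_hh0 y).
have [c' c'E] : exists c', Z2_incl c' = c - bar_d f.
  by apply: bar2_ker; rewrite bar2B bar2_d fE -d_hv -wy wE; apply: subrr.
have [e eE] : exists e : bar (Z2_GL2 A) 1, bar_d e = << cinclZ z' *g tup0 >>.
  apply: (@scissors_push _ z' c'); apply: Z2_incl_inj.
  rewrite Z2_incl_d c'E bar_dB bar_dd subr0 Z2_inclE; exact: cE.
apply: has_class_uniq za _; apply/scissors_class0; exists e; rewrite zz'; exact: eE.
Qed.
End ScissorsPage.

(** * The exact sequence *)

Lemma graph_uniq (U V : zmodType) (R : U -> V -> Prop) :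
    (forall x x' y y', R x y -> R x' y' -> R (x - x') (y - y')) ->
    (forall y, R 0 y -> y = 0) ->
  forall x y y', R x y -> R x y' -> y = y'.
Proof.
move=> RB R0 x y y' xy xy'; apply/eqP; rewrite -subr_eq0; apply/eqP/R0.
by rewrite -(subrr x); apply: RB.
Qed.

Lemma iso_of_graph (U V : zmodType) (R : U -> V -> Prop) :
    (forall x, exists y, R x y) ->
    (forall x x' y y', R x y -> R x' y' -> R (x - x') (y - y')) ->
    (forall y, R 0 y -> y = 0) -> (forall x, R x 0 -> x = 0) ->
    (forall y, exists x, R x y) ->
  exists f : {additive U -> V}, [/\ bijective f, forall x, R x (f x) &
    forall y, exists x, f x = y].
Proof.
move=> Rtot RB R0 R_inj R_surj; have [f fR] := additive_of_graph Rtot RB R0.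
have f_surj y : exists x, f x = y.
  have [x xy] := R_surj y; exists x; apply: (graph_uniq RB R0) (fR x) xy.
exists f; split=> //; apply: additive_bijective f_surj => x fx.
by apply: R_inj; rewrite -fx.
Qed.

Lemma map_of_graph (U V W : zmodType) (R : U -> W -> Prop) (i : {additive V -> W}) :
    bijective i -> (forall y, exists x, i x = y) ->
    (forall x, exists y, R x y) ->
    (forall x x' y y', R x y -> R x' y' -> R (x - x') (y - y')) ->
    (forall y, R 0 y -> y = 0) ->
  exists f : {additive U -> V}, forall x, R x (i (f x)).
Proof.
move=> /bij_inj i_inj i_surj Rtot RB R0.
apply: (@additive_of_graph _ _ (fun x v => R x (i v))) => [x|x x' y y' xy xy'|y /R0 iy].
- by have [y xy] := Rtot x; have [v vE] := i_surj y; exists v; rewrite vE.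
- by rewrite raddfB; apply: RB.
by apply: i_inj; rewrite iy raddf0.
Qed.

Section MainProof.
Variable A : comPzRingType.

Lemma mu2_iso : exists iM : mu2 A -> E2 A 1 1, [/\ bijective iM,
  forall a, mu2_graph a (iM a), forall y, exists a, iM a = y &
  forall a b, iM (a * b)%g = iM a + iM b].
Proof.
pose iM a : E2 A 1 1 := sval (cid (mu2_graph_ex a)).
have iMP a : mu2_graph a (iM a) by apply: (svalP (cid (mu2_graph_ex a))).
have iM_M a b : iM (a * b)%g = iM a + iM b.
  exact: mu2_graph_uniq (iMP _) (mu2_graphM (iMP a) (iMP b)).
have iM_surj y : exists a, iM a = y.
  by have [a ay] := mu2_graph_surj y; exists a; apply: mu2_graph_uniq (iMP a) ay.
have iM1 : iM 1%g = 0 by apply: (addIr (iM 1%g)); rewrite -iM_M mul1g add0r.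
have iM_V a : iM a^-1%g = - iM a.
  by apply: (addIr (iM a)); rewrite -iM_M mulVg iM1 addNr.
have iM_inj : injective iM.
  move=> a b ab; apply: (mulIg b^-1%g); rewrite mulgV; apply: mu2_graph_inj.
  by have := iMP (a * b^-1)%g; rewrite iM_M iM_V ab subrr.
exists iM; split=> //; exists (fun y => sval (cid (iM_surj y))) => [a|y].
  by apply: iM_inj; rewrite (svalP (cid (iM_surj _))).
exact: (svalP (cid (iM_surj y))).
Qed.
End MainProof.

Theorem corollary7p6 (A : comPzRingType) :
  universal_for_GE2 A ->
  exists (iP : {additive scissors A -> E2 A 2 1})
         (iB : {additive H_PB2 A 2 -> E2 A 0 2})
         (iM : mu2 A -> E2 A 1 1)
         (f1 : {additive H_PGE2 A 3 -> scissors A})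
         (f2 : {additive scissors A -> H_PB2 A 2})
         (f3 : {additive H_PB2 A 2 -> H_PGE2 A 2})
         (f4 : H_PGE2 A 2 -> mu2 A),
    [/\ [/\ bijective iP, bijective iB, bijective iM &
            forall a b, iM (a * b)%g = (iM a + iM b)%R],
        [/\ forall a, scissors_graph a (iP a),
            forall a, PB2_graph a (iB a) &
            forall a, mu2_graph a (iM a)],
        [/\ forall x, @edge_to A 2 1 x (iP (f1 x)),
            forall a, @d2_graph A 0 1 (iP a) (iB (f2 a)),
            forall b, @edge_from A 2 (iB b) (f3 b) &
            forall x, @edge_to A 1 1 x (iM (f4 x))] &
        [/\ exact_at f1 f2,
            exact_at f2 f3,
            forall x y, f4 (x + y)%R = (f4 x * f4 y)%g,
            forall x, (exists b, f3 b = x) <-> f4 x = 1%g &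
            forall a, exists x, f4 x = a]].
Proof.
move=> A_univ; have col := @col20 A A_univ.
have [iP [iP_bij iPP iP_surj]] := iso_of_graph (@scissors_graph_ex A)
  (fun a a' h h' => @scissors_graphB A a a' h h') (@scissors_graph0 A)
  (@scissors_graph_inj A A_univ) (@scissors_graph_surj A A_univ).
have [iB [iB_bij iBP iB_surj]] := iso_of_graph (@PB2_graph_ex A)
  (fun a a' h h' => @PB2_graphB A a a' h h') (@PB2_graph0 A)
  (@PB2_graph_inj A) (@PB2_graph_surj A).
have [iM [iM_bij iMP iM_surj iM_M]] := mu2_iso A.
have iP_inj := bij_inj iP_bij; have iB_inj := bij_inj iB_bij; have iM_inj := bij_inj iM_bij.
have iM1 : iM 1%g = 0 by apply: (addIr (iM 1%g)); rewrite -iM_M mul1g add0r.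
have [f1 f1P] := map_of_graph iP_bij iP_surj (@edge_to21_ex A) (@edge_to21B A)
  (@edge_to21_0 A).
have f1_uniq := graph_uniq (@edge_to21B A) (@edge_to21_0 A).
have f2_uniq := graph_uniq (@d2B A) (@d2_0 A).
have f3_uniq := graph_uniq (@edge_fromB A) (@edge_from_0 A).
have f4_uniq := graph_uniq (@edge_to11B A) (@edge_to11_0 A).
have [f2 f2P] : exists f2 : {additive scissors A -> H_PB2 A 2},
    forall a, @d2_graph A 0 1 (iP a) (iB (f2 a)).
  apply: (map_of_graph (R := fun a h => @d2_graph A 0 1 (iP a) h) iB_bij iB_surj).
  - by move=> a; apply: d2_ex.
  - by move=> a a' h h' ah ah'; rewrite raddfB; apply: d2B.
  - by move=> h; rewrite raddf0; apply: d2_0.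
have [f3 f3P] : exists f3 : {additive H_PB2 A 2 -> H_PGE2 A 2},
    forall b, @edge_from A 2 (iB b) (f3 b).
  apply: (@additive_of_graph _ _ (fun b x => @edge_from A 2 (iB b) x)).
  - by move=> b; apply: edge_from_ex.
  - by move=> b b' x x' bx bx'; rewrite raddfB; apply: edge_fromB.
  - by move=> x; rewrite raddf0; apply: edge_from_0.
have [e4 e4P] := additive_of_graph (edge_to11_ex col) (@edge_to11B A)
  (@edge_to11_0 A).
pose f4 x := sval (cid (iM_surj (e4 x))).
have f4E x : iM (f4 x) = e4 x by apply: (svalP (cid (iM_surj (e4 x)))).
have f4P x : @edge_to A 1 1 x (iM (f4 x)) by rewrite f4E.
exists iP, iB, iM, f1, f2, f3, f4; split=> //; split.
- move=> a; split=> [[x <-]|a0].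
    apply: iB_inj; rewrite raddf0; apply: f2_uniq (f2P _) _.
    exact: edge_to21_d2 (f1P x).
  have := f2P a; rewrite a0 raddf0 => /d2_edge_to21[x xa].
  by exists x; apply/iP_inj/(f1_uniq x).
- move=> b; split=> [[a <-]|b0].
    exact: f3_uniq (f3P _) (d2_edge_from (f2P a)).
  have := f3P b; rewrite b0 => /edge_from_d2[h hb].
  have [a ah] := iP_surj h; exists a; apply: iB_inj.
  by apply: f2_uniq (f2P a) _; rewrite ah.
- by move=> x y; apply: iM_inj; rewrite iM_M !f4E raddfD.
- move=> x; split=> [[b <-]|x1].
    apply: iM_inj; rewrite iM1; apply: f4_uniq (f4P _) _.
    exact: edge_from_to11 (f3P b).
  have := f4P x; rewrite x1 iM1 => /edge_to11_from[h hx].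
  have [b bh] := iB_surj h; exists b.
  by apply: f3_uniq (f3P b) _; rewrite bh.
- move=> a; have [x xa] := edge_to11_surj (iM a); exists x.
  exact: iM_inj (f4_uniq x _ _ (f4P x) xa).
Qed.
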